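(* Let $G$ be a finite simple undirected graph without isolated vertices. The following statements are equivalent: (i) The Gallai graph $\Gamma(G)$ of $G$ is a tree. (ii) Every non-trivial homogeneous set in $G$ is independent, and $G$ is a chordal graph containing none of $F_1,\ldots,F_9$ (described in the context) as an induced subgraph. (iii) $G$ is isomorphic to the graph $F_8^-$ (described in the context), or $G$ is connected and satisfies all of the following: every block of $G$ is isomorphic to $K_2$, $K_3$, or the gem; every cut-vertex of $G$ lies in at most two blocks and has degree at most $3$ in $G$; every block of $G$ isomorphic to $K_3$ contains exactly two cut-vertices of $G$; every block of $G$ isomorphic to the gem contains exactly one cut-vertex of $G$.
   Context: For a graph $G$, the Gallai graph $\Gamma(G)$ has vertex set $E(G)$, and two distinct edges $e,f$ of $G$ are adjacent in $\Gamma(G)$ if $e$ and $f$ share an endpoint in $G$ but do not span a triangle in $G$ (i.e., if $e=uv$, $f=vw$ with $u\neq w$, then $uw\notin E(G)$). A graph is chordal if it has no induced cycle of length at least $4$. A set $U\subseteq V(G)$ is homogeneous if every vertex of $V(G)\setminus U$ is adjacent either to all vertices of $U$ or to none of them; it is non-trivial if $|U|\notin\{0,1,|V(G)|\}$. The gem is the graph on five vertices consisting of an induced path $a_1a_2a_3a_4$ together with a fifth vertex adjacent to all of $a_1,a_2,a_3,a_4$. Blocks are maximal connected subgraphs without a cut-vertex (of themselves). The graph $F_8^-$ has vertices $a,b,c,d,e,f$ and edges $ab,ad,bd,bc,be,cd,ce,cf,ef$. The graphs $F_1,\dots,F_9$ are given by vertex sets and edge lists: $F_1$: vertices $1,2,3,4$;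 edges $14,24,34$ (the claw). $F_2$: vertices $1,\dots,5$; edges $12,15,25,34,35,45$. $F_3$: vertices $1,\dots,6$; edges $12,16,23,25,26,35,36,34,45,56$. $F_4$: vertices $1,\dots,6$; edges $12,23,34,25,35,56$. $F_5$: vertices $1,\dots,6$; edges $24,25,45,12,14,23,35,46,56$. $F_6$: vertices $1,\dots,6$; edges $12,23,34,45,26,36,46$. $F_7$: vertices $1,\dots,7$; edges $12,23,34,45,56,27,37,47,57$. $F_8$: vertices $1,\dots,7$; edges $12,15,25,26,56,23,36,37,67,34,47$. $F_9$: vertices $1,\dots,7$; edges $12,14,23,24,25,27,36,35,37,45,47,56,57$. ''Contains $H$ as an induced subgraph'' means some subset of vertices of $G$ induces a graph isomorphic to $H$. *)

(* Defs.v *)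
From mathcomp Require Import all_boot.

Set Implicit Arguments.
Unset Strict Implicit.
Unset Printing Implicit Defensive.

Record sgraph := SGraph {
  svertex :> finType;
  sedge : rel svertex;
  sg_sym : symmetric sedge;
  sg_irrefl : irreflexive sedge }.

Arguments sedge {s} x y.

Notation "x -- y" := (sedge x y) (at level 30).

Definition isomorphic (G H : sgraph) : Prop :=
  exists2 f : G -> H, bijective f & forall x y : G, (f x -- f y) = (x -- y).

Section Graph.
Variable G : sgraph.

Definition no_isolated_vertex : Prop := forall x : G, exists y, x -- y.

Definition degree (v : G) : nat := #|[set y | v -- y]|.

Definition connected : bool :=
  (0 < #|G|) && [forall x : G, forall y : G, connect sedge x y].

(* A cycle is the repetition-free sequence of its vertices; cyclic sequences
   of length at most 2 are not cycles of a simple graph. *)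
Definition acyclic : Prop := forall s : seq G, ucycle sedge s -> size s < 3.

Definition tree : Prop := connected /\ acyclic.

Definition independent (U : {set G}) : Prop := {in U &, forall x y, ~~ (x -- y)}.

Definition homogeneous (U : {set G}) : Prop :=
  forall x, x \notin U ->
    {in U, forall y, x -- y} \/ {in U, forall y, ~~ (x -- y)}.

Definition nontrivial (U : {set G}) : bool := #|U| \notin [:: 0; 1; #|G|].

Section Induced.
Variable S : {set G}.

Definition induced_rel : rel {x | x \in S} := [rel x y | val x -- val y].

Lemma induced_sym : symmetric induced_rel.
Proof. by move=> x y; apply: sg_sym. Qed.

Lemma induced_irrefl : irreflexive induced_rel.
Proof. by move=> x; apply: sg_irrefl. Qed.

Definition induced : sgraph := SGraph induced_sym induced_irrefl.
End Induced.

Definition contains_induced (H : sgraph) : Prop :=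
  exists S : {set G}, isomorphic (induced S) H.

(* v separates two other vertices of the same connected component, i.e.,
   deleting v increases the number of components. *)
Definition cut_vertex (v : G) : bool :=
  [exists x : induced [set~ v], exists y : induced [set~ v],
     connect sedge (val x) (val y) && ~~ connect sedge x y].

Definition edges : {set {set G}} :=
  [set A | [exists x : G, exists y : G, (x -- y) && (A == [set x; y])]].

Definition gallai_rel : rel {A | A \in edges} :=
  [rel A B | [exists u : G, exists v : G, exists w : G,
     [&& u != w, val A == [set u; v], val B == [set v; w] & ~~ (u -- w)]]].

Lemma gallai_sym : symmetric gallai_rel.
Proof.
suff H A B : gallai_rel A B -> gallai_rel B A by move=> A B; apply/idP/idP; apply: H.
move=> /existsP[u /existsP[v /existsP[w /and4P[uw /eqP AE /eqP BE nuw]]]].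
apply/existsP; exists w; apply/existsP; exists v; apply/existsP; exists u.
by rewrite /= AE BE eq_sym uw sg_sym nuw ![[set v; _]]setUC !eqxx.
Qed.

Lemma gallai_irrefl : irreflexive gallai_rel.
Proof.
move=> A; apply/negbTE/negP.
move=> /existsP[u /existsP[v /existsP[w /and4P[uw /eqP AE /eqP BE _]]]].
have := valP A; rewrite inE => /existsP[x /existsP[y /andP[xy /eqP AxyE]]].
have uv : u != v.
  apply/eqP => uv; move: AE; rewrite uv setUid AxyE => xyE.
  have := set21 x y; rewrite xyE inE => /eqP xv.
  have := set22 x y; rewrite xyE inE => /eqP yv.
  by move: xy; rewrite xv yv sg_irrefl.
have : u \in [set v; w] by rewrite -BE AE set21.
by rewrite !inE (negbTE uv) (negbTE uw).
Qed.

Definition gallai : sgraph := SGraph gallai_sym gallai_irrefl.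

Definition subgraph : finType :=
  {p : {set G} * {set {set G}} |
     (p.2 \subset edges) && [forall A in p.2, A \subset p.1]}.

Definition sub_vertices (H : subgraph) : {set G} := (val H).1.
Definition sub_edges (H : subgraph) : {set {set G}} := (val H).2.

Section GraphOfSubgraph.
Variable H : subgraph.

Definition sub_rel : rel {x | x \in sub_vertices H} :=
  [rel x y | [set val x; val y] \in sub_edges H].

Lemma sub_rel_sym : symmetric sub_rel.
Proof. by move=> x y; rewrite /sub_rel /= setUC. Qed.

Lemma sub_rel_irrefl : irreflexive sub_rel.
Proof.
move=> x; apply/negbTE/negP => /= xH.
have /andP[/subsetP/(_ _ xH)] := valP H.
rewrite inE setUid => /existsP[a /existsP[b /andP[ab /eqP xE]]] _.
have := set21 a b; rewrite -xE inE => /eqP ax.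
have := set22 a b; rewrite -xE inE => /eqP bx.
by move: ab; rewrite ax bx sg_irrefl.
Qed.

Definition graph_of : sgraph := SGraph sub_rel_sym sub_rel_irrefl.
End GraphOfSubgraph.

Definition sub_le (H K : subgraph) : bool :=
  (sub_vertices H \subset sub_vertices K) && (sub_edges H \subset sub_edges K).

End Graph.

Definition nonseparable (G : sgraph) : bool :=
  connected G && [forall v : G, ~~ cut_vertex v].

Definition block (G : sgraph) (H : subgraph G) : bool :=
  nonseparable (graph_of H) &&
  [forall K : subgraph G, sub_le H K && nonseparable (graph_of K) ==> (K == H)].

Definition blocks_at (G : sgraph) (v : G) : {set subgraph G} :=
  [set H | block H & v \in sub_vertices H].

Definition cut_vertices_in (G : sgraph) (H : subgraph G) : {set G} :=
  [set v in sub_vertices H | cut_vertex v].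

Section ConcreteGraphs.
Variable n : nat.

Definition symm_rel (r : rel 'I_n) : rel 'I_n :=
  [rel i j | (i != j) && (r i j || r j i)].

Lemma symm_rel_sym r : symmetric (symm_rel r).
Proof. by move=> i j; rewrite /symm_rel /= eq_sym orbC. Qed.

Lemma symm_rel_irrefl r : irreflexive (symm_rel r).
Proof. by move=> i; rewrite /symm_rel /= eqxx. Qed.

Definition symm_graph (r : rel 'I_n) : sgraph :=
  SGraph (symm_rel_sym r) (symm_rel_irrefl r).

Definition complete_graph : sgraph := symm_graph [rel i j | true].

(* This is the cycle C_n only for n >= 3. *)
Definition cycle_graph : sgraph := symm_graph [rel i j : 'I_n | i.+1 %% n == j :> nat].

(* The vertices are 1, ..., n in the edge list: i : 'I_n stands for i.+1. *)
Definition graph_of_edges (s : seq (nat * nat)) : sgraph :=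
  symm_graph [rel i j : 'I_n | (i.+1, j.+1) \in s].

End ConcreteGraphs.

Definition chordal (G : sgraph) : Prop :=
  forall n, 4 <= n -> ~ contains_induced G (cycle_graph n).

(* The path is 1 2 3 4. *)
Definition gem : sgraph := graph_of_edges 5
  [:: (1,2); (2,3); (3,4); (1,5); (2,5); (3,5); (4,5)].

Definition F1 : sgraph := graph_of_edges 4 [:: (1,4); (2,4); (3,4)].

Definition F2 : sgraph := graph_of_edges 5
  [:: (1,2); (1,5); (2,5); (3,4); (3,5); (4,5)].

Definition F3 : sgraph := graph_of_edges 6
  [:: (1,2); (1,6); (2,3); (2,5); (2,6); (3,5); (3,6); (3,4); (4,5); (5,6)].

Definition F4 : sgraph := graph_of_edges 6
  [:: (1,2); (2,3); (3,4); (2,5); (3,5); (5,6)].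

Definition F5 : sgraph := graph_of_edges 6
  [:: (2,4); (2,5); (4,5); (1,2); (1,4); (2,3); (3,5); (4,6); (5,6)].

Definition F6 : sgraph := graph_of_edges 6
  [:: (1,2); (2,3); (3,4); (4,5); (2,6); (3,6); (4,6)].

Definition F7 : sgraph := graph_of_edges 7
  [:: (1,2); (2,3); (3,4); (4,5); (5,6); (2,7); (3,7); (4,7); (5,7)].

Definition F8 : sgraph := graph_of_edges 7
  [:: (1,2); (1,5); (2,5); (2,6); (5,6); (2,3); (3,6); (3,7); (6,7); (3,4);
      (4,7)].

Definition F9 : sgraph := graph_of_edges 7
  [:: (1,2); (1,4); (2,3); (2,4); (2,5); (2,7); (3,6); (3,5); (3,7); (4,5);
      (4,7); (5,6); (5,7)].

Definition F8minus : sgraph :=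
  let: (a, b, c, d, e, f) := (1, 2, 3, 4, 5, 6) in
  graph_of_edges 6
    [:: (a,b); (a,d); (b,d); (b,c); (b,e); (c,d); (c,e); (c,f); (e,f)].

(* Main.v *)
Require Import Defs.
From Stdlib Require Import Classical.
From mathcomp Require Import all_boot.
From mathcomp Require Import zify.

Set Implicit Arguments.
Unset Strict Implicit.
Unset Printing Implicit Defensive.

(** Write P_n^2 for the square of the path on n vertices: K_3 is P_3^2, the gem is
    P_5^2, F_8^- is P_6^2 and F_8 is P_7^2.  The graphs in question are exactly those
    whose vertices can be numbered 0, ..., n-1 so that consecutive vertices are
    adjacent, i and i+2 are adjacent when a bit b(i) is set, and there are no other
    edges; the word b is either 1111 or consists of isolated interior ones, any two
    at distance at least 3, and possibly a run 111 at either end, separated from the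
    other ones by at least two zeros.

    (ii) gives such a numbering.  Adjacent twins are separated by a further vertex,
    and a finite search over graphs with at most 7 vertices, carried out inside the
    logic, then excludes K_4, embeds every diamond in a gem, and shows that a gem is
    attached to the rest of the graph at a single end unless the graph is P_6^2.
    Starting from a gem, or in its absence from the end of a longest induced path
    (here chordality is used), one numbers the vertices one by one.

    From the numbering, the Gallai graph is seen to be a tree by ranking the edges,
    and the blocks are the intervals between consecutive positions that no edge
    jumps over, which gives (iii).  Conversely (iii) gives (ii) because every cycle
    lies in a block, and an induced copy of H in G yields an induced copy of the
    Gallai graph of H in that of G, so that (i) gives (ii). *)

(** * Induced copies *)

(** Each restriction on the word has a local reason. Two ones with a single zero between them are
    triangles sharing only a vertex, the butterfly F_2; hence two zeros. Two consecutive ones make a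
    diamond whose middle vertices are twins, so runs of length two do not survive. A triangle at an
    end of the layout would have two twins, hence [0 < i] and [i + 4 <= n] in [good_word]. A gem
    that is the whole graph would leave its four vertices other than the hub as a homogeneous set,
    hence [6 <= n]. The bounds [5 <= i] and [i + 8 <= n] are the two zeros next to a gem, and
    [10 <= n] leaves two gems joined by an edge. A gem cannot be attached at both ends because of
    F_7 and the 5-cycle.

    The delicate point in building the layout is that a triangle or a gem must not be accepted too
    early: the first is legitimate only if the layout continues behind it. The invariant of the walk
    therefore promises a further neighbour in these cases, and this neighbour is the vertex that
    separates two twins. *)

Section Copy.
Variable G : sgraph.
Implicit Types (r : rel nat) (e : nat -> G).

Lemma sedge_neq (x y : G) : x -- y -> x != y.
Proof. by apply: contraTneq => ->; rewrite sg_irrefl. Qed.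

(** Only the values [r i j] with [i < j] are read, so a pattern need not be symmetric, and [e] is
    total with arbitrary values from [m] on. Copies can thus be truncated, shifted and extended
    without subtypes. *)
Definition copy m r e : Prop :=
  forall i j, i < j < m -> e i != e j /\ (e i -- e j) = r i j.

Lemma copy_inj m r e i j : copy m r e -> i < m -> j < m -> e i = e j -> i = j.
Proof.
move=> ce im jm eij; case: (ltngtP i j) => // ij.
  by have [] := ce i j _; [lia | rewrite eij eqxx].
by have [] := ce j i _; [lia | rewrite eij eqxx].
Qed.

Lemma copy_edge m r e i j : copy m r e -> i < j < m -> (e i -- e j) = r i j.
Proof. by move=> ce ij; have [] := ce i j ij. Qed.

Lemma copy_widen k m r e : k <= m -> copy m r e -> copy k r e.
Proof. by move=> km ce i j ij; apply: ce; lia. Qed.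

Lemma copy_eq m r r' e :
  (forall i j, i < j < m -> r i j = r' i j) -> copy m r e -> copy m r' e.
Proof. by move=> rr' ce i j ij; rewrite -rr' //; apply: ce. Qed.

Definition copy_set m e : {set G} := [set e (val i) | i : 'I_m].

Lemma copy_setP m e x :
  reflect (exists2 i, i < m & x = e i) (x \in copy_set m e).
Proof.
apply: (iffP imsetP) => [[i _ ->] | [i im ->]]; first by exists i.
by exists (Ordinal im); rewrite ?inE.
Qed.

Lemma card_copy_set m r e : copy m r e -> #|copy_set m e| = m.
Proof.
move=> ce; rewrite card_imset ?card_ord // => i j eij.
by apply: val_inj; exact: (copy_inj ce (ltn_ord i) (ltn_ord j) eij).
Qed.

Lemma copy_iso m r e (R : rel 'I_m) :
  copy m r e ->
  (forall i j : 'I_m, i < j -> symm_rel R i j = r i j) ->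
  isomorphic (induced (copy_set m e)) (symm_graph R).
Proof.
move=> ce Rr.
have eS (i : 'I_m) : e i \in copy_set m e by apply/copy_setP; exists i.
pose g (i : 'I_m) : induced (copy_set m e) := Sub (e i) (eS i).
have g_inj : injective g.
  by move=> i j /(congr1 val) /= eij; apply: val_inj; exact: (copy_inj ce (ltn_ord i) (ltn_ord j) eij).
have gR i j : (g i -- g j) = symm_rel R i j.
  have lt_case (a b : 'I_m) : a < b -> (g a -- g b) = symm_rel R a b.
    by move=> ab; rewrite Rr // -(copy_edge ce) // ab ltn_ord.
  case: (ltngtP i j) => [/lt_case // | /lt_case ji | /val_inj ->].
    by rewrite sg_sym ji symm_rel_sym.
  by rewrite sg_irrefl symm_rel_irrefl.
have [|h gh hg] := @inj_card_bij _ _ g g_inj; last first.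
  by exists h => [|x y]; [exists g | rewrite -[x in RHS]hg -[y in RHS]hg gR].
by rewrite card_sig (card_copy_set ce) card_ord.
Qed.

Lemma copy_contains m r e (R : rel 'I_m) :
  copy m r e ->
  (forall i j : 'I_m, i < j -> symm_rel R i j = r i j) ->
  contains_induced G (symm_graph R).
Proof. by move=> ce Rr; exists (copy_set m e); apply: (copy_iso ce Rr). Qed.

Lemma iso_copy m r (S : {set G}) (R : rel 'I_m) :
  0 < m -> isomorphic (induced S) (symm_graph R) ->
  (forall i j : 'I_m, i < j -> symm_rel R i j = r i j) ->
  exists2 e, copy m r e & S = copy_set m e.
Proof.
move=> m0 [f [h fh hf] fR] Rr.
pose e k : G := val (h (odflt (Ordinal m0) (insub k))).
have eE (i : 'I_m) : e i = val (h i) by rewrite /e valK.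
exists e => [i j ij|].
  have [im jm] : i < m /\ j < m by lia.
  rewrite (eE (Ordinal im)) (eE (Ordinal jm)); split.
    apply/eqP => /val_inj /(congr1 f); rewrite !hf => /(congr1 val) /=; lia.
  by rewrite -(Rr (Ordinal im) (Ordinal jm)) /= ?(andP ij).1 // -[LHS]fR !hf.
apply/setP => x; apply/idP/copy_setP => [xS | [i im ->]].
  by exists (f (Sub x xS)); rewrite ?ltn_ord // eE fh.
by rewrite (eE (Ordinal im)) (valP (h _)).
Qed.

Lemma contains_copy m r (R : rel 'I_m) :
  0 < m -> contains_induced G (symm_graph R) ->
  (forall i j : 'I_m, i < j -> symm_rel R i j = r i j) ->
  exists e, copy m r e.
Proof. by move=> m0 [S isoS] Rr; have [e ce _] := iso_copy m0 isoS Rr; exists e. Qed.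

Definition push m e x k : G := if k < m then e k else x.

Lemma copy_push m r e x :
  copy m r e -> (forall i, i < m -> e i != x /\ (e i -- x) = r i m) ->
  copy m.+1 r (push m e x).
Proof.
move=> ce ex i j ij; rewrite /push; have -> : i < m by lia.
case: ltnP => jm; first by apply: ce; lia.
have -> : j = m by lia.
by apply: ex; lia.
Qed.

Definition cyc n i j := (j == i.+1) || (i == 0) && (j == n.-1).

Lemma symm_cyc n (i j : 'I_n) : 2 < n -> i < j ->
  symm_rel [rel i j : 'I_n | i.+1 %% n == j :> nat] i j = cyc n i j.
Proof.
move=> n2 ij; rewrite /cyc /symm_rel /= -val_eqE /= modn_small; last by have := ltn_ord j; lia.
have [jn | jn] := eqVneq j.+1 n.
  by rewrite jn modnn; lia.
by rewrite modn_small; have := ltn_ord j; lia.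
Qed.

Lemma chordal_copyN n e : chordal G -> 4 <= n -> ~ copy n (cyc n) e.
Proof.
move=> Gch n4 ce; apply: (Gch n n4); apply: (copy_contains ce) => i j ij.
by apply: symm_cyc => //; lia.
Qed.

End Copy.

(** * Searching for patterns in small graphs *)

(* [has], [all] and the boolean connectives evaluate all their arguments under
   call by value; these variants are lazy enough for [vm_compute]. *)
Fixpoint lhas T (p : T -> bool) s :=
  if s is x :: s' then if p x then true else lhas p s' else false.
Fixpoint lall T (p : T -> bool) s :=
  if s is x :: s' then if p x then lall p s' else false else true.

Lemma lhasE T (p : T -> bool) s : lhas p s = has p s.
Proof. by elim: s => //= x s ->; case: (p x). Qed.

Lemma lallE T (p : T -> bool) s : lall p s = all p s.
Proof. by elim: s => //= x s ->; case: (p x). Qed.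

(* A graph on 0, ..., n-1 is stored as the list of its n rows; row j lists the
   adjacencies of j to 0, ..., j-1. *)
Definition ladj (g : seq bitseq) i j : bool := nth false (nth [::] g j) i.
Definition gadj g i j : bool := if i < j then ladj g i j else ladj g j i.

Definition graph_list n (r : rel nat) : seq bitseq :=
  [seq [seq r i j | i <- iota 0 j] | j <- iota 0 n].

Lemma size_graph_list n r : size (graph_list n r) = n.
Proof. by rewrite size_map size_iota. Qed.

Lemma ladj_graph_list n r i j : i < j < n -> ladj (graph_list n r) i j = r i j.
Proof.
move=> /andP[ij jn]; rewrite /ladj (nth_map 0) ?size_iota // nth_iota // add0n.
by rewrite (nth_map 0) ?size_iota // nth_iota.
Qed.

(** Backtracking: [l] holds the images of the pattern vertices placed so far, [k] counts those still
    to be placed. *)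
Fixpoint extend (g : seq bitseq) (r : rel nat) (l : seq nat) k : bool :=
  if k is k'.+1 then
    lhas (fun v =>
      if lall (fun i => if nth 0 l i == v then false
                        else gadj g (nth 0 l i) v == r i (size l))
              (iota 0 (size l))
      then extend g r (rcons l v) k' else false)
      (iota 0 (size g))
  else true.

Section Extend.
Variables (G : sgraph) (g : seq bitseq) (e : nat -> G).
Hypothesis ce : copy (size g) (ladj g) e.

Lemma copy_gadj i j : i < size g -> j < size g -> i != j ->
  (e i -- e j) = gadj g i j.
Proof.
move=> ig jg ij; rewrite /gadj; case: ltnP => ij'.
  by apply: (copy_edge ce); lia.
by rewrite sg_sym; apply: (copy_edge ce); lia.
Qed.

Lemma copy_rcons v : (forall i, i < size g -> e i != e (size g) /\
     (e i -- e (size g)) = nth false v i) ->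
  copy (size (rcons g v)) (ladj (rcons g v)) e.
Proof.
move=> ev i j; rewrite size_rcons => ij; rewrite /ladj nth_rcons.
case: (ltngtP j (size g)) => jg; last first.
- by rewrite jg; apply: ev; lia.
- lia.
by have [] := ce (i := i) (j := j) _; first lia.
Qed.

Lemma extend_sound r l k : extend g r l k -> all (gtn (size g)) l ->
  copy (size l) r (fun i => e (nth 0 l i)) ->
  exists2 l', copy (size l + k) r (fun i => e (nth 0 l' i)) & all (gtn (size g)) l'.
Proof.
elim: k l => [|k IH] l /=; first by move=> _ lg cl; exists l; rewrite ?addn0.
rewrite lhasE => /hasP[v]; rewrite mem_iota add0n => /andP[_ vg].
rewrite lallE; case: allP => // lv /IH + lg cl.
rewrite size_rcons addSnnS; apply; first by rewrite all_rcons /= vg lg.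
move=> i j /andP[ij jl]; rewrite !nth_rcons; have il : i < size l by lia.
rewrite il; case: ltnP => jl'; first by apply: cl; lia.
have -> : j = size l by lia.
rewrite eqxx; have := lv i; rewrite mem_iota add0n il => /(_ isT).
have iv : nth 0 l i < size g by move/all_nthP: lg => /(_ 0 _ il).
case: eqVneq => // niv /eqP <-; rewrite copy_gadj //; split=> //.
by apply/eqP => /(copy_inj ce iv vg) /eqP; rewrite (negbTE niv).
Qed.

Lemma extend_complete r e' m k :
  copy m r e' -> (forall i, i < m -> exists2 a, a < size g & e' i = e a) -> k <= m ->
  exists l, [/\ size l = m - k, forall i, i < m - k -> nth 0 l i < size g /\
                 e' i = e (nth 0 l i) & extend g r l k].
Proof.
move=> ce' e'e; elim: k => [|k IH] km.
  have [l [sl ll]] : exists l, size l = m /\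
      (forall i, i < m -> nth 0 l i < size g /\ e' i = e (nth 0 l i)).
    elim: m e'e {ce' km} => [|m IHm] e'e; first by exists [::].
    have [|l [sl ll]] := IHm; first by move=> i im; apply: e'e; lia.
    have [a ag ea] := e'e m (ltnSn m).
    exists (rcons l a); split; first by rewrite size_rcons sl.
    move=> i im; rewrite nth_rcons sl; case: (ltngtP i m) => im'; [exact: ll | lia |].
    by rewrite im'.
  by exists l; rewrite subn0.
have [|l [sl ll El]] := IH; first lia.
case/lastP: l sl ll El => [/=|l v]; first lia.
rewrite size_rcons => sl ll El; exists l; split; first lia.
  move=> i il; have := ll i; rewrite nth_rcons.
  have -> : i < size l by lia.
  by apply; lia.
rewrite /= lhasE; apply/hasP; exists v.
  have := ll (size l); rewrite nth_rcons ltnn eqxx mem_iota add0n.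
  by move=> []; first lia.
rewrite El lallE; case: allP => // -[] i; rewrite mem_iota add0n => il.
have [] := ll i; first lia.
rewrite nth_rcons; have -> : i < size l by lia.
move=> lig e'i; have [] := ll (size l); first lia.
rewrite nth_rcons ltnn eqxx => vg e'v.
have [] := ce' i (size l) _; first lia.
rewrite e'i e'v => neq; case: eqVneq => [E|nv]; first by rewrite E eqxx in neq.
by rewrite copy_gadj // => ->.
Qed.

End Extend.

Definition has_copy g (r : rel nat) m := extend g r [::] m.

Lemma has_copy_sound (G : sgraph) g (e : nat -> G) r m :
  copy (size g) (ladj g) e -> has_copy g r m -> exists e' : nat -> G, copy m r e'.
Proof.
move=> ce /(extend_sound ce) /(_ isT) [] => [i j|l cl _]; first by rewrite ltn0 andbF.
by exists (fun i => e (nth 0 l i)).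
Qed.

(** Meant to be used with a search that fails by computation: then the small graph carries no copy
    of the pattern. *)
Lemma has_copy_complete (G : sgraph) g (e e' : nat -> G) r m :
  copy (size g) (ladj g) e -> copy m r e' ->
  (forall i, i < m -> exists2 a, a < size g & e' i = e a) -> has_copy g r m.
Proof.
move=> ce ce' ee'; have [l []] := extend_complete ce ce' ee' (leqnn m).
by rewrite subnn => /size0nil ->.
Qed.

Definition prel (es : seq (nat * nat)) i j :=
  ((i.+1, j.+1) \in es) || ((j.+1, i.+1) \in es).

Lemma symm_prel n es (i j : 'I_n) : i < j ->
  symm_rel [rel i j : 'I_n | (i.+1, j.+1) \in es] i j = prel es i j.
Proof. by move=> ij; rewrite /symm_rel /= neq_ltn ij. Qed.

Fixpoint bitseqs n : seq bitseq :=
  if n is n'.+1 then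
    [seq false :: v | v <- bitseqs n'] ++ [seq true :: v | v <- bitseqs n']
  else [:: [::]].

Lemma mem_bitseqs v : v \in bitseqs (size v).
Proof.
elim: v => //= b v IH; rewrite mem_cat; case: b.
  by rewrite orbC map_f.
by rewrite map_f.
Qed.

Definition twins g i j : bool :=
  if gadj g i j then
    lall (fun k => if k == i then true else if k == j then true
                   else gadj g i k == gadj g j k) (iota 0 (size g))
  else false.

(* [d] bounds the number of new vertices, each introduced to separate two
   adjacent twins. *)
Fixpoint refuted (ps : seq (nat * rel nat)) d g : bool :=
  if lhas (fun p => has_copy g p.2 p.1) ps then true
  else if d is d'.+1 then
    lhas (fun j => lhas (fun i =>
      if twins g i j then
        lall (fun v => if nth false v i == nth false v j then true
                       else refuted ps d' (rcons g v)) (bitseqs (size g))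
      else false) (iota 0 j)) (iota 0 (size g))
  else false.

Section Refuted.
Variables (G : sgraph) (ps : seq (nat * rel nat)).
Hypothesis ps_free :
  forall m r, List.In (m, r) ps -> forall e : nat -> G, ~ copy m r e.
Hypothesis twin_free : forall x y : G, x -- y ->
  exists z, [/\ z != x, z != y & (z -- x) != (z -- y)].

(** No listed vertex separates the twins [i] and [j], so the vertex given by [twin_free] is new. Its
    adjacencies to the old vertices are one of the rows that were tried, and the copy grows by one
    vertex. *)
Lemma refuted_sound d g (e : nat -> G) :
  refuted ps d g -> copy (size g) (ladj g) e -> False.
Proof.
elim: d g e => [|d IH] g e /= + ce.
  case: ifP => // + _; rewrite lhasE.
  elim: ps ps_free => //= -[m r] qs IHq fr /orP[|/IHq].
    by move=> /(has_copy_sound ce)[e']; apply: fr; left.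
  by apply=> m' r' ?; apply: fr; right.
case: ifP => [+ _|_].
  rewrite lhasE.
  elim: ps ps_free => //= -[m r] qs IHq fr /orP[|/IHq].
    by move=> /(has_copy_sound ce)[e']; apply: fr; left.
  by apply=> m' r' ?; apply: fr; right.
rewrite lhasE => /hasP[j]; rewrite mem_iota add0n => /andP[_ jg].
rewrite lhasE => /hasP[i]; rewrite mem_iota add0n => /andP[_ ij].
case: ifP => // tw; rewrite lallE => /allP allv.
move: tw; rewrite /twins; case: ifP => // adj_ij; rewrite lallE => /allP tw.
have ig : i < size g by lia.
have nij : i != j by lia.
have [|z [zi zj zij]] := @twin_free (e i) (e j).
  by rewrite (copy_gadj ce).
have ze k : k < size g -> e k != z.
  move=> kg; have := tw k; rewrite mem_iota add0n kg => /(_ isT).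
  case: eqVneq => [->|ki]; first by rewrite eq_sym.
  case: eqVneq => [->|kj]; first by rewrite eq_sym.
  rewrite -!(copy_gadj ce) // 1?eq_sym // => /eqP E.
  by apply: contra_neq zij => <-; rewrite ![e k -- _]sg_sym.
pose v := [seq e k -- z | k <- iota 0 (size g)].
have vE k : k < size g -> nth false v k = (e k -- z).
  by move=> kg; rewrite (nth_map 0) ?size_iota // nth_iota.
have sv : size v = size g by rewrite size_map size_iota.
have := mem_bitseqs v; rewrite sv => /allv; rewrite !vE //.
rewrite ![_ -- z]sg_sym (negbTE zij) => /IH; apply.
apply: (@copy_rcons _ _ (push (size g) e z)).
  by move=> a b ab; rewrite /push !ifT; [apply: ce | lia | lia].
by move=> k kg; rewrite /push kg ltnn vE //; split=> //; apply: ze.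
Qed.

End Refuted.

(** Lengths up to 7 suffice: no graph reached by the searches below has more vertices. *)
Definition cycle_patterns : seq (nat * rel nat) :=
  [seq (n, cyc n : rel nat) | n <- [:: 4; 5; 6; 7]].

Definition F_patterns : seq (nat * rel nat) :=
  [:: (4, prel [:: (1,4); (2,4); (3,4)] : rel nat);
   (5, prel [:: (1,2); (1,5); (2,5); (3,4); (3,5); (4,5)] : rel nat);
   (6, prel [:: (1,2); (1,6); (2,3); (2,5); (2,6); (3,5); (3,6); (3,4); (4,5); (5,6)] : rel nat);
   (6, prel [:: (1,2); (2,3); (3,4); (2,5); (3,5); (5,6)] : rel nat);
   (6, prel [:: (2,4); (2,5); (4,5); (1,2); (1,4); (2,3); (3,5); (4,6); (5,6)] : rel nat);
   (6, prel [:: (1,2); (2,3); (3,4); (4,5); (2,6); (3,6); (4,6)] : rel nat);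
   (7, prel [:: (1,2); (2,3); (3,4); (4,5); (5,6); (2,7); (3,7); (4,7); (5,7)] : rel nat);
   (7, prel [:: (1,2); (1,5); (2,5); (2,6); (5,6); (2,3); (3,6); (3,7); (6,7); (3,4);
      (4,7)] : rel nat);
   (7, prel [:: (1,2); (1,4); (2,3); (2,4); (2,5); (2,7); (3,6); (3,5); (3,7); (4,5);
      (4,7); (5,6); (5,7)] : rel nat)].

Definition patterns := cycle_patterns ++ F_patterns.

Definition band (b : nat -> bool) i j := (j == i.+1) || ((j == i.+2) && b i).

Definition sq n : nat * rel nat := (n, band predT : rel nat).

Definition K4_list := graph_list 4 (fun _ _ => true).
Definition sq_list n := graph_list n (band predT).

Lemma refuted_K4 : refuted patterns 3 K4_list.
Proof. by vm_cast_no_check (erefl true). Qed.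

(** [P_4^2] is the diamond, with twins 1 and 2; a single vertex separating them already completes a
    forbidden pattern or a gem. *)
Lemma refuted_sq4 : refuted (sq 5 :: patterns) 1 (sq_list 4).
Proof. by vm_cast_no_check (erefl true). Qed.

(** Depth 0: any attachment to [P_6^2] contains a forbidden pattern at once. *)
Lemma refuted_sq6 v : size v = 6 -> true \in v ->
  refuted patterns 0 (rcons (sq_list 6) v).
Proof.
move=> s6; suff /allP/(_ v): all (fun v => (true \notin v) ||
    refuted patterns 0 (rcons (sq_list 6) v)) (bitseqs 6).
  by rewrite -{1}s6 mem_bitseqs => /(_ isT) /orP[/negP|].
by vm_cast_no_check (erefl true).
Qed.

(** The surviving rows attach the new vertex to nothing, or to exactly one end of the gem, position
    4 or position 0. *)
Lemma refuted_sq5 v : size v = 5 ->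
  [|| v == nseq 5 false, v == rcons (nseq 4 false) true,
      v == true :: nseq 4 false | refuted (sq 6 :: patterns) 1 (rcons (sq_list 5) v)].
Proof.
move=> s5; suff /allP/(_ v): all (fun v => 
  [|| v == nseq 5 false, v == rcons (nseq 4 false) true,
      v == true :: nseq 4 false | refuted (sq 6 :: patterns) 1 (rcons (sq_list 5) v)]) (bitseqs 5).
  by rewrite -{1}s5 mem_bitseqs => /(_ isT).
by vm_cast_no_check (erefl true).
Qed.

(** * Linear layouts *)

Definition layout (G : sgraph) n b (f : nat -> G) : Prop :=
  copy n (band b) f /\ forall x, x \in copy_set n f.

(* [b i] says that vertices i and i+2 are adjacent: a run of ones of length k
   spans the square of a path on k+2 vertices, so [pre] and [suf] announce a gem
   at either end, and the positions of [c] are the isolated triangles. *)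
Definition good_word n (b : nat -> bool) : Prop :=
  exists pre suf : bool, exists c : nat -> bool,
  [/\ forall i, b i = [|| pre && (i < 3), c i | [&& suf, n <= i + 5 & i + 3 <= n]],
      pre || suf -> 6 <= n,
      pre && suf -> 10 <= n &
      forall i, c i -> [&& 0 < i, i + 4 <= n, ~~ c i.+1, ~~ c i.+2,
                         pre ==> (5 <= i) & suf ==> (i + 8 <= n)]].

(** The second alternative is [P_6^2], the run 1111, which [good_word] does not cover. *)
Definition chain (G : sgraph) : Prop :=
  exists n b (f : nat -> G),
    [/\ layout n b f, 1 < n & good_word n b \/ n = 6 /\ b =1 gtn 4].

(* Hypotheses about vertices and edges are useless to [lia] and slow it down. *)
Ltac nat_lia :=
  repeat match goal with
  | H : forall _ : nat, _ |- _ => clear H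
  | H : context [@sedge _] |- _ => clear H
  | H : context [@in_mem] |- _ => clear H
  | H : context [@copy] |- _ => clear H
  | H : is_true (negb (@eq_op _ ?x _)) |- _ =>
      let T := type of x in lazymatch T with nat => fail | _ => clear H end
  end; lia.

Ltac solve_edge :=
  solve [ assumption | by rewrite sg_sym | apply/negbTE; assumption
        | apply/negbTE; rewrite sg_sym; assumption ].
Ltac solve_neq :=
  solve [ assumption | by rewrite eq_sym | by apply: sedge_neq
        | by rewrite eq_sym; apply: sedge_neq ].
Ltac solve_copy :=
  move=> [|[|[|[|[|[|[|?]]]]]]] [|[|[|[|[|[|[|?]]]]]]] //=; rewrite ?andbF // => _;
  (split;
   [ solve_neq
   | match goal with |- _ = ?b => let v := eval vm_compute in b in change b with v end;
     solve_edge ]).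

(** * Local consequences of the forbidden subgraphs *)

Section LocalStructure.
Variable G : sgraph.
Hypothesis G_conn : forall x y : G, connect sedge x y.
Hypothesis G_chordal : chordal G.
Hypothesis G_free :
  forall m r, List.In (m, r) F_patterns -> forall e : nat -> G, ~ copy m r e.
Hypothesis G_twin_free : forall x y : G, x -- y ->
  exists z, [/\ z != x, z != y & (z -- x) != (z -- y)].

Lemma patterns_free m r : List.In (m, r) patterns -> forall e : nat -> G, ~ copy m r e.
Proof.
move=> [[<- <-]|[[<- <-]|[[<- <-]|[[<- <-]|F_mr]]]] e; try exact: chordal_copyN.
exact: G_free F_mr e.
Qed.

Lemma closed_set_full (S : {set G}) (x : G) : x \in S ->
  (forall u v, u \in S -> u -- v -> v \in S) -> forall y, y \in S.
Proof.
move=> xS cl y; have /connectP[p] := G_conn x y.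
elim: p x xS => [|z p IH] x xS /= => [_ -> //|/andP[xz pz] yl].
by apply: (IH z) => //; apply: cl xz.
Qed.

Lemma C4_free (x y z t : G) : x -- y -> y -- z -> z -- t -> t -- x ->
  x != z -> y != t -> ~~ (x -- z) -> ~~ (y -- t) -> False.
Proof.
move=> xy yz zt tx xz yt nxz nyt.
apply: (@chordal_copyN _ 4 (nth x [:: x; y; z; t]) G_chordal) => //.
solve_copy.
Qed.

Lemma claw_free (c x y z : G) : c -- x -> c -- y -> c -- z ->
  x != y -> x != z -> y != z -> ~~ (x -- y) -> ~~ (x -- z) -> y -- z.
Proof.
move=> cx cy cz xy xz yz nxy nxz; apply: contraT => nyz; exfalso.
apply: (G_free (or_introl erefl) (e := nth c [:: x; y; z; c])).
solve_copy.
Qed.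

Lemma butterfly_free (c x y z t : G) : c -- x -> c -- y -> c -- z -> c -- t ->
  x -- y -> z -- t -> ~~ (x -- z) -> ~~ (x -- t) -> ~~ (y -- z) -> ~~ (y -- t) -> False.
Proof.
move=> cx cy cz ct xy zt xz xt yz yt.
have nxz : x != z by apply: contraNneq xt => ->.
have nxt : x != t by apply: contraNneq xz => ->; rewrite sg_sym.
have nyz : y != z by apply: contraNneq yt => ->.
have nyt : y != t by apply: contraNneq yz => ->; rewrite sg_sym.
apply: (G_free (or_intror (or_introl erefl)) (e := nth c [:: x; y; z; t; c])).
solve_copy.
Qed.

Lemma net_free (x y z x' y' z' : G) : x -- y -> y -- z -> x -- z ->
  x -- x' -> y -- y' -> z -- z' -> ~~ (x -- y') -> ~~ (x -- z') ->
  ~~ (y -- x') -> ~~ (y -- z') -> ~~ (z -- x') -> ~~ (z -- y') ->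
  ~~ (x' -- y') -> ~~ (x' -- z') -> ~~ (y' -- z') -> False.
Proof.
move=> xy yz xz xx yy zz xy' xz' yx' yz' zx' zy' nxy nxz nyz.
have n1 : x != y' by apply: contraNneq zy' => <-; rewrite sg_sym.
have n2 : x != z' by apply: contraNneq yz' => <-; rewrite sg_sym.
have n3 : y != x' by apply: contraNneq zx' => <-; rewrite sg_sym.
have n4 : y != z' by apply: contraNneq xz' => <-.
have n5 : z != x' by apply: contraNneq yx' => <-.
have n6 : z != y' by apply: contraNneq xy' => <-.
have n7 : x' != y' by apply: contraNneq xy' => <-.
have n8 : x' != z' by apply: contraNneq xz' => <-.
have n9 : y' != z' by apply: contraNneq yz' => <-.
apply: (G_free (or_intror (or_intror (or_intror (or_introl erefl))))
  (e := nth x [:: x'; x; y; y'; z; z'])).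
solve_copy.
Qed.

Lemma K4_free (x y z t : G) : x -- y -> x -- z -> x -- t -> y -- z -> y -- t ->
  z -- t -> False.
Proof.
move=> xy xz xt yz yt zt.
apply: (refuted_sound patterns_free G_twin_free refuted_K4 (e := nth x [:: x; y; z; t])).
solve_copy.
Qed.

(** In the absence of a gem, [sq 5] may join the forbidden patterns, and separating the twins [y]
    and [z] refutes the diamond. *)
Lemma sq5_of_diamond (x y z t : G) : x -- y -> x -- z -> y -- z -> y -- t -> z -- t ->
  x != t -> ~~ (x -- t) -> exists e : nat -> G, copy 5 (band predT) e.
Proof.
move=> xy xz yz yt zt nxt xt; apply: NNPP => no5.
have fr m r : List.In (m, r) (sq 5 :: patterns) -> forall e : nat -> G, ~ copy m r e.
  by move=> [[<- <-] e ce | /patterns_free //]; apply: no5; exists e.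
apply: (refuted_sound fr G_twin_free refuted_sq4 (e := nth x [:: x; y; z; t])).
solve_copy.
Qed.

Lemma copy_list n r (e : nat -> G) : copy n r e ->
  copy (size (graph_list n r)) (ladj (graph_list n r)) e.
Proof.
by rewrite size_graph_list; apply: copy_eq => i j ij; rewrite ladj_graph_list.
Qed.

Lemma copy_list_push n r (e : nat -> G) y : copy n r e -> y \notin copy_set n e ->
  copy (size (rcons (graph_list n r) [seq e i -- y | i <- iota 0 n]))
    (ladj (rcons (graph_list n r) [seq e i -- y | i <- iota 0 n])) (push n e y).
Proof.
move=> ce yS; apply: copy_rcons.
  apply: copy_list => i j ij; rewrite /push !ifT; [exact: ce | nat_lia | nat_lia].
rewrite size_graph_list => i in'; rewrite /push in' ltnn (nth_map 0) ?size_iota //.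
rewrite nth_iota //; split=> //; apply: contraNneq yS => <-.
by apply/copy_setP; exists i.
Qed.

Lemma sq6_full e : copy 6 (band predT) e -> forall x : G, x \in copy_set 6 e.
Proof.
move=> ce; apply: (@closed_set_full _ (e 0)); first by apply/copy_setP; exists 0.
move=> _ y /copy_setP[i i6 ->] iy; apply: contraT => yS; exfalso.
apply: (refuted_sound patterns_free G_twin_free _ (copy_list_push ce yS)).
apply: refuted_sq6; first by rewrite size_map.
by apply/mapP; exists i => //; rewrite mem_iota.
Qed.

(** * Attachments to a gem *)

Section NoSq6.
Hypothesis no_sq6 : ~ exists e : nat -> G, copy 6 (band predT) e.

Lemma sq5_neighbour (e : nat -> G) y i : copy 5 (band predT) e -> y \notin copy_set 5 e ->
  i < 5 -> e i -- y -> i = 0 \/ i = 4.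
Proof.
move=> ce yS i5 iy; set v := [seq e i -- y | i <- iota 0 5].
have fr m r : List.In (m, r) (sq 6 :: patterns) -> forall e : nat -> G, ~ copy m r e.
  by move=> [[<- <-] e' ce' | /patterns_free //]; apply: no_sq6; exists e'.
have vi : nth false v i by rewrite (nth_map 0) ?size_iota // nth_iota.
have /or4P[/eqP E|/eqP E|/eqP E|ref] := refuted_sq5 (v := v) erefl.
- by move: vi; rewrite E nth_nseq if_same.
- by right; move: vi; rewrite E; case: i i5 {iy} => [|[|[|[|[|]]]]].
- by left; move: vi; rewrite E; case: i i5 {iy} => [|[|[|[|[|]]]]].
by case: (refuted_sound fr G_twin_free ref (copy_list_push ce yS)).
Qed.

Lemma sq5_one_side (e : nat -> G) y z : copy 5 (band predT) e ->
  y \notin copy_set 5 e -> z \notin copy_set 5 e -> e 0 -- y -> e 4 -- z -> False.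
Proof.
move=> ce yS zS y0 z4.
have ySi i : i < 5 -> e i != y.
  by move=> i5; apply: contraNneq yS => <-; apply/copy_setP; exists i.
have zSi i : i < 5 -> e i != z.
  by move=> i5; apply: contraNneq zS => <-; apply/copy_setP; exists i.
have yN i : 0 < i < 4 -> ~~ (e i -- y).
  by move=> i4; apply/negP => /(sq5_neighbour ce yS) []; nat_lia.
have zN i : 0 < i < 4 -> ~~ (e i -- z).
  by move=> i4; apply/negP => /(sq5_neighbour ce zS) []; nat_lia.
have E i j : i < j < 5 -> (e i -- e j) = band predT i j by apply: copy_edge.
have D i j : i < j < 5 -> e i != e j by move=> /ce[].
have e02 : e 0 -- e 2 by rewrite E.
have e01 : e 0 -- e 1 by rewrite E.
have e12 : e 1 -- e 2 by rewrite E.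
have e13 : e 1 -- e 3 by rewrite E.
have e23 : e 2 -- e 3 by rewrite E.
have e24 : e 2 -- e 4 by rewrite E.
have e34 : e 3 -- e 4 by rewrite E.
have e04 : ~~ (e 0 -- e 4) by rewrite E.
have e03 : ~~ (e 0 -- e 3) by rewrite E.
have e14 : ~~ (e 1 -- e 4) by rewrite E.
have d04 : e 0 != e 4 by rewrite D.
have d03 : e 0 != e 3 by rewrite D.
have d14 : e 1 != e 4 by rewrite D.
have y4 : ~~ (e 4 -- y).
  apply/negP => y4; apply: (@C4_free (e 0) (e 2) (e 4) y) => //.
  - by rewrite sg_sym.
  - exact: ySi.
  - exact: yN.
have z0 : ~~ (e 0 -- z).
  apply/negP => z0; apply: (@C4_free (e 0) (e 2) (e 4) z) => //.
  - by rewrite sg_sym.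
  - exact: zSi.
  - exact: zN.
have nyz : y != z by apply: contraNneq y4 => ->.
have y1 := yN 1 isT; have y2 := yN 2 isT; have y3 := yN 3 isT.
have z1 := zN 1 isT; have z2 := zN 2 isT; have z3 := zN 3 isT.
have [dy0 dy1 dy2] := And3 (ySi 0 isT) (ySi 1 isT) (ySi 2 isT).
have [dy3 dy4] := conj (ySi 3 isT) (ySi 4 isT).
have [dz0 dz1 dz2] := And3 (zSi 0 isT) (zSi 1 isT) (zSi 2 isT).
have [dz3 dz4] := conj (zSi 3 isT) (zSi 4 isT).
(* If [y] and [z] are adjacent, they close an induced 5-cycle through [e 0], the hub [e 2] and
   [e 4]. Otherwise they are pendant at the two ends of the gem, which is F_7, the entry of
   [patterns] after four cycles and six graphs. *)
have [yz|nyz'] := boolP (y -- z).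
  apply: (@chordal_copyN _ 5 (nth y [:: y; e 0; e 2; e 4; z]) G_chordal) => //.
  solve_copy.
apply: (patterns_free _ (e := nth y [:: y; e 0; e 1; e 3; e 4; z; e 2])).
  by do 10 right; left.
solve_copy.
Qed.

End NoSq6.

(** * Induced paths and a vertex of degree one *)

Definition ipath k (e : nat -> G) := copy k (fun i j => j == i.+1) e.

(** The first neighbour of [x] behind [i] would close an induced cycle with the segment starting at
    [i]; it has at least four vertices since [e i.+1] is no neighbour. *)
Lemma ipath_gap k (e : nat -> G) x i : ipath k e -> (forall j, j < k -> x != e j) ->
  e i -- x -> ~~ (e i.+1 -- x) -> forall j, i < j < k -> ~~ (e j -- x).
Proof.
move=> ce xe ix ni1 j0 j0k; apply/negP => j0x.
have ex : exists j, (i < j < k) && (e j -- x) by exists j0; rewrite j0x andbT.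
case: (ex_minnP ex) => j /andP[ijk jx] jmin.
have ij : i.+1 < j.
  by rewrite ltn_neqAle (andP ijk).1 andbT; apply: contraNneq ni1 => ->.
apply: (@chordal_copyN _ (j - i).+2 (push (j - i).+1 (fun a => e (i + a)) x) G_chordal).
  nat_lia.
apply: copy_push => [a b ab | a aj].
  have [|? ->] := ce (i + a) (i + b); first nat_lia.
  by split=> //; rewrite /cyc; nat_lia.
split; first by rewrite eq_sym xe //; nat_lia.
rewrite /cyc; have [->|a0] := eqVneq a 0; first by rewrite addn0 ix; nat_lia.
have [->|aj'] := eqVneq a (j - i).
  by rewrite (_ : i + (j - i) = j) ?jx; nat_lia.
apply/idP/idP; last nat_lia.
by move=> ax; have := jmin (i + a); rewrite ax; nat_lia.
Qed.

Lemma ipath_cons k (e : nat -> G) x : ipath k e -> 0 < k -> e 0 -- x ->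
  (forall j, j < k -> x != e j) -> (forall j, 0 < j < k -> ~~ (e j -- x)) ->
  ipath k.+1 (fun i => if i is i'.+1 then e i' else x).
Proof.
move=> ce k0 e0x xe nx [|i] [|j] //= ij; last by rewrite eqSS; apply: ce; nat_lia.
split; first by apply: xe; nat_lia.
rewrite sg_sym; case: j ij => [|j] ij; first by rewrite e0x.
by apply/negbTE/nx; nat_lia.
Qed.

Lemma ipath_grow k (e : nat -> G) x : 1 < k -> ipath k e -> e 0 -- x -> x != e 1 ->
  (exists e', ipath k.+1 e') \/ e 1 -- x.
Proof.
move=> k1 ce e0x xe1; have [|n1x] := boolP (e 1 -- x); [by right | left].
have xe j : j < k -> x != e j.
  case: j => [_|[_ //|j jk]]; first by rewrite eq_sym sedge_neq.
  by apply: contraTneq e0x => ->; rewrite (copy_edge ce).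
exists (fun i => if i is i'.+1 then e i' else x); apply: ipath_cons => //; first nat_lia.
exact: (ipath_gap ce).
Qed.

(** Without a leaf, induced paths would grow for ever. If one could not be extended, its end [e 0]
    and a second neighbour [x] of [e 0] would be adjacent, both joined to [e 1] and not to [e 2]; a
    vertex separating them then creates a diamond or a claw. *)
Lemma end_vertex (x0 : G) : no_isolated_vertex G ->
  ~ (exists e : nat -> G, copy 5 (band predT) e) ->
  exists a c : G, a -- c /\ forall y, a -- y -> y = c.
Proof.
move=> noiso no5; apply: NNPP => noend.
have other a c : a -- c -> exists2 y : G, a -- y & y != c.
  move=> ac; apply: NNPP => no; apply: noend; exists a, c; split=> // y ay.
  by apply/eqP/contraT => yc; case: no; exists y.
have long k : 3 <= k -> exists e, ipath k e.
  elim: k => // k IH; rewrite leq_eqVlt => /orP[/eqP <-|k3].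
    (* An edge and a vertex separating its ends form an induced path on three vertices. *)
    have [y xy] := noiso x0; have [z [zx zy zxy]] := G_twin_free xy.
    have [zx' | zx'] := boolP (z -- x0).
      have zy' : ~~ (z -- y) by move: zxy; rewrite zx'; case: (z -- y).
      exists (nth x0 [:: z; x0; y]); solve_copy.
    have zy' : z -- y by move: zxy; rewrite (negbTE zx'); case: (z -- y).
    exists (nth x0 [:: z; y; x0]); solve_copy.
  have [e ce] := IH k3; case: (classic (exists e', ipath k.+1 e')) => // nogrow; exfalso.
  have k1 : 1 < k by nat_lia.
  have e01 : e 0 -- e 1 by rewrite (copy_edge ce).
  have e12 : e 1 -- e 2 by rewrite (copy_edge ce); nat_lia.
  have e02 : ~~ (e 0 -- e 2) by rewrite (copy_edge ce); nat_lia.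
  have grow (e' : nat -> G) x : ipath k e' -> e' 0 -- x -> x != e' 1 -> e' 1 -- x.
    by move=> ce' ? ?; case: (ipath_grow k1 ce' (x := x)).
  have no_diamond (x y z t : G) : x -- y -> x -- z -> y -- z -> y -- t -> z -- t ->
      ~~ (x -- t) -> x != t -> False.
    move=> xy xz yz yt zt xt nxt; apply: no5.
    exact: (sq5_of_diamond xy xz yz yt zt nxt xt).
  have [x e0x xe1] := other _ _ e01.
  have e1x := grow _ _ ce e0x xe1.
  have d02 : e 0 != e 2 by have [] := ce 0 2; [nat_lia|].
  have xe2 : x != e 2 by apply: contraNneq e02 => <-.
  have x2 : ~~ (e 2 -- x).
    by apply/negP => x2; apply: (no_diamond (e 0) (e 1) x (e 2)) => //; rewrite sg_sym.
  have xe j : j < k -> x != e j.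
    case: j => [_|[_ //|j jk]]; first by rewrite eq_sym sedge_neq.
    by apply: contraTneq e0x => ->; rewrite (copy_edge ce).
  (* Replacing [e 0] by [x] gives another induced path on [k] vertices, so [x] and [e 0] can
     exchange roles below. *)
  have ce' : ipath k (fun i => if i is 0 then x else e i).
    move=> [|i] [|j] //= ij; last by apply: ce.
    split; first by apply: xe; nat_lia.
    rewrite sg_sym; case: j ij => [|j] ij; first by rewrite e1x.
    by rewrite (negbTE (ipath_gap ce xe e1x x2 _)) //; nat_lia.
  (* If [w] is adjacent to [e 2], then [v], [e 1], [w], [e 2] induce a diamond; if not, [u], [w],
     [e 2] are the leaves of a claw at [e 1]. *)
  have sep u v w : e 1 -- u -> e 1 -- v -> ~~ (e 2 -- u) -> ~~ (e 2 -- v) -> u != e 2 ->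
      v != e 2 -> w != u -> w != v -> w != e 1 -> v -- u -> w -- v -> ~~ (w -- u) ->
      e 1 -- w -> False.
    move=> u1 v1 u2 v2 ue ve wu wv we vu wv' wu' w1.
    have w2 : w != e 2 by apply: contraNneq v2 => <-.
    have [w2'|w2'] := boolP (e 2 -- w).
      by apply: (no_diamond v (e 1) w (e 2)) => //; rewrite sg_sym.
    have := claw_free u1 w1 e12; rewrite eq_sym wu ue w2 sg_sym wu' sg_sym u2.
    by rewrite sg_sym (negbTE w2') => /(_ isT isT isT isT isT).
  have [z [z0 zx zx0]] := G_twin_free e0x.
  have n02 : e 0 != e 2 by [].
  have [z0'|z0'] := boolP (z -- e 0).
    have zx' : ~~ (z -- x) by move: zx0; rewrite z0'; case: (z -- x).
    have ze1 : z != e 1 by apply: contraNneq zx' => ->.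
    apply: (sep x (e 0) z) => //; [by rewrite sg_sym | by rewrite sg_sym | ].
    by apply: (grow e) => //; rewrite sg_sym.
  have zx' : z -- x by move: zx0; rewrite (negbTE z0'); case: (z -- x).
  have ze1 : z != e 1 by apply: contraNneq z0' => ->; rewrite sg_sym.
  apply: (sep (e 0) x z) => //; [ by rewrite sg_sym | by rewrite sg_sym | by rewrite sg_sym | ].
  by have := grow _ z ce'; apply=> //=; rewrite sg_sym.
have [e /card_copy_set cs] := long (3 + #|G|) (leq_addr _ _).
by have := max_card (mem (copy_set (3 + #|G|) e)); rewrite cs; nat_lia.
Qed.

(** * Building a layout vertex by vertex *)

Section Walk.
Hypothesis no_sq6 : ~ exists e : nat -> G, copy 6 (band predT) e.

Definition partial_word (pre : bool) c i := pre && (i < 3) || c i.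

(* The first [m] vertices of a layout, where only the last one may have further
   neighbours. *)
Record prefix_layout (pre : bool) m (f : nat -> G) (c : nat -> bool) : Prop := {
  pl_copy : copy m (band (partial_word pre c)) f;
  pl_size : 1 < m;
  pl_closed : forall i y, i.+1 < m -> f i -- y -> y \in copy_set m f;
  pl_word : forall i, c i ->
    [&& 0 < i, i + 2 < m, ~~ c i.+1, ~~ c i.+2 & pre ==> (5 <= i)];
  pl_pre : pre -> 5 <= m;
  pl_next : (exists2 i, c i & i + 3 = m) \/ pre && (m == 5) ->
    exists2 y, y \notin copy_set m f & f m.-1 -- y }.

Lemma copy_set_push m (f : nat -> G) y z :
  (z \in copy_set m.+1 (push m f y)) = (z \in copy_set m f) || (z == y).
Proof.
apply/copy_setP/orP => [[i im ->] | [/copy_setP[i im ->] | /eqP ->]].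
- rewrite /push; case: ltnP => im'; [left | by right].
  by apply/copy_setP; exists i.
- by exists i; [nat_lia | rewrite /push im].
- by exists m; rewrite // /push ltnn.
Qed.

(** When the walk stops, [pl_next] excludes a triangle or a lone gem ending at the last vertex; this
    gives the bounds [i + 4 <= n] and [6 <= n] of a good word. *)
Lemma prefix_layout_full pre m f c : prefix_layout pre m f c ->
  (forall y, f m.-1 -- y -> y \in copy_set m f) -> chain G.
Proof.
case=> cf m1 cl wd pr nx last_cl.
exists m, (partial_word pre c), f; split=> //.
  split=> //; apply: (@closed_set_full _ (f 0)); first by apply/copy_setP; exists 0 => //; nat_lia.
  move=> _ y /copy_setP[i im ->].
  have [/cl|im'] := ltnP i.+1 m; first exact.
  by rewrite (_ : i = m.-1); [exact: last_cl | nat_lia].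
have nonext : ~ ((exists2 i, c i & i + 3 = m) \/ pre && (m == 5)).
  by move=> /nx [y yS /last_cl]; rewrite (negbTE yS).
left; exists pre, false, c; split.
- by move=> i; rewrite /partial_word /= orbF.
- rewrite orbF => p; have := pr p; rewrite leq_eqVlt => /orP[/eqP m5|//].
  by case: nonext; right; rewrite p -m5.
- by rewrite andbF.
- move=> i ci; have /and5P[-> i2 -> -> ->] := wd i ci; rewrite /= !andbT.
  suff : i + 3 <> m by nat_lia.
  by move=> i3; case: nonext; left; exists i.
Qed.

Lemma copy_setN m (f : nat -> G) z i : z \notin copy_set m f -> i < m -> f i != z.
Proof. by move=> zS im; apply: contraNneq zS => <-; apply/copy_setP; exists i. Qed.

Section Step.
Variables (pre : bool) (m : nat) (f : nat -> G) (c : nat -> bool).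
Hypothesis pl : prefix_layout pre m f c.
Let S := copy_set m f.
Let r := f m.-1.
Let u := f m.-2.
Let m1 := pl_size pl.

Let rS : r \in S. Proof. by apply/copy_setP; exists m.-1 => //; nat_lia. Qed.
Let uS : u \in S. Proof. by apply/copy_setP; exists m.-2 => //; nat_lia. Qed.

Let ur : u -- r.
Proof. by rewrite (copy_edge (pl_copy pl)) /band; nat_lia. Qed.

Let out z i : z \notin S -> i.+1 < m -> ~~ (f i -- z).
Proof. by move=> zS im; apply: contra zS; apply: (pl_closed pl im). Qed.

Let outu z : z \notin S -> ~~ (u -- z).
Proof. by move=> zS; apply: out => //; nat_lia. Qed.

Let word_end i : m <= i + 2 -> partial_word pre c i = false.
Proof.
move=> mi; rewrite /partial_word; apply/negP => /orP[/andP[p i3]|].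
  by have := pl_pre pl p; nat_lia.
by move=> /(pl_word pl); nat_lia.
Qed.

Lemma extend_one y : y \notin S -> r -- y ->
  (forall t, t \notin S -> r -- t -> t = y) ->
  prefix_layout pre m.+1 (push m f y) c.
Proof.
move=> yS ry ext; split.
- apply: copy_push; first exact: pl_copy pl.
  move=> i im; split; first exact: (copy_setN yS).
  have [->|im'] := eqVneq i m.-1; first by rewrite -/r ry /band; nat_lia.
  rewrite (negbTE (out yS _)) /band; last nat_lia.
  have [E|] := eqVneq m i.+2; last nat_lia.
  by rewrite word_end; nat_lia.
- nat_lia.
- move=> i t; rewrite copy_set_push ltnS => im; rewrite /push im => it.
  apply/orP; have [|tS] := boolP (t \in S); [by left | right].
  have [|im'] := ltnP i.+1 m; first by move=> /(out tS); rewrite it.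
  by apply/eqP/ext => //; rewrite /r (_ : m.-1 = i) //; nat_lia.
- by move=> i /(pl_word pl) /and5P[-> ? -> -> ->]; rewrite /= !andbT; nat_lia.
- by move=> /(pl_pre pl); nat_lia.
- case=> [[i /(pl_word pl)]|/andP[/(pl_pre pl)]]; nat_lia.
Qed.

Section Triangle.
Variables y z w : G.
Hypotheses (yS : y \notin S) (zS : z \notin S).
Hypotheses (ry : r -- y) (rz : r -- z) (yz : y -- z).
Hypothesis ext : forall t, t \notin S -> r -- t -> t = y \/ t = z.
Hypotheses (wy : w != y) (wz : w -- z) (nwy : ~~ (w -- y)).

(** A triangle ending at [r] would form a butterfly with the triangle [r], [y], [z]. *)
Let wordN i : i + 3 = m -> partial_word pre c i = false.
Proof.
move=> im; apply/negP => bi.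
have fiu : f i -- u by rewrite (copy_edge (pl_copy pl)) /band; nat_lia.
have fir : f i -- r by rewrite (copy_edge (pl_copy pl)) /band ?bi; nat_lia.
by apply: (@butterfly_free r (f i) u y z) => //;
  rewrite ?out ?outu //; try nat_lia; rewrite sg_sym.
Qed.

Let preN : pre -> 6 <= m.
Proof.
move=> p; have := pl_pre pl p; rewrite leq_eqVlt => /orP[/eqP m5|//].
by have := @wordN 2; rewrite /partial_word p /= => /(_ m5).
Qed.

Let cN i : c i -> i + 4 <= m.
Proof.
move=> ci; have := pl_word pl ci; have := @wordN i.
rewrite /partial_word ci orbT; nat_lia.
Qed.

Let nbrS t x : x \notin S -> t -- x -> t != r -> t \notin S.
Proof.
move=> xS tx tr; apply/negP => /copy_setP[i im tE].
have ne : i != m.-1 by apply: contraNneq tr => iE; rewrite tE iE.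
have : i.+1 < m by nat_lia.
by move=> /(out xS); rewrite -tE tx.
Qed.

Let wS : w \notin S.
Proof. by apply: (nbrS zS wz); apply: contraNneq nwy => ->. Qed.

Let nwr : ~~ (r -- w).
Proof.
apply/negP => /(ext wS)[wy'|wz']; first by move: wy; rewrite wy' eqxx.
by move: wz; rewrite wz' sg_irrefl.
Qed.

(** The order of the two new vertices matters: [y] is finished, whereas [z] still has the neighbour
    [w], which is the one that [pl_next] asks for. The new bit belongs to the position of [r]. *)
Lemma extend_two : (forall t, y -- t -> t = r \/ t = z) ->
  prefix_layout pre m.+2 (push m.+1 (push m f y) z) (fun i => c i || (i == m.-1)).
Proof.
move=> yext; split.
- apply: copy_push; first apply: copy_push.
  + move=> i j ij; have [-> ->] := pl_copy pl ij; split=> //.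
    by rewrite /band /partial_word; nat_lia.
  + move=> i im; split; first exact: (copy_setN yS).
    have [->|im'] := eqVneq i m.-1; first by rewrite -/r ry /band; nat_lia.
    rewrite (negbTE (out yS _)) /band; last nat_lia.
    have [E|] := eqVneq m i.+2; last nat_lia.
    by have := @word_end i; rewrite /partial_word; nat_lia.
  + move=> i im; rewrite /push; case: ltnP => im'; last first.
      by rewrite (sedge_neq yz) yz /band; split=> //; nat_lia.
    split; first exact: (copy_setN zS).
    have [->|im2] := eqVneq i m.-1.
      by rewrite -/r rz /band /partial_word eqxx !orbT; nat_lia.
    by rewrite (negbTE (out zS _)) /band; nat_lia.
- nat_lia.
- move=> i t im; rewrite !copy_set_push /push; have -> : i < m.+1 by nat_lia.
  case: ltnP => im' it; last first.
    by case: (yext _ it) => ->; rewrite ?rS ?eqxx ?orbT.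
  have [//|tS] := boolP (t \in S).
  have [|im2] := ltnP i.+1 m; first by move=> /(out tS); rewrite it.
  have [||->|->] := @ext t; rewrite ?eqxx ?orbT //.
  by rewrite /r (_ : m.-1 = i) //; nat_lia.
- move=> i /orP[ci|/eqP ->].
    by have := cN ci; have /and5P[-> _ /negbTE -> /negbTE -> ->] := pl_word pl ci; nat_lia.
  have cN' j : m <= j + 3 -> c j = false by move=> mj; apply/negP => /cN; nat_lia.
  by rewrite !cN'; try nat_lia; case p: pre; rewrite //=; have := preN p; nat_lia.
- by move=> /(pl_pre pl); nat_lia.
- move=> _; exists w; last by rewrite /push ltnn sg_sym.
  by rewrite !copy_set_push (negbTE wS) (negbTE wy) (negbTE (sedge_neq wz)).
Qed.

(** The vertices [r], [y], [z], [t], [w] form a gem entered at its end [r]. As [u] is attached to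
    that end, nothing is attached to the other one, and the layout is complete. *)
Lemma extend_gem t : y -- t -> t != r -> t != z -> chain G.
Proof.
move=> yt tr tz.
have tS : t \notin S by apply: (nbrS yS) => //; rewrite sg_sym.
have ty : y != t by apply: sedge_neq.
have nrt : ~~ (r -- t).
  by apply/negP => /(ext tS)[E|E]; [rewrite E eqxx in ty | rewrite E eqxx in tz].
have wt : w != t by apply: contraNneq nwy => ->; rewrite sg_sym.
(* Otherwise [y], [z], [w], [t] is an induced 4-cycle when [w] and [t] are adjacent, and the
   triangle [r], [y], [z] with pendants [u], [t], [w] is a net when they are not. *)
have zt : z -- t.
  apply: contraT => nzt; exfalso; have [wt'|nwt] := boolP (w -- t).
    by apply: (@C4_free y z w t) => //; first [rewrite sg_sym | rewrite eq_sym].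
  have [nuy nuz nut nuw] := And4 (outu yS) (outu zS) (outu tS) (outu wS).
  by apply: (@net_free r y z u t w) => //; rewrite sg_sym.
have wt' : w -- t.
  have [nwr' ntr'] : r != w /\ r != t by split; [apply: (copy_setN wS) | apply: (copy_setN tS)]; nat_lia.
  by apply: (@claw_free z r w t) => //; rewrite sg_sym.
(* The default value counts: [q 4] is [w], the far end of the gem. *)
pose q := nth w [:: r; y; z; t].
have nrw : r != w by apply: (copy_setN wS); nat_lia.
have nrt' : r != t by rewrite eq_sym.
have cq : copy 5 (band predT) q by solve_copy.
have qS i : 0 < i < 5 -> q i \notin S by case: i => [|[|[|[|[|]]]]].
(* The gem overlaps the prefix in [q 0 = r], at position [m.-1]; it contributes four new
   vertices. *)
pose F i := if i < m then f i else q (i + 1 - m).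
have Fq i : m.-1 <= i -> F i = q (i + 1 - m).
  rewrite /F; case: ltnP => // im mi; rewrite (_ : i = m.-1); last nat_lia.
  by rewrite (_ : m.-1 + 1 - m = 0); last nat_lia.
pose b i := partial_word pre c i || (m + 4 <= i + 5) && (i + 3 <= m + 4).
have cF : copy (m + 4) (band b) F.
  move=> i j ij; have [jm|jm] := ltnP j m.
    rewrite /F jm (_ : i < m); last nat_lia.
    have [|-> ->] := pl_copy pl (i := i) (j := j); first nat_lia.
    by split=> //; rewrite /band /b; nat_lia.
  have [im|im] := ltnP i m.-1; last first.
    rewrite !Fq; [|nat_lia|nat_lia].
    have [|-> ->] := cq (i + 1 - m) (j + 1 - m); first nat_lia.
    by split=> //; rewrite /band /b /=; nat_lia.
  have qjS : q (j + 1 - m) \notin S by apply: qS; nat_lia.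
  rewrite (Fq j) /F; last nat_lia.
  have im' : i < m by nat_lia.
  rewrite im' (copy_setN qjS) //; split=> //.
  rewrite (negbTE (out qjS _)) /band; last nat_lia.
  have [E|] := eqVneq j i.+2; last nat_lia.
  by rewrite /b word_end; nat_lia.
exists (m + 4), b, F; split; [split=> // | nat_lia | left].
  apply: (@closed_set_full _ (F 0)); first by apply/copy_setP; exists 0 => //; nat_lia.
  have SF v : v \in S -> v \in copy_set (m + 4) F.
    by move=> /copy_setP[i im ->]; apply/copy_setP; exists i; rewrite /F ?im //; nat_lia.
  have qF v : v \in copy_set 5 q -> v \in copy_set (m + 4) F.
    move=> /copy_setP[i im ->]; apply/copy_setP; exists (i + m - 1); first nat_lia.
    by rewrite Fq; [congr q; nat_lia | nat_lia].
  move=> _ v /copy_setP[i im ->] iv.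
  have [im'|im'] := ltnP i m.-1.
    by apply/SF/(pl_closed pl (i := i)); rewrite /F in iv *; [nat_lia | rewrite ifT // in iv; nat_lia].
  have [/qF //|vq] := boolP (v \in copy_set 5 q).
  move: iv; rewrite Fq // => iv.
  have [|i0|i4] := sq5_neighbour no_sq6 cq vq _ iv; first nat_lia.
    have [/SF //|vS] := boolP (v \in S); rewrite i0 in iv.
    by apply: qF; apply/copy_setP; case: (ext vS iv) => ->; [exists 1 | exists 2].
  exfalso; rewrite i4 in iv; apply: (sq5_one_side no_sq6 cq _ vq _ iv (y := u)); last first.
    by rewrite sg_sym.
  apply/negP => /copy_setP[[|j] j5 uq].
    by move: ur; rewrite uq /= sg_irrefl.
  by have := qS j.+1; rewrite -uq uS j5 => /(_ isT).
exists pre, true, c; split=> //.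
- by move=> i; rewrite /b /partial_word -orbA.
- nat_lia.
- by rewrite andbT => /preN; nat_lia.
- move=> i ci; have /and5P[-> ? -> -> ->] := pl_word pl ci; have := cN ci.
  by rewrite /=; nat_lia.
Qed.

Lemma triangle_step : chain G \/
  exists m' f' c', m < m' /\ prefix_layout pre m' f' c'.
Proof.
have [t /and3P[yt tr tz]|no] := pickP (fun t => [&& y -- t, t != r & t != z]).
  by left; apply: (extend_gem yt).
right; do 3 eexists; split; last first.
  apply: extend_two => t yt; have := no t; rewrite yt /=.
  by case: eqVneq => [->|_ /=]; [left | case: eqVneq => // ->; right].
nat_lia.
Qed.

End Triangle.

Lemma prefix_step : chain G \/
  exists m' f' c', m < m' /\ prefix_layout pre m' f' c'.
Proof.
have [y /andP[yS ry]|none] := pickP (fun y => (y \notin S) && (r -- y)); last first.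
  left; apply: (prefix_layout_full pl) => y ry; have := none y.
  by rewrite -/r in ry *; rewrite ry andbT => /negbFE.
have [z /and3P[zS rz zy]|none] := pickP (fun z => [&& z \notin S, r -- z & z != y]); last first.
  right; do 3 eexists; split; last first.
    apply: (extend_one yS ry) => t tS rt; have := none t.
    by rewrite tS rt /= => /negbFE /eqP.
  nat_lia.
(* Two non-adjacent outer neighbours of [r] would form a claw with [u]. Hence three outer neighbours
   would give a [K_4] with [r], and at most two exist. *)
have adj s t : s \notin S -> t \notin S -> r -- s -> r -- t -> s != t -> s -- t.
  move=> sS tS rs rt st; apply: (@claw_free r u) => //; rewrite ?outu //.
  - by rewrite sg_sym.
  - by apply: (copy_setN sS); nat_lia.
  - by apply: (copy_setN tS); nat_lia.
have yz : y -- z by apply: adj => //; rewrite eq_sym.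
have ext t : t \notin S -> r -- t -> t = y \/ t = z.
  move=> tS rt; have [->|ty] := eqVneq t y; first by left.
  have [->|tz] := eqVneq t z; first by right.
  by exfalso; apply: (@K4_free r y z t) => //; apply: adj => //; rewrite eq_sym.
have [w [wy wz wyz]] := G_twin_free yz.
have [wy'|wy'] := boolP (w -- y).
  have nwz : ~~ (w -- z) by move: wyz; rewrite wy'; case: (w -- z).
  apply: (@triangle_step z y w) => //; first by rewrite sg_sym.
  by move=> t tS /(ext t tS) [->|->]; [right | left].
have wz' : w -- z by move: wyz; rewrite (negbTE wy'); case: (w -- z).
exact: (@triangle_step y z w).
Qed.

End Step.

Lemma chain_of_prefix k pre m f c : #|G| <= m + k -> prefix_layout pre m f c -> chain G.
Proof.
elim: k m f c => [|k IH] m f c Gk pl; have [//|[m' [f' [c' [mm pl']]]]] := prefix_step pl.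
  have := max_card (mem (copy_set m' f')).
  by rewrite (card_copy_set (pl_copy pl')); nat_lia.
by apply: (IH m' f' c') => //; nat_lia.
Qed.

(** * Layouts starting from a gem *)

Section GemStart.
Hypothesis G_homogeneous :
  forall U : {set G}, nontrivial U -> homogeneous U -> independent U.

(** Otherwise the complement of the hub [e 2] is a non-trivial homogeneous set containing an
    edge. *)
Lemma sq5_not_full (e : nat -> G) : copy 5 (band predT) e -> exists y, y \notin copy_set 5 e.
Proof.
move=> ce; apply/existsP; apply: contraT => /existsPn full.
have e_inj i j : i < 5 -> j < 5 -> (e i == e j) = (i == j).
  by move=> i5 j5; apply/eqP/eqP => [/(copy_inj ce)|->]; [exact | ].
pose U := [set~ e 2].
suff /(_ (e 0) (e 1)) : independent U.
  by rewrite !inE !e_inj // (copy_edge ce) // => /(_ isT isT).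
have cardU : #|U|.+1 = #|G| by rewrite cardsC1 prednK //; apply/card_gt0P; exists (e 2).
have card5 : #|G| = 5.
  rewrite -(card_copy_set ce); apply: esym; apply/eqP.
  rewrite -cardsT (_ : copy_set 5 e = setT) //; apply/setP => x.
  by rewrite inE; have := full x; rewrite negbK.
apply: G_homogeneous.
  by rewrite /nontrivial !inE; nat_lia.
move=> x; rewrite !inE negbK => /eqP ->; left => y; rewrite !inE.
have := full y; rewrite negbK => /copy_setP[i i5 ->]; rewrite e_inj // => i2.
have [i_lt2 | i_ge2] := ltnP i 2; first by rewrite sg_sym (copy_edge ce) /band /=; nat_lia.
by rewrite (copy_edge ce) /band /=; nat_lia.
Qed.

Lemma chain_of_sq5_start (e : nat -> G) : copy 5 (band predT) e ->
  (forall y, y \notin copy_set 5 e -> ~~ (e 0 -- y)) -> chain G.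
Proof.
move=> ce out0; apply: (@chain_of_prefix #|G| true 5 e pred0); first exact: leq_addl.
have out i y : i < 4 -> y \notin copy_set 5 e -> ~~ (e i -- y).
  move=> i4 yS; apply/negP => iy.
  have [|i0|i4'] := sq5_neighbour no_sq6 ce yS _ iy; [by nat_lia | | by nat_lia].
  by have := out0 y yS; rewrite -i0 iy.
split=> //.
- apply: copy_eq ce => i j ij; rewrite /band /partial_word /= orbF.
  by nat_lia.
- by move=> i y i4 iy; apply: contraT => /(out i y i4); rewrite iy.
(* [G] is connected and larger than the gem, and [e 4] is the only exit left. *)
- move=> _; have [y0 y0S] := sq5_not_full ce.
  have [y /andP[yS ey]|no] := pickP (fun y => (y \notin copy_set 5 e) && (e 4 -- y)).
    by exists y.
  have := y0S; rewrite (@closed_set_full (copy_set 5 e) (e 0)) //.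
    by apply/copy_setP; exists 0.
  move=> _ v /copy_setP[i i5 ->] iv; apply: contraT => vS.
  have [i4|i4] := ltnP i 4; first by have := out i v i4 vS; rewrite iv.
  have := no v; rewrite vS /= (_ : 4 = i) ?iv //.
  by nat_lia.
Qed.

(** At most one end of the gem is attached to the rest; reversing the gem if necessary makes [e 0]
    the free end. *)
Lemma chain_of_sq5 (e : nat -> G) : copy 5 (band predT) e -> chain G.
Proof.
move=> ce.
have ce' : copy 5 (band predT) (fun i => e (4 - i)).
  move=> i j ij; have [|ne ee] := ce (4 - j) (4 - i); first by nat_lia.
  by rewrite eq_sym sg_sym ne ee /band /=; split=> //; nat_lia.
have set' x : (x \in copy_set 5 (fun i => e (4 - i))) = (x \in copy_set 5 e).
  apply/copy_setP/copy_setP => -[i i5 ->]; exists (4 - i) => //; first by nat_lia.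
    by nat_lia.
  by congr e; nat_lia.
have [y /andP[yS ey]|no] := pickP (fun y => (y \notin copy_set 5 e) && (e 4 -- y)).
  apply: (chain_of_sq5_start ce) => z zS; apply/negP => ez.
  exact: (sq5_one_side no_sq6 ce zS yS ez ey).
apply: (chain_of_sq5_start ce') => y; rewrite set' => yS /=.
by have := no y; rewrite yS /= => /negbT.
Qed.

End GemStart.
End Walk.

Lemma chain_of_local (x0 : G) : no_isolated_vertex G ->
  (forall U : {set G}, nontrivial U -> homogeneous U -> independent U) -> chain G.
Proof.
move=> noiso hom.
have [[e ce]|no6] := classic (exists e : nat -> G, copy 6 (band predT) e).
  exists 6, (gtn 4), e; split=> //; last by right.
  split; last exact: sq6_full.
  by apply: copy_eq ce => i j ij; rewrite /band /=; nat_lia.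
have [[e ce]|no5] := classic (exists e : nat -> G, copy 5 (band predT) e).
  exact: chain_of_sq5 ce.
have [a [c [ac aend]]] := end_vertex x0 noiso no5.
apply: (@chain_of_prefix no6 #|G| false 2 (nth a [:: a; c]) pred0); first exact: leq_addl.
split=> //.
- solve_copy.
- by move=> [|i] y //= _ /aend ->; apply/copy_setP; exists 1.
- by case=> // -[].
Qed.

End LocalStructure.

(** * Twins and components as homogeneous sets *)

Lemma twin_free_of_homogeneous (G : sgraph) : 2 < #|G| ->
  (forall U : {set G}, nontrivial U -> homogeneous U -> independent U) ->
  forall x y : G, x -- y -> exists z, [/\ z != x, z != y & (z -- x) != (z -- y)].
Proof.
move=> G2 hom x y xy.
have [z /and3P[zx zy zxy]|no] := pickP (fun z => [&& z != x, z != y & (z -- x) != (z -- y)]).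
  by exists z.
have /(_ x y) : independent [set x; y].
  (* A third vertex is needed here: in [K_2] the pair is the whole vertex set and hence trivial. *)
  apply: hom; first by rewrite /nontrivial !inE cards2 (sedge_neq xy) neq_ltn G2.
  move=> z; rewrite !inE negb_or => /andP[zx zy].
  have := no z; rewrite zx zy /= => /negbFE /eqP E.
  have [zx'|zx'] := boolP (z -- x); [left | right] => t; rewrite !inE => /orP[] /eqP ->;
    by rewrite -?E.
by rewrite !inE !eqxx orbT xy => /(_ isT isT).
Qed.

(** The component of [x] is homogeneous and contains an edge, so it cannot be a proper subset. *)
Lemma connected_of_homogeneous (G : sgraph) : no_isolated_vertex G ->
  (forall U : {set G}, nontrivial U -> homogeneous U -> independent U) ->
  forall x y : G, connect sedge x y.
Proof.
move=> noiso hom x y; apply: contraT => nxy.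
have [z xz] := noiso x; pose U := [set t | connect sedge x t].
have /(_ x z) : independent U.
  apply: hom.
    have : #|[set x; z]| <= #|U|.
      apply/subset_leq_card/subsetP => t; rewrite !inE => /orP[] /eqP ->.
        exact: connect0.
      exact: connect1.
    have : #|U| < #|G|.
      rewrite -cardsT; apply: proper_card; rewrite properE subsetT /=.
      by apply: contra nxy => /subsetP/(_ y); rewrite !inE => /(_ isT).
    rewrite /nontrivial !inE cards2 (sedge_neq xz) => ltG; rewrite [_ == #|G|]ltn_eqF //.
    by case: #|U| => [|[]].
  move=> t; rewrite inE => nt; right => s; rewrite inE => xs.
  by apply: contra nt => ts; apply: connect_trans xs (connect1 _); rewrite sg_sym.
by rewrite !inE connect0 connect1 // xz => /(_ isT isT).
Qed.

Lemma free_of_not_contains (G : sgraph) :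
  ~ contains_induced G F1 /\ ~ contains_induced G F2 /\ ~ contains_induced G F3 /\
  ~ contains_induced G F4 /\ ~ contains_induced G F5 /\ ~ contains_induced G F6 /\
  ~ contains_induced G F7 /\ ~ contains_induced G F8 /\ ~ contains_induced G F9 ->
  forall m r, List.In (m, r) F_patterns -> forall e : nat -> G, ~ copy m r e.
Proof.
move=> [n1 [n2 [n3 [n4 [n5 [n6 [n7 [n8 n9]]]]]]]] m r + e ce.
have use k es : copy k (prel es) e -> contains_induced G (graph_of_edges k es).
  by move=> ck; apply: (copy_contains ck) => i j; apply: symm_prel.
by do 9 (case=> [[? ?]|]; first by subst; move/use: ce).
Qed.

Theorem chain_of_ii (G : sgraph) : 0 < #|G| -> no_isolated_vertex G ->
  (forall U : {set G}, nontrivial U -> homogeneous U -> independent U) ->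
  chordal G ->
  (forall m r, List.In (m, r) F_patterns -> forall e : nat -> G, ~ copy m r e) ->
  chain G.
Proof.
move=> /card_gt0P[x _] noiso hom chd fr.
have [G2|G2] := leqP #|G| 2; last first.
  apply: (chain_of_local _ chd fr _ x) => //.
    exact: connected_of_homogeneous.
  exact: twin_free_of_homogeneous.
have [y xy] := noiso x; exists 2, pred0, (nth x [:: x; y]); split=> //; last first.
  left; exists false, false, pred0; split=> // i.
split; first solve_copy.
move=> z; have : z \in [set x; y].
  have /eqP -> : [set x; y] == setT by rewrite eqEcard subsetT cardsT cards2 (sedge_neq xy).
  by rewrite inE.
by rewrite !inE => /orP[] /eqP ->; apply/copy_setP; [exists 0 | exists 1].
Qed.

(** * The Gallai graph of a layout *)

(** Descending in rank leads every vertex to the root. On a cycle, a vertex of maximal rank would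
    have two distinct neighbours of rank at most its own. *)
Lemma tree_of_rank (H : sgraph) (rk : H -> nat) (root : H) :
  (forall x, x != root -> exists2 y, x -- y & rk y < rk x) ->
  (forall x y z, x -- y -> x -- z -> rk y <= rk x -> rk z <= rk x -> y = z) ->
  tree H.
Proof.
move=> parent uniq_parent; split.
  have to_root x : connect sedge x root.
    have [k] := ubnP (rk x); elim: k x => // k IH x xk.
    have [->|/parent[y xy yx]] := eqVneq x root; first exact: connect0.
    by apply: connect_trans (connect1 xy) (IH y _); lia.
  have connC := sym_connect_sym (@sg_sym H).
  apply/andP; split; first by apply/card_gt0P; exists root.
  apply/forallP => x; apply/forallP => y.
  by apply: connect_trans (to_root x) _; rewrite connC.
move=> s /andP[cyc_s uniq_s]; rewrite ltnNge; apply/negP => s3.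
have [x0 x0s] : exists x, x \in s by case: s s3 {cyc_s uniq_s} => // x s _; exists x; rewrite inE eqxx.
case: (arg_maxnP rk (P := [in s]) x0s) => x xs xmax.
have [i s' sE] := rot_to xs.
have s's y : y \in s' -> rk y <= rk x.
  by move=> ys'; apply: xmax; rewrite -(mem_rot i) sE inE ys' orbT.
have : cycle sedge (x :: s') by rewrite -sE rot_cycle.
have : uniq (x :: s') by rewrite -sE rot_uniq.
have : 2 < size (x :: s') by rewrite -sE size_rot.
case: s' s's {sE} => // y [//|z s'] s's _ /=.
move=> /and3P[_ ynot _] /and3P[xy _]; rewrite rcons_path => /andP[_].
have lz : last z s' \in z :: s' by apply: mem_last.
rewrite sg_sym => xl.
have yl : y = last z s'.
  apply: (uniq_parent x) => //; apply: s's; first by rewrite inE eqxx.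
  by rewrite inE lz orbT.
by rewrite yl lz in ynot.
Qed.

(* The edge {i, i+1} has label (i, false), the edge {i, i+2} label (i, true). *)
Definition valid_label n (b : nat -> bool) (l : nat * bool) : bool :=
  (l.1.+1 + l.2 < n) && (l.2 ==> b l.1).

(** Edges with a common lower or a common upper end always span a triangle, so Gallai neighbours
    meet upper end to lower end. They then span a triangle only if both are short and the bit of the
    lower one is set. *)
Definition label_up (b : nat -> bool) (l l' : nat * bool) : bool :=
  (l'.1 == l.1.+1 + l.2) && ~~ [&& ~~ l.2, ~~ l'.2 & b l.1].

Definition label_adj b l l' := label_up b l l' || label_up b l' l.

Definition label_tree n b (rk : nat * bool -> nat) root : Prop :=
  [/\ valid_label n b root,
      forall l, valid_label n b l -> l != root ->
        exists2 l', valid_label n b l' && label_adj b l l' & rk l' < rk l &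
      forall l l1 l2, valid_label n b l -> valid_label n b l1 -> valid_label n b l2 ->
        label_adj b l l1 -> label_adj b l l2 -> rk l1 <= rk l -> rk l2 <= rk l ->
        l1 = l2].

(** The distance to the edge {4, 5} in the Gallai graph of [P_6^2]. *)
Definition sq6_rank (l : nat * bool) : nat :=
  nth 0 (if l.2 then [:: 2; 5; 1; 4] else [:: 6; 2; 3; 6; 0]) l.1.

Lemma label_tree_sq6 :
  label_tree 6 (gtn 4) sq6_rank
    (4, false).
Proof.
pose ls := [seq (i, t) | i <- iota 0 5, t <- [:: false; true]].
have in_ls l : valid_label 6 (gtn 4) l -> l \in ls.
  case: l => i t; rewrite /valid_label /= => /andP[it _]; apply/allpairsP; exists (i, t).
  by rewrite mem_iota /=; split=> //; [lia | case: t {it}].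
split=> //.
- move=> l vl; have /in_ls := vl; move: vl.
  suff /allP H : all (fun l => valid_label 6 (gtn 4) l ==> ((l == (4, false)) ||
      has (fun l' => [&& valid_label 6 (gtn 4) l', label_adj (gtn 4) l l' &
       sq6_rank l' <
       sq6_rank l]) ls)) ls.
    move=> vl /H; rewrite vl implyTb => /orP[-> //|/hasP[l' _ /and3P[v' a' r']] _].
    by exists l'; rewrite ?v'.
  by vm_compute.
- suff /allP H : all (fun l => all (fun l1 => all (fun l2 =>
     [&& valid_label 6 (gtn 4) l, valid_label 6 (gtn 4) l1, valid_label 6 (gtn 4) l2,
         label_adj (gtn 4) l l1, label_adj (gtn 4) l l2,
       sq6_rank l1 <=
       sq6_rank l &
       sq6_rank l2 <=
       sq6_rank l] ==> (l1 == l2)) ls) ls) ls.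
    move=> l l1 l2 v v1 v2 a1 a2 r1 r2; have /allP H1 := H l (in_ls _ v).
    have /allP/(_ l2 (in_ls _ v2)) := H1 l1 (in_ls _ v1).
    by rewrite v v1 v2 a1 a2 r1 r2 => /eqP.
  by vm_compute.
Qed.

(* Triangles hang from the left, and a gem at the left end from its only
   attachment; hence the table for the latter. *)
Definition word_rank (pre : bool) (b : nat -> bool) (l : nat * bool) : nat :=
  if pre && (l.1 < 4) then nth 0 (if l.2 then [:: 10; 10; 9] else [:: 11; 10; 11; 9]) l.1
  else if l.2 then l.1.*2.+1 else l.1.*2 + (if (0 < l.1) && b l.1.-1 then 4 else 0).

(** Behind a gem the root is the edge {4, 5} leaving it, of rank 8; the table in [word_rank] is 8
    plus the distance to that edge. *)
Definition word_root (pre : bool) := (if pre then 4 else 0, false).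

(** * Parents of edges along a good word *)

Section GoodWord.
Variables (n : nat) (b c : nat -> bool) (pre suf : bool).
Hypothesis n1 : 1 < n.
Hypothesis bE : forall i, b i = [|| pre && (i < 3), c i | [&& suf, n <= i + 5 & i + 3 <= n]].
Hypothesis n6 : pre || suf -> 6 <= n.
Hypothesis n10 : pre && suf -> 10 <= n.
Hypothesis cP : forall i, c i -> [&& 0 < i, i + 4 <= n, ~~ c i.+1, ~~ c i.+2,
                         pre ==> (5 <= i) & suf ==> (i + 8 <= n)].



Lemma good_word0 : b 0 -> pre.
Proof.
rewrite bE => /or3P[/andP[]//|/cP//|/and3P[sf]]; have := n6; rewrite sf orbT; nat_lia.
Qed.

Lemma good_word_pre : pre -> [/\ b 0, b 1, b 2, b 3 = false & b 4 = false].
Proof.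
move=> p; have c3 : c 3 = false by apply/negP => /cP; rewrite p /= !andbF.
have c4 : c 4 = false by apply/negP => /cP; rewrite p /= !andbF.
have := n10; rewrite !bE p c3 c4 /=; case: suf => //= /(_ isT) n10'.
by split=> //; nat_lia.
Qed.

Lemma good_word_case i : b i -> ~~ (pre && (i < 3)) ->
  [&& 0 < i, i + 4 <= n, ~~ b i.-1, ~~ b i.+1 & ~~ b i.+2] \/
  [&& suf, n <= i + 5 & i + 3 <= n].
Proof.
move=> + ip; rewrite bE (negbTE ip) /= => /orP[ci|]; [left | by right].
have /and5P[i0 i4 c1 c2 /andP[pi si]] := cP ci.
have cp : c i.-1 = false by apply/negP => /cP /and5P[_ _]; rewrite prednK // ci.
rewrite !bE cp (negbTE c1) (negbTE c2) i0 i4 /=.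
by case: pre pi ip => /= [i5|_] _; case: suf si => /= [i8|_] //; nat_lia.
Qed.

Lemma good_word_suf i : suf -> n <= i + 6 -> i + 3 <= n -> b i = (n <= i + 5).
Proof.
move=> sf i6 i3; have := n6; rewrite sf orbT => /(_ isT) n6'.
have ci : c i = false by apply/negP => /cP; rewrite sf /= => /and5P[_ _ _ _]; nat_lia.
rewrite bE ci sf i3 andbT /=; case p: pre => //=.
by have := n10; rewrite p sf => /(_ isT); nat_lia.
Qed.

Lemma good_word_end i : b i -> i + 3 <= n.
Proof.
rewrite bE => /or3P[/andP[p]|/cP|/and3P[]//]; last nat_lia.
by have := n6; rewrite p => /(_ isT); nat_lia.
Qed.

Lemma run_end k : b k -> ~~ b k.+1 -> k + 3 < n -> ~~ (pre && (k < 3)) -> ~~ b k.-1.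
Proof.
move=> bk bk1 kn kp; have [/and5P[] //|/and3P[sf k5 k3]] := good_word_case bk kp.
by move: bk1; rewrite good_word_suf //; nat_lia.
Qed.

(** Isolated ones are at distance at least 3, so two ones at distance 2 can only be the ends of a
    run 111. *)
Lemma run_gap k : b k -> b k.+2 -> ~~ (pre && (k < 3)) -> b k.+1 /\ ~~ b k.-1.
Proof.
move=> bk bk2 kp; have [/and5P[_ _ _ _]|/and3P[sf k5 k3]] := good_word_case bk kp.
  by rewrite bk2.
have k2 := good_word_end bk2; have := n6; rewrite sf orbT => /(_ isT) n6'.
by rewrite !good_word_suf //; try nat_lia; split; nat_lia.
Qed.

Lemma run_start k : b k -> ~~ b k.-1 -> ~~ (pre && (k < 3)) -> 0 < k ->
  if b k.+1 then b k.+2 && (k + 5 <= n) else k + 4 <= n.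
Proof.
move=> bk bk1 kp k0; have [/and5P[_ ? _ /negbTE -> _] //|/and3P[sf k5 k3]] := good_word_case bk kp.
move: bk1; rewrite good_word_suf //; [|nat_lia|nat_lia] => k6.
have -> : b k.+1 by rewrite good_word_suf //; nat_lia.
by rewrite good_word_suf //; nat_lia.
Qed.

(** Outside the left gem an edge hangs from one that ends at its lower end, with one exception: for
    {j, j+1} with [b j.-1] set and [b j.-2] clear, the edge {j-1, j} spans a triangle with it and no
    long edge ends at j. It then hangs from an edge on its right, and the summand 4 in [word_rank]
    ranks it above that edge. *)
Definition label_parent (l : nat * bool) : nat * bool :=
  let: (j, s) := l in
  if pre && (j < 4) then
    nth (0, false) (if s then [:: (2, true); (3, false); (4, false)]
                    else [:: (1, true); (2, true); (0, true); (4, false)]) j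
  else if s then if b j.-1 && b j.-2 then (j.-2, true) else (j.-1, false)
  else if b j.-1 then
         if b j.-2 then (j.-2, true) else if b j then (j.+1, true) else (j.+1, false)
       else if b j.-2 then (j.-2, true) else (j.-1, false).

(** Every Gallai adjacency is a parent link in one of the two directions; this is what makes a
    neighbour of no larger rank unique. *)
Lemma label_up_parent l l' : valid_label n b l -> valid_label n b l' -> label_up b l l' ->
  word_rank pre b l < word_rank pre b l' /\ label_parent l' = l \/
  word_rank pre b l' < word_rank pre b l /\ label_parent l = l'.
Proof.
case: l l' => [i t] [j s]; rewrite /label_up /= => vl vl' /andP[/eqP jE].
rewrite {j}jE /= in vl' *.
move: vl vl'; rewrite /valid_label /= => /andP[itn bi] /andP[jn bj] adj.
have [/andP[p i4]|ip] := boolP (pre && (i < 4)).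
  have [b0 b1 b2 b3 b4] := good_word_pre p.
  rewrite /word_rank /label_parent p.
  by case: i i4 itn bi jn bj adj => [|[|[|[|//]]]] _; case: t; case: s => //=;
    rewrite ?b0 ?b1 ?b2 ?b3 ?b4 //= => *; first [by left | by right].
have np k : i.-1 <= k -> ~~ (pre && (k < 3)) by nat_lia.
have pj k : i <= k -> pre && (k < 4) = false by nat_lia.
rewrite /word_rank /label_parent /= !pj; [|nat_lia|nat_lia].
case: t itn bi jn bj adj => /=; rewrite ?addn0 ?addn1 /= => itn bi jn bj adj.
  rewrite bi; left; case: s jn bj adj => /= jn bj _.
    have [->] := run_gap bi bj (np i (leq_pred i)); split=> //; nat_lia.
  by rewrite if_same; split=> //; case: (b i.+1); nat_lia.
have pred_case : b i.-1 -> 0 < i.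
  by case: (posnP i) => // i0; have := np 0; rewrite i0 /= => /(_ isT) np0 /good_word0 p; rewrite p in np0.
case: s jn bj adj => /= jn bj adj.
  have [bp|/negbTE bp] := boolP (b i.-1); last first.
    by left; rewrite !andbF; split=> //; nat_lia.
  have i0 := pred_case bp; right; rewrite i0 /=.
  have bp2 : b i.-1.+2 by rewrite prednK.
  have [bi' /negbTE bp'] := run_gap bp bp2 (np _ (leqnn _)).
  by rewrite prednK // in bi'; rewrite bp' bi'; split=> //; nat_lia.
rewrite (negbTE adj); have [bp|/negbTE bp] := boolP (b i.-1); last first.
  by left; rewrite andbF; split=> //; nat_lia.
have i0 := pred_case bp; right; rewrite i0 /=.
have bp1 : ~~ b i.-1.+1 by rewrite prednK.
have /negbTE bp' : ~~ b i.-2 by apply: (run_end bp bp1 _ (np _ (leqnn _))); nat_lia.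
by rewrite bp'; split=> //; nat_lia.
Qed.

Lemma label_parentP l : valid_label n b l -> l != word_root pre ->
  [&& valid_label n b (label_parent l), label_adj b l (label_parent l) &
      word_rank pre b (label_parent l) < word_rank pre b l].
Proof.
case: l => j s; rewrite /valid_label /word_root /= => /andP[jn bj] root.
have [/andP[p j4]|jp] := boolP (pre && (j < 4)).
  have [b0 b1 b2 b3 b4] := good_word_pre p; have := n6; rewrite p => /(_ isT) n6'.
  rewrite /word_rank /label_parent /label_adj /label_up ?p.
  by case: j j4 jn bj {root} => [|[|[|[|//]]]] _; case: s => //=;
    rewrite ?b0 ?b1 ?b2 ?b3 ?b4 //= => *; nat_lia.
have j5 : if pre then 5 <= j else 0 < j.
  case p: pre root jp => /= root jp.
    rewrite -ltnNge ltnS leq_eqVlt in jp; case/orP: jp => // /eqP j4.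
    have [_ _ _ _ b4] := good_word_pre p.
    by move: root bj; rewrite -j4 b4; case: s {jn}.
  rewrite lt0n; apply/eqP => j0; move: root bj; rewrite j0; case: s {jn} => //= _ /good_word0.
  by rewrite p.
have np k : j.-2 <= k -> ~~ (pre && (k < 3)) by move: j5; case: pre => /=; nat_lia.
have pj k : j.-1 <= k -> pre && (k < 4) = false by move: j5; case: pre => /=; nat_lia.
have b1 : b j.-1 -> 1 < j.
  have [//|j1 bj1] := ltnP 1 j; have := np 0; rewrite (_ : j.-2 = 0); last nat_lia.
  by rewrite good_word0 // (_ : 0 = j.-1) //; nat_lia.
have b2 : b j.-2 -> 2 < j.
  have [//|j1 bj1] := ltnP 2 j; have := np 0; rewrite (_ : j.-2 = 0); last nat_lia.
  by rewrite good_word0 // (_ : 0 = j.-2) //; nat_lia.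
have j0 : 0 < j by move: j5; case: pre; nat_lia.
have zone k : b k -> j.-2 <= k -> pre && (k < 4) = false.
  move=> bk jk; apply/negP => /andP[p k4]; have [_ _ _ b3 _] := good_word_pre p.
  move: j5; rewrite p => j5; have k3 : k = 3 by nat_lia.
  by rewrite k3 b3 in bk.
rewrite /label_parent ?(pj j (leq_pred j)) /label_adj /label_up /valid_label /word_rank.
rewrite ?(pj j (leq_pred j)).
case: s root jn bj => /= root; rewrite ?addn1 ?addn0 => jn bj.
  case: ifP => [/andP[bj1 bj2]|nb] /=.
    have j2 := b2 bj2; rewrite bj2 (zone _ bj2) //=; nat_lia.
  rewrite (pj _ (leqnn _)); case: ifP => [/andP[_ bj2]|_]; last nat_lia.
  have j2 := b2 bj2; have bj' : b j.-2.+2 by rewrite (_ : j.-2.+2 = j) //; nat_lia.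
  have [] := run_gap bj2 bj' (np _ (leqnn _)).
  rewrite (_ : j.-2.+1 = j.-1); last nat_lia.
  by move=> bj1; rewrite bj1 bj2 in nb.
case: ifP => bj1; case: ifP => bj2 /=.
- have j2 := b2 bj2; rewrite bj2 (zone _ bj2) //= j0; nat_lia.
- have j1 := b1 bj1; have := run_start bj1 (negbT bj2) (np j.-1 _).
  rewrite prednK // => /(_ _ _); case: ifP => bj' /=.
    rewrite (pj j.+1) ?j0; last nat_lia.
    by move=> H; have /andP[-> jn5] := H (leq_pred _) ltac:(nat_lia); rewrite eqxx /=; clear H; nat_lia.
  rewrite (pj j.+1) ?j0 ?bj'; last nat_lia.
  by move=> H; have jn4 := H (leq_pred _) ltac:(nat_lia); rewrite eqxx /=; clear H; nat_lia.
- have j2 := b2 bj2; rewrite bj2 (zone _ bj2) //=; nat_lia.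
- by rewrite (pj _ (leqnn _)) bj2 bj1 !andbF; nat_lia.
Qed.

Lemma label_tree_good : label_tree n b (word_rank pre b) (word_root pre).
Proof.
split.
- rewrite /valid_label /word_root; case p: pre => /=; last nat_lia.
  by have := n6; rewrite p => /(_ isT); nat_lia.
- by move=> l vl /(label_parentP vl) /and3P[v a r]; exists (label_parent l); rewrite ?v.
- have par l l' : valid_label n b l -> valid_label n b l' -> label_adj b l l' ->
      word_rank pre b l' <= word_rank pre b l -> l' = label_parent l.
    by move=> v v' /orP[/(label_up_parent v v')|/(label_up_parent v' v)] [] [r E] r' //; nat_lia.
  by move=> l l1 l2 v v1 v2 a1 a2 r1 r2; rewrite (par l l1) // (par l l2).
Qed.
End GoodWord.

Lemma set2_eq (T : finType) (a b c d : T) : [set a; b] = [set c; d] -> a != b ->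
  a = c /\ b = d \/ a = d /\ b = c.
Proof.
move=> E ab; have : a \in [set c; d] by rewrite -E set21.
have : b \in [set c; d] by rewrite -E set22.
rewrite !inE => /orP[] /eqP bE /orP[] /eqP aE; subst; rewrite ?eqxx // in ab; [right | left]; by [].
Qed.

(** * Edges of a layout and their labels *)

Section LayoutTree.
Variables (G : sgraph) (n : nat) (b : nat -> bool) (f : nat -> G).
Hypothesis lay : layout n b f.

Lemma layout_adj p q : p < n -> q < n -> (f p -- f q) = band b p q || band b q p.
Proof.
have [cf _] := lay; move=> pn qn; case: (ltngtP p q) => pq.
- by rewrite (copy_edge cf) ?pq // /band; nat_lia.
- by rewrite sg_sym (copy_edge cf) ?pq // /band; nat_lia.
- by rewrite pq sg_irrefl /band; nat_lia.
Qed.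

Lemma layout_eq p q : p < n -> q < n -> (f p == f q) = (p == q).
Proof.
have [cf _] := lay; move=> pn qn.
by apply/eqP/eqP => [/(copy_inj cf pn qn)|->].
Qed.

Definition label_edge (l : nat * bool) : {set G} := [set f l.1; f (l.1.+1 + l.2)].

Lemma label_edge_edges l : valid_label n b l -> label_edge l \in edges G.
Proof.
case: l => i t /andP[/= itn bi]; rewrite inE.
apply/existsP; exists (f i); apply/existsP; exists (f (i.+1 + t)); rewrite eqxx andbT.
by rewrite layout_adj /band //; last (by nat_lia); case: t bi {itn} => /= [->|_]; nat_lia.
Qed.

Lemma edge_label (A : gallai G) :
  exists l, valid_label n b l && (val A == label_edge l).
Proof.
have := valP A; rewrite inE => /existsP[x /existsP[y /andP[xy /eqP AE]]].
have [_ full] := lay; have /copy_setP[p pn xE] := full x; have /copy_setP[q qn yE] := full y.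
have wlog_lt u v : u < n -> v < n -> u < v -> f u -- f v ->
    valid_label n b (u, v == u.+2) && ([set f u; f v] == label_edge (u, v == u.+2)).
  move=> un vn uv; rewrite layout_adj // /valid_label /label_edge /band /=.
  have [vE|v2 H] := eqVneq v u.+2; first by subst v; rewrite /= addn1 eqxx; nat_lia.
  have vE : v = u.+1 by nat_lia.
  by rewrite vE addn0 eqxx /=; nat_lia.
rewrite AE xE yE in xy *; case: (ltngtP p q) => pq.
- by exists (p, q == p.+2); apply: wlog_lt.
- by exists (q, p == q.+2); rewrite setUC; apply: wlog_lt => //; rewrite sg_sym.
- by move: xy; rewrite pq sg_irrefl.
Qed.

Lemma gallai_label_adj (A B : gallai G) l l' :
  valid_label n b l -> valid_label n b l' -> val A = label_edge l -> val B = label_edge l' ->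
  (A -- B) = label_adj b l l'.
Proof.
have up_adj (A' B' : gallai G) k k' : valid_label n b k -> valid_label n b k' ->
    val A' = label_edge k -> val B' = label_edge k' -> label_up b k k' -> A' -- B'.
  case: k k' => [i t] [j s] vk vk' AE BE /andP[/eqP ji adj].
  move: vk vk' ji adj => /andP[/= itn bi] /andP[/= jsn bj] /= ji adj.
  apply/existsP; exists (f i); apply/existsP; exists (f j); apply/existsP; exists (f (j.+1 + s)).
  rewrite AE BE /label_edge /= ji eqxx eqxx layout_eq ?layout_adj //; try nat_lia.
  by move: adj; rewrite /band; case: t bi {itn jsn AE ji} => /= bi; case: s bj {BE} => /= bj; nat_lia.
move=> vl vl' AE BE; apply/idP/orP => [|[]]; last first.
- by move=> /(up_adj B A _ _ vl' vl BE AE); rewrite sg_sym.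
- exact: up_adj.
move: l l' vl vl' AE BE => [i t] [j s] vl vl' AE BE.
move=> /existsP[u /existsP[v /existsP[w /and4P[uw /eqP AE' /eqP BE' nuw]]]].
move: vl vl' => /andP[/= itn bi] /andP[/= jsn bj].
have ne p q : p < q < n -> f p != f q by move=> pq; rewrite layout_eq; nat_lia.
have [||[Ei Ei']|[Ei Ei']] := @set2_eq _ (f i) (f (i.+1 + t)) u v; first by rewrite -AE' AE.
- by apply: ne; nat_lia.
- have [||[Ej Ej']|[Ej Ej']] := @set2_eq _ (f j) (f (j.+1 + s)) v w; first by rewrite -BE' BE.
  + by apply: ne; nat_lia.
  + have ji : j = i.+1 + t.
      by apply/eqP; rewrite -(@layout_eq j (i.+1 + t)) ?Ej ?Ei' //; nat_lia.
    left; rewrite /label_up /= ji eqxx /=; apply/negP => /and3P[t0 s0 b0].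
    move: nuw; rewrite -Ei -Ej' layout_adj ?ji; try nat_lia.
    by rewrite /band b0; nat_lia.
  (* With a common upper end the lower ends are consecutive, so the two edges span a triangle. *)
  + have ji : j.+1 + s = i.+1 + t.
      by apply/eqP; rewrite -(@layout_eq (j.+1 + s) (i.+1 + t)) ?Ej' ?Ei' //; nat_lia.
    exfalso; move: uw nuw; rewrite -Ei -Ej layout_adj ?layout_eq //; try nat_lia.
    by rewrite /band; case: t ji {bi itn AE Ei'}; case: s {bj jsn BE Ej'}; nat_lia.
- have [||[Ej Ej']|[Ej Ej']] := @set2_eq _ (f j) (f (j.+1 + s)) v w; first by rewrite -BE' BE.
  + by apply: ne; nat_lia.
  + have ji : j = i.
      by apply/eqP; rewrite -(@layout_eq j i) ?Ej ?Ei //; nat_lia.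
    exfalso; move: uw nuw; rewrite -Ei' -Ej' layout_adj ?layout_eq //; try nat_lia.
    by rewrite /band; case: t {bi itn AE Ei'}; case: s {bj jsn BE Ej'}; nat_lia.
  + have ji : j.+1 + s = i.
      by apply/eqP; rewrite -(@layout_eq (j.+1 + s) i) ?Ej' ?Ei //; nat_lia.
    right; rewrite /label_up /= ji eqxx /=; apply/negP => /and3P[t0 s0 b0].
    move: nuw; rewrite -Ei' -Ej layout_adj; try nat_lia.
    by rewrite /band b0; nat_lia.
Qed.

Lemma layout_tree rk root : label_tree n b rk root -> tree (gallai G).
Proof.
case=> vroot parent uniq_parent.
pose lab A := xchoose (edge_label A).
have labP A : valid_label n b (lab A) /\ val A = label_edge (lab A).
  by have /andP[? /eqP] := xchooseP (edge_label A).
have adjE (A B : gallai G) : (A -- B) = label_adj b (lab A) (lab B).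
  by have [vA eA] := labP A; have [vB eB] := labP B; apply: gallai_label_adj.
have lab_inj A B : lab A = lab B -> A = B.
  by move=> E; apply: val_inj; rewrite (labP A).2 (labP B).2 E.
pose edge l (vl : valid_label n b l) : gallai G := Sub (label_edge l) (label_edge_edges vl).
have labK l (vl : valid_label n b l) : lab (edge l vl) = l.
  have [vl' /= E] := labP (edge l vl).
  move: (lab _) vl' E => -[i t]; case: l vl => j s vl vl' E.
  move: vl vl' E => /andP[/= jn _] /andP[/= itn _] /esym E.
  have ne : f i != f (i.+1 + t) by rewrite layout_eq; nat_lia.
  case: (set2_eq E ne) => -[] /eqP + /eqP; rewrite !layout_eq /=; try nat_lia.
  by move=> /eqP -> /eqP /addnI; case: t {itn E ne}; case: s {jn}.
apply: (@tree_of_rank _ (fun A => rk (lab A)) (edge _ vroot)).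
  move=> A nroot; have [|l' /andP[vl' adj] lt] := parent _ (labP A).1.
    by apply: contra_neq nroot => E; apply: lab_inj; rewrite labK.
  by exists (edge _ vl'); rewrite ?adjE labK.
move=> A B C; rewrite !adjE => AB AC BA CA; apply: lab_inj.
by apply: (uniq_parent (lab A)); rewrite ?(labP _).1.
Qed.

End LayoutTree.

Theorem tree_of_chain (G : sgraph) : chain G -> tree (gallai G).
Proof.
move=> [n [b [f [lay n1 [[pre [suf [c [bE n6 n10 cP]]]]|[n6 b4]]]]]].
  exact: (layout_tree lay (label_tree_good n1 bE n6 n10 cP)).
apply: (@layout_tree _ 6 (gtn 4) f _ _ _ label_tree_sq6); case: lay; rewrite n6 => cf full.
by split=> //; apply: copy_eq cf => i j ij; rewrite /band b4.
Qed.

(** * Blocks as maximal nonseparable vertex sets *)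

Lemma connect_homo (T T' : finType) (e : rel T) (e' : rel T') (h : T -> T') x y :
  (forall a b, e a b -> e' (h a) (h b)) -> connect e x y -> connect e' (h x) (h y).
Proof.
move=> he /connectP[p + ->] {y}; elim: p x => //= z p IH x /andP[/he xz /IH].
exact: connect_trans (connect1 xz).
Qed.

Section Nonseparable.
Variable G : sgraph.
Implicit Types (S T : {set G}) (x y z v : G).

(** A relation on all of [G], so that connectivity inside different vertex sets can be compared
    without nested subtypes. *)
Definition in_rel S : rel G := [rel x y | [&& x \in S, y \in S & x -- y]].

Lemma in_relS S T x y : S \subset T -> connect (in_rel S) x y -> connect (in_rel T) x y.
Proof.
move=> /subsetP ST; apply: (connect_homo (h := id)) => a b /and3P[aS bS ab].
by rewrite /in_rel /= !ST.
Qed.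

Lemma in_rel_connC S : connect_sym (in_rel S).
Proof.
by apply: sym_connect_sym => x y; rewrite /in_rel /= andbCA sg_sym.
Qed.

Lemma in_rel_lift (T : finType) (h : T -> G) S (e : rel T) (x y : T) :
  injective h -> (forall a, a \in S -> exists x : T, h x = a) ->
  (forall x y : T, h x \in S -> h y \in S -> h x -- h y -> e x y) ->
  connect (in_rel S) (h x) (h y) -> connect e x y.
Proof.
move=> h_inj hS he /connectP[p]; elim: p x => [|a p IH] x /=.
  by move=> _ /h_inj ->; apply: connect0.
move=> /andP[/and3P[xS aS xa] pa] yE; have [z zE] := hS a aS; subst a.
by apply: connect_trans (connect1 (he _ _ xS aS xa)) _; apply: IH.
Qed.

(** Counterpart of [nonseparable] for vertex sets; deleting a vertex [v] outside [S] changes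
    nothing, so [v] may range over all of [G]. *)
Definition nonsep S : bool :=
  [&& S != set0, [forall x in S, forall y in S, connect (in_rel S) x y] &
      [forall v, forall x in S :\ v, forall y in S :\ v, connect (in_rel (S :\ v)) x y]].

Lemma nonsepP S :
  reflect [/\ exists x, x \in S,
              {in S &, forall x y, connect (in_rel S) x y} &
              forall v, {in S :\ v &, forall x y, connect (in_rel (S :\ v)) x y}]
          (nonsep S).
Proof.
apply: (iffP and3P) => -[S0 cS cv]; split.
- exact/set0Pn.
- by move=> x y xS yS; move/forall_inP: cS => /(_ x xS) /forall_inP/(_ y yS).
- move=> v x y xS yS; move/forallP: cv => /(_ v) /forall_inP/(_ x xS).
  by move=> /forall_inP/(_ y yS).
- exact/set0Pn.
- by apply/forall_inP => x xS; apply/forall_inP => y yS; apply: cS.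
- apply/forallP => v; apply/forall_inP => x xS; apply/forall_inP => y yS.
  exact: cv.
Qed.

Lemma mem_edges x y : ([set x; y] \in edges G) = (x -- y).
Proof.
rewrite inE; apply/existsP/idP => [[a /existsP[b /andP[ab /eqP /esym E]]] | xy].
  by have [[<- <-]|[<- <-]] := set2_eq E (sedge_neq ab); rewrite // sg_sym.
by exists x; apply/existsP; exists y; rewrite xy eqxx.
Qed.

Lemma nonsep_sub (H : subgraph G) : nonseparable (graph_of H) -> nonsep (sub_vertices H).
Proof.
have subE (x y : graph_of H) : x -- y -> val x -- val y.
  by move=> xy; rewrite -mem_edges; have /andP[/subsetP/(_ _ xy)] := valP H.
move=> /andP[/andP[/card_gt0P[x0 _] /forallP cH] /forallP cutH].
have cV : {in sub_vertices H &, forall x y, connect (in_rel (sub_vertices H)) x y}.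
  move=> x y xS yS; have /forallP/(_ (Sub y yS)) := cH (Sub x xS).
  move=> /(connect_homo (h := val) (e' := in_rel (sub_vertices H))); apply.
  by move=> a b /subE ab; rewrite /in_rel /= !(valP a) !(valP b).
apply/nonsepP; split=> [|//|v]; first by exists (val x0); apply: valP.
have [vS|vS] := boolP (v \in sub_vertices H); last first.
  suff -> : sub_vertices H :\ v = sub_vertices H by [].
  by apply/setP => x; rewrite !inE; case: eqVneq => // ->; rewrite (negbTE vS).
move=> x y; rewrite !inE => /andP[xv xS] /andP[yv yS].
have := cutH (Sub v vS); rewrite /cut_vertex => /existsPn.
pose x1 : graph_of H := Sub x xS; pose y1 : graph_of H := Sub y yS.
pose v1 : graph_of H := Sub v vS.
have xI : x1 \in [set~ v1] by rewrite !inE -val_eqE.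
have yI : y1 \in [set~ v1] by rewrite !inE -val_eqE.
move=> /(_ (Sub x1 xI)) /existsPn /(_ (Sub y1 yI)).
have /forallP/(_ y1) := cH x1; rewrite !SubK => -> /= /negPn.
move=> /(connect_homo (h := fun z : induced [set~ v1] => val (val z)) (e' := in_rel (sub_vertices H :\ v))).
apply=> a b /subE ab; rewrite /in_rel /= !inE ab (valP (val a)) (valP (val b)) !andbT.
have := valP a; have := valP b; rewrite !inE -!val_eqE /=.
by move=> -> ->.
Qed.

Lemma fullsub_proof S :
  ((S, [set A in edges G | A \subset S]).2 \subset edges G) &&
  [forall A in (S, [set A in edges G | A \subset S]).2, A \subset (S, [set A in edges G | A \subset S]).1].
Proof.
apply/andP; split; first by apply/subsetP => A; rewrite inE => /andP[].
by apply/forall_inP => A; rewrite inE => /andP[].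
Qed.

Definition fullsub S : subgraph G := Sub (S, [set A in edges G | A \subset S]) (fullsub_proof S).

Lemma fullsub_edge S (x y : graph_of (fullsub S)) : (x -- y) = (val x -- val y).
Proof.
rewrite [LHS]inE mem_edges; apply: andb_idr => _.
by apply/subsetP => z; rewrite !inE => /orP[] /eqP ->; apply: valP.
Qed.

Lemma nonsep_fullsub S : nonsep S -> nonseparable (graph_of (fullsub S)).
Proof.
move=> /nonsepP[[x0 x0S] cS cv]; apply/andP; split; first apply/andP; first split.
- by apply/card_gt0P; exists (Sub x0 x0S).
- apply/forallP => x; apply/forallP => y.
  apply: (in_rel_lift (h := val) (S := S)); first exact: val_inj.
  + by move=> a aS; exists (Sub a aS).
  + by move=> a b _ _; rewrite -fullsub_edge.
  + by apply: cS; apply: valP.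
apply/forallP => v; apply/existsPn => x; apply/existsPn => y.
rewrite negb_and negbK; apply/orP; right.
apply: (in_rel_lift (h := fun z : induced [set~ v] => val (val z)) (S := S :\ val v)).
- by move=> a b /val_inj /val_inj.
- move=> a; rewrite !inE => /andP[av aS].
  have aI : (Sub a aS : graph_of (fullsub S)) \in [set~ v] by rewrite !inE -val_eqE.
  by exists (Sub (Sub a aS : graph_of (fullsub S)) aI).
- by move=> a b _ _ ab; rewrite -[a -- b]/(val a -- val b) fullsub_edge.
by apply: cv; rewrite !inE; [have := valP x | have := valP y]; rewrite !inE -val_eqE => ->;
  apply: valP.
Qed.

(** Adding all edges of [G] inside the vertex set keeps a subgraph nonseparable. A maximal one is
    therefore induced and determined by its vertices. *)
Lemma block_fullsub (B : subgraph G) : block B ->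
  B = fullsub (sub_vertices B) /\ maxset nonsep (sub_vertices B).
Proof.
move=> /andP[nsB /forallP maxB].
have nsV := nonsep_sub nsB.
have le_full T : sub_vertices B \subset T -> sub_le B (fullsub T).
  move=> BT; rewrite /sub_le BT /=; apply/subsetP => A AB.
  have /andP[/subsetP/(_ _ AB) Ae /forall_inP/(_ _ AB) AV] := valP B.
  by rewrite inE Ae (subset_trans AV BT).
have full T : nonsep T -> sub_vertices B \subset T -> fullsub T = B.
  move=> nT BT; have /implyP := maxB (fullsub T).
  by rewrite le_full // nonsep_fullsub // => /(_ isT) /eqP.
split; first by rewrite full.
apply/maxsetP; split=> // T nT BT.
by rewrite -[in RHS](full T nT BT).
Qed.

Lemma maxset_block S : maxset nonsep S -> block (fullsub S).
Proof.
move=> /maxsetP[nS maxS]; rewrite /block nonsep_fullsub //=; apply/forallP => K.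
apply/implyP => /andP[/andP[SK EK] /nonsep_sub nK]; have VK := maxS _ nK SK.
apply/eqP/val_inj; rewrite /= [val K]surjective_pairing; congr pair => //.
apply/eqP; rewrite eqEsubset [X in _ && X]EK andbT; apply/subsetP => A AK.
have /andP[/subsetP/(_ _ AK) Ae /forall_inP/(_ _ AK) AV] := valP K.
by rewrite inE Ae -VK.
Qed.

Lemma iso_fullsub S H : isomorphic (graph_of (fullsub S)) H <-> isomorphic (induced S) H.
Proof.
split=> -[f fb fE]; exists f => // x y; first by rewrite fE fullsub_edge.
by rewrite [RHS]fullsub_edge fE.
Qed.

Lemma cut_vertexP v :
  reflect (exists x y, [/\ x != v, y != v, connect sedge x y & ~~ connect (in_rel [set~ v]) x y])
          (cut_vertex v).
Proof.
have lift (x y : induced [set~ v]) :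
    connect sedge x y = connect (in_rel [set~ v]) (val x) (val y).
  apply/idP/idP.
    apply: connect_homo => a b ab.
    by apply/and3P; split; [exact: valP | exact: valP | exact: ab].
  apply: in_rel_lift; first exact: val_inj.
  - by move=> a aS; exists (Sub a aS).
  - by [].
apply: (iffP existsP) => [[x /existsP[y /andP[cxy ncxy]]] | [x [y [xv yv cxy ncxy]]]].
  exists (val x), (val y); split=> //.
  - by have := valP x; rewrite !inE.
  - by have := valP y; rewrite !inE.
  - by rewrite -lift.
have xI : x \in [set~ v] by rewrite !inE.
have yI : y \in [set~ v] by rewrite !inE.
exists (Sub x xI); apply/existsP; exists (Sub y yI).
by rewrite lift cxy.
Qed.

End Nonseparable.

(** * The blocks of a layout *)

Lemma iso_card (G : sgraph) (S : {set G}) m (R : rel 'I_m) :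
  isomorphic (induced S) (symm_graph R) -> #|S| = m.
Proof. by case=> h /bij_eq_card; rewrite card_sig card_ord. Qed.

Lemma cards3_le (T : finType) (x y z : T) : #|[set x; y; z]| <= 3.
Proof. by rewrite cardsU cards2 cards1; lia. Qed.

Lemma copy_relabel (G : sgraph) m k r r' (e : nat -> G) (p : nat -> nat) :
  copy m r e -> (forall i, i < k -> p i < m) ->
  (forall i j, i < j < k -> (p i < p j) && (r (p i) (p j) == r' i j) ||
                            (p j < p i) && (r (p j) (p i) == r' i j)) ->
  copy k r' (fun i => e (p i)).
Proof.
move=> ce pm pr i j ij; have im := pm i; have jm := pm j.
case/orP: (pr i j ij) => /andP[lt /eqP <-]; first by apply: ce; lia.
by have [|ne E] := ce (p j) (p i); [lia | rewrite sg_sym eq_sym ne E].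
Qed.

Section LayoutBlocks.
Variables (G : sgraph) (n : nat) (b : nat -> bool) (f : nat -> G).
Hypothesis lay : layout n b f.
Hypothesis n1 : 1 < n.

Lemma layout_pos (x : G) : exists2 i, i < n & x = f i.
Proof. by have [_ full] := lay; apply/copy_setP. Qed.

(** Walk down from [q] by short edges and pass over [d] on the long edge at [d.-1]. With [d = n]
    nothing is avoided. *)
Lemma layout_skip (S : {set G}) d p q : p < q < n -> p != d -> q != d ->
  (p < d < q -> b d.-1) -> (forall a, p <= a <= q -> a != d -> f a \in S) ->
  connect (in_rel S) (f p) (f q).
Proof.
elim/ltn_ind: q => q IH pq pd qd bd inS.
have step a : p <= a < q -> a != d -> f a -- f q -> connect (in_rel S) (f p) (f q).
  move=> aq ad eaq.
  have last : connect (in_rel S) (f a) (f q).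
    by apply: connect1; rewrite /in_rel /= eaq !inS //; nat_lia.
  have [<- //|pa] := eqVneq a p.
  apply: connect_trans last; apply: IH; try nat_lia.
  by move=> c ca cd; apply: inS => //; nat_lia.
have [dq|dq] := eqVneq q.-1 d.
  apply: (step q.-2); [nat_lia | nat_lia |].
  rewrite (layout_adj lay) /band; [|nat_lia|nat_lia].
  have -> : b q.-2 by rewrite (_ : q.-2 = d.-1); [apply: bd; nat_lia | nat_lia].
  by nat_lia.
apply: (step q.-1) => //; first by nat_lia.
by rewrite (layout_adj lay) /band; nat_lia.
Qed.

Lemma layout_skip_sym (S : {set G}) d p q : p < n -> q < n -> p != d -> q != d ->
  (minn p q < d < maxn p q -> b d.-1) ->
  (forall a, minn p q <= a <= maxn p q -> a != d -> f a \in S) ->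
  connect (in_rel S) (f p) (f q).
Proof.
move=> pn qn pd qd bd inS; case: (ltngtP p q) => pq.
- apply: (@layout_skip _ d) => //; first by nat_lia.
  + by move=> H; apply: bd; nat_lia.
  + by move=> a H; apply: inS; nat_lia.
- rewrite in_rel_connC; apply: (@layout_skip _ d) => //; first by nat_lia.
  + by move=> H; apply: bd; nat_lia.
  + by move=> a H; apply: inS; nat_lia.
- by rewrite pq connect0.
Qed.

(** Only {d-1, d+1} could jump over [d]; without it the positions below [d] are closed under
    adjacency in [S]. *)
Lemma layout_separates (S : {set G}) d p q : f d \notin S -> d < n -> b d.-1 = false ->
  p < n -> q < n -> connect (in_rel S) (f p) (f q) -> (p < d) = (q < d).
Proof.
move=> dS dn bd pn qn cpq.
pose L := [pred x | x \in copy_set d f].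
have L_lt a : a < n -> (f a \in L) = (a < d).
  move=> an; apply/copy_setP/idP => [[i id /eqP]|ad]; last by exists a.
  by rewrite (layout_eq lay) //; [move/eqP => -> | nat_lia].
have step x y : in_rel S x y -> x \in L -> y \in L.
  have [i i_n ->] := layout_pos x; have [j jn ->] := layout_pos y.
  move=> /and3P[iS jS]; rewrite (layout_adj lay) // => adj; rewrite !L_lt // => id.
  have jd : j != d by apply: contraNneq dS => <-.
  have [/eqP E|ne] := boolP (i == d.-1); last first.
    by move: adj; rewrite /band; nat_lia.
  by move: adj; rewrite /band E bd; nat_lia.
have cl : closed (in_rel S) L.
  apply: intro_closed => [|x y]; last exact: step.
  exact: in_rel_connC.
by rewrite -!L_lt //; apply: (closed_connect cl).
Qed.

Lemma layout_connect (x y : G) : connect sedge x y.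
Proof.
have [p pn ->] := layout_pos x; have [q qn ->] := layout_pos y.
have : connect (in_rel [set: G]) (f p) (f q).
  apply: (@layout_skip_sym _ n) => //; try nat_lia.
apply: (connect_homo (h := id)) => u v.
by case/and3P.
Qed.

Lemma cut_vertex_layout d : d < n -> cut_vertex (f d) = [&& 0 < d, d.+1 < n & ~~ b d.-1].
Proof.
move=> dn; apply/cut_vertexP/and3P => [[x [y []]]|[d0 d1 bd]].
  have [p pn ->] := layout_pos x; have [q qn ->] := layout_pos y.
  rewrite !(layout_eq lay) // => pd qd _ ncut.
  have nskip : ~ (minn p q < d < maxn p q -> b d.-1).
    move=> bd; move/negP: ncut; apply; apply: (@layout_skip_sym _ d) => // a aq ad.
    by rewrite !inE (layout_eq lay) //; nat_lia.
  split; [apply: contraT| apply: contraT | apply/negP] => H; case: nskip => //; nat_lia.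
exists (f d.-1), (f d.+1); rewrite !(layout_eq lay) //; try nat_lia.
split; [nat_lia | nat_lia | exact: layout_connect |].
have dS : f d \notin [set~ f d] by rewrite !inE eqxx.
have [dp ds] : d.-1 < n /\ d.+1 < n by nat_lia.
by apply/negP => /(layout_separates dS dn (negbTE bd) dp ds); nat_lia.
Qed.

Definition interval i k : {set G} := copy_set k (fun a => f (i + a)).

Lemma mem_interval i k p : i + k <= n -> p < n -> (f p \in interval i k) = (i <= p < i + k).
Proof.
move=> ik pn; apply/copy_setP/idP => [[a ak /eqP]|H].
  by rewrite (layout_eq lay) //; nat_lia.
by exists (p - i); [nat_lia | congr f; nat_lia].
Qed.

Definition run i k := forall a, i <= a -> a + 2 < i + k -> b a.

Lemma interval_nonsep i k : 0 < k -> i + k <= n -> run i k -> nonsep (interval i k).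
Proof.
move=> k0 ik rn; apply/nonsepP; split.
- by exists (f i); rewrite mem_interval //; nat_lia.
- move=> x y; have [p pn ->] := layout_pos x; have [q qn ->] := layout_pos y.
  rewrite !mem_interval // => pi qi.
  apply: (@layout_skip_sym _ n) => //; try nat_lia.
  by move=> a aq an; rewrite mem_interval //; nat_lia.
- move=> v x y; have [d dn ->] := layout_pos v.
  have [p pn ->] := layout_pos x; have [q qn ->] := layout_pos y.
  rewrite ![_ \in _ :\ _]inE ![_ \in [set f d]]inE !mem_interval // !(layout_eq lay) //.
  move=> pi qi; apply: (@layout_skip_sym _ d) => //; try nat_lia.
    by move=> dd; apply: rn; nat_lia.
  by move=> a aq ad; rewrite !in_setD1 (layout_eq lay) ?mem_interval //; nat_lia.
Qed.

Lemma nonsep_run (S : {set G}) p q d : nonsep S -> f p \in S -> f q \in S ->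
  q < n -> p < d < q -> b d.-1.
Proof.
move=> /nonsepP[_ cS cv] pS qS qn pdq; apply/negPn/negP => /negbTE bd.
have [dn pn] : d < n /\ p < n by nat_lia.
have dv : f d \notin S :\ f d by rewrite !inE eqxx.
have := layout_separates dv dn bd pn qn.
have -> : connect (in_rel (S :\ f d)) (f p) (f q).
  apply: cv; rewrite !inE ?pS ?qS andbT (layout_eq lay) //; nat_lia.
by move=> /(_ isT); nat_lia.
Qed.

(** Every position strictly between the extreme ones of [S] is jumped over, so the whole interval is
    nonseparable. Maximality makes it equal to [S] and prevents it from growing on either side. *)
Lemma maxset_interval (S : {set G}) : maxset (@nonsep G) S -> exists i k,
  [/\ 1 < k, i + k <= n & S = interval i k] /\
  [/\ run i k, 0 < i -> b i.-1 = false & i + k < n -> b (i + k - 2) = false].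
Proof.
move=> /maxsetP[nS maxS]; have /nonsepP[[x0 x0S] _ _] := nS.
have [p0 p0n x0E] := layout_pos x0; rewrite x0E in x0S.
have ex : exists p, (p < n) && (f p \in S) by exists p0; rewrite p0n.
case: (ex_minnP ex) => i /andP[i_n iS] imin.
have ub p : (p < n) && (f p \in S) -> p <= n by move=> /andP[/ltnW].
case: (ex_maxnP ex ub) => j /andP[jn jS] jmax.
have ij : i <= j by apply: imin; rewrite jn.
have rn : run i (j - i).+1.
  move=> a ia aj; rewrite -[a]/(a.+1.-1); apply: (nonsep_run nS iS jS jn); nat_lia.
have SE : S = interval i (j - i).+1.
  apply/esym/maxS; first by apply: interval_nonsep => //; nat_lia.
  apply/subsetP => x xS; have [p pn xE] := layout_pos x; rewrite xE in xS *.
  rewrite mem_interval //; last by nat_lia.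
  have := imin p; have := jmax p; rewrite pn xS; nat_lia.
have grow i' k' : 0 < k' -> i' + k' <= n -> run i' k' -> i' <= i -> j < i' + k' ->
    i' = i /\ i' + k' = j.+1.
  move=> k0 ikn rn' ii jk; have E : interval i' k' = S.
    apply: maxS; first exact: interval_nonsep.
    apply/subsetP => x; rewrite SE; have [p pn ->] := layout_pos x.
    by rewrite !mem_interval //; nat_lia.
  have := mem_interval ikn i_n; have := mem_interval ikn jn.
  have := @mem_interval i' k' i' ikn; have := @mem_interval i' k' (i' + k' - 1) ikn.
  rewrite E SE !mem_interval //; nat_lia.
exists i, (j - i).+1; split; split=> //; try nat_lia.
(* A single vertex is not maximal: as [1 < n], it forms an edge with a neighbouring position. *)
- have [//|ji] := ltnP 1 (j - i).+1.
  have [j1|j1] := ltnP j.+1 n.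
    have [|||||E1 E2] := grow i (j - i).+2; try nat_lia.
    by move=> a ia aj; nat_lia.
  have [|||||E1 E2] := grow i.-1 (j - i).+2; try nat_lia.
  by move=> a ia aj; nat_lia.
- move=> i0; apply/negP => bi.
  have [|||||E1 E2] := grow i.-1 (j - i).+2; try nat_lia.
  move=> a ia aj; have [->//|ai] := eqVneq a i.-1.
  by apply: rn; nat_lia.
- move=> ikn; apply/negP => bi.
  have [|||||E1 E2] := grow i (j - i).+2; try nat_lia.
  move=> a ia aj; have [->//|ai] := eqVneq a (i + (j - i).+1 - 2).
  by apply: rn; nat_lia.
Qed.

End LayoutBlocks.

(** * Runs of ones and the shape of blocks *)

Section GoodBlocks.
Variables (n : nat) (b c : nat -> bool) (pre suf : bool).
Hypothesis n1 : 1 < n.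
Hypothesis bE : forall i, b i = [|| pre && (i < 3), c i | [&& suf, n <= i + 5 & i + 3 <= n]].
Hypothesis n6 : pre || suf -> 6 <= n.
Hypothesis n10 : pre && suf -> 10 <= n.
Hypothesis cP : forall i, c i -> [&& 0 < i, i + 4 <= n, ~~ c i.+1, ~~ c i.+2,
                         pre ==> (5 <= i) & suf ==> (i + 8 <= n)].

Lemma good_word_gap k : b k -> b k.+2 -> b k.+1.
Proof.
move=> bk bk2; have [/andP[p k3]|kp] := boolP (pre && (k < 3)).
  have [b0 b1 b2 b3 b4] := good_word_pre n1 bE n6 n10 cP p.
  by case: k k3 bk bk2 => [|[|[]]] //=; rewrite b4.
by have [] := run_gap n1 bE n6 n10 cP bk bk2 kp.
Qed.

Lemma maximal_run i k : 2 < k -> i + k <= n -> run b i k ->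
  (0 < i -> b i.-1 = false) -> (i + k < n -> b (i + k - 2) = false) ->
  [/\ k = 3, 0 < i, i + 4 <= n & b i.+1 = false] \/
  [/\ k = 5, 6 <= n & i = 0 \/ i + 5 = n].
Proof.
move=> k2 ik rn lmax rmax; have bi : b i by apply: rn; nat_lia.
have kn m : k = m -> i + m < n -> b (i + m - 2) = false by move=> <-.
have [/andP[p i3]|ip] := boolP (pre && (i < 3)).
  have [b0 b1 b2 b3 b4] := good_word_pre n1 bE n6 n10 cP p.
  have n6' : 6 <= n by apply: n6; rewrite p.
  have i0 : i = 0 by case: i i3 lmax {bi ik rn rmax kn} => [|[|[]]] //= _ /(_ isT); rewrite ?b0 ?b1.
  subst i; right; split=> //; last by left.
  have k5 : k <= 5 by rewrite leqNgt; apply/negP => k5; have := rn 3; rewrite b3 => /(_ isT); nat_lia.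
  have k3 : k != 3 by apply/eqP => k3; have := kn 3 k3; rewrite b1 => /(_ _); nat_lia.
  have k4 : k != 4 by apply/eqP => k4; have := kn 4 k4; rewrite b2 => /(_ _); nat_lia.
  nat_lia.
have [/and5P[i0 i4 _ b1 _]|/and3P[sf i5 i3]] := good_word_case n1 bE n6 n10 cP bi ip.
  left; split=> //; last exact: negbTE.
  have [//|k4] := eqVneq k 3; have : b i.+1 by apply: rn; nat_lia.
  by rewrite (negbTE b1).
have n6' : 6 <= n by apply: n6; rewrite sf orbT.
have sufE := good_word_suf n1 bE n6 n10 cP sf.
have i5' : i + 5 = n by have := lmax; rewrite sufE; nat_lia.
right; split=> //; last by right.
have k3 : k != 3.
  by apply/eqP => k3; have := kn 3 k3; rewrite sufE; nat_lia.
have k4 : k != 4.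
  by apply/eqP => k4; have := kn 4 k4; rewrite sufE; nat_lia.
nat_lia.
Qed.

Section Blocks.
Variables (G : sgraph) (f : nat -> G).
Hypothesis lay : layout n b f.

Lemma interval_copy i k : i + k <= n -> copy k (band (fun a => b (i + a))) (fun a => f (i + a)).
Proof.
have [cf _] := lay => ik p q pq; have [|ne ->] := cf (i + p) (i + q); first nat_lia.
by rewrite ne; split=> //; rewrite /band; nat_lia.
Qed.

Lemma block_interval (B : subgraph G) : block B -> exists i k,
  [/\ 1 < k, i + k <= n & B = fullsub (interval f i k)] /\
  [/\ run b i k, 0 < i -> b i.-1 = false & i + k < n -> b (i + k - 2) = false].
Proof.
move=> /block_fullsub[BE /(maxset_interval lay n1)[i [k [[k1 ik SE] rest]]]].
by exists i, k; split=> //; split=> //; rewrite BE SE.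
Qed.

Lemma interval_card i k : i + k <= n -> #|interval f i k| = k.
Proof. by move=> /interval_copy/card_copy_set. Qed.

Lemma interval2_iso i : i + 2 <= n ->
  isomorphic (induced (interval f i 2)) (complete_graph 2).
Proof.
move=> i2; apply: (copy_iso (interval_copy i2)) => p q pq; rewrite /symm_rel /= /band.
by have := ltn_ord q; rewrite neq_ltn pq; nat_lia.
Qed.

Lemma interval3_iso i : i + 3 <= n -> b i ->
  isomorphic (induced (interval f i 3)) (complete_graph 3).
Proof.
move=> i3 bi; apply: (copy_iso (interval_copy i3)) => p q pq; rewrite /symm_rel /= /band.
have := ltn_ord q; rewrite neq_ltn pq /=.
have [->|] := eqVneq (p : nat) 0; [rewrite addn0 bi | ]; nat_lia.
Qed.

Lemma interval5_iso i : i + 5 <= n -> b i -> b i.+1 -> b i.+2 ->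
  isomorphic (induced (interval f i 5)) gem.
Proof.
(* In [P_5^2] the induced path of the gem is 4, 3, 1, 0 and the hub is 2. *)
move=> i5 b0 b1 b2; pose p a := nth 0 [:: 4; 3; 1; 0; 2] a.
have -> : interval f i 5 = copy_set 5 (fun a => f (i + p a)).
  apply/setP => x; apply/copy_setP/copy_setP => -[a a5 ->].
    by case: a a5 => [|[|[|[|[|]]]]] // _; [exists 3 | exists 2 | exists 4 | exists 1 | exists 0].
  by exists (p a) => //; case: a a5 => [|[|[|[|[|]]]]].
apply: (@copy_iso _ _ (prel [:: (1,2); (2,3); (3,4); (1,5); (2,5); (3,5); (4,5)]) (fun a => f (i + p a))).
  apply: (copy_relabel (p := p) (interval_copy i5)); first by case=> [|[|[|[|[|]]]]].
  move=> [|[|[|[|[|?]]]]] [|[|[|[|[|?]]]]] //=; rewrite ?andbF // => _;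
    by rewrite /band /= ?addn0 ?addn1 ?addn2 ?b0 ?b1 ?b2.
by move=> u v uv; apply: symm_prel.
Qed.

Lemma chain_block_iso (B : subgraph G) : block B ->
  isomorphic (graph_of B) (complete_graph 2) \/
  isomorphic (graph_of B) (complete_graph 3) \/ isomorphic (graph_of B) gem.
Proof.
move=> /block_interval[i [k [[k1 ik ->] [rn lmax rmax]]]]; rewrite !iso_fullsub.
have [k2|k2] := ltnP 2 k; last first.
  by left; rewrite (_ : k = 2); [apply: interval2_iso; nat_lia | nat_lia].
right; have [[k3 _ _ _]|[k5 _ _]] := maximal_run k2 ik rn lmax rmax; subst k.
  by left; apply: interval3_iso => //; apply: rn; nat_lia.
by right; apply: interval5_iso => //; apply: rn; nat_lia.
Qed.

Lemma mem_fullsub (S : {set G}) x : (x \in sub_vertices (fullsub S)) = (x \in S).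
Proof. by []. Qed.

Lemma chain_cut_vertex (v : G) : cut_vertex v -> #|blocks_at v| <= 2 /\ degree v <= 3.
Proof.
have [d dn ->] := layout_pos lay v; rewrite (cut_vertex_layout lay n1) //.
move=> /and3P[d0 d1 /negbTE bd]; split; last first.
  (* At most one of the positions at distance 2 is adjacent to [d]: if both were, [good_word_gap]
     would set [b d.-1]. *)
  pose third := if b d then f d.+2 else f d.-2.
  apply: leq_trans (cards3_le (f d.-1) (f d.+1) third); apply/subset_leq_card/subsetP => x.
  have [p pn ->] := layout_pos lay x; rewrite !inE (layout_adj lay) // /band.
  have bdd : b d -> b d.-2 = false \/ d < 2.
    case: d {third d1 dn x p pn} d0 bd => [//|[|d]] _ bd bd'; [by right | left].
    by apply/negP => bd2; have := good_word_gap bd2 bd'; rewrite bd.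
  have [->|np1] := eqVneq p d.-1; first by rewrite eqxx.
  have [->|np2] := eqVneq p d.+1; first by rewrite eqxx orbT.
  rewrite /third; have [->|np3] := eqVneq p d.+2.
    by move=> H; have -> : b d by [move: H; nat_lia]; rewrite eqxx !orbT.
  have [pE|np4] := eqVneq d p.+2; last by nat_lia.
  rewrite pE in bdd *; rewrite /= => H; have bp : b p by move: H; nat_lia.
  case bd' : (b p.+2); last by rewrite eqxx !orbT.
  by have [] := bdd bd'; rewrite ?bp //; nat_lia.
(* A block through a cut vertex starts or ends there. Two maximal intervals sharing an end coincide,
   so this boolean identifies the block. *)
pose g (B : subgraph G) := f d.+1 \in sub_vertices B.
have shape B : B \in blocks_at (f d) -> exists i k,
    [/\ 1 < k, i + k <= n & sub_vertices B = interval f i k] /\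
    [/\ block B, if g B then i = d else i + k = d.+1 & run b i k].
  rewrite inE => /andP[blB]; have [i [k [[k1 ik BE] [rn _ _]]]] := block_interval blB.
  have VB : sub_vertices B = interval f i k by rewrite BE.
  rewrite VB (mem_interval lay n1) // => dik.
  exists i, k; split; split=> //.
  rewrite /g VB (mem_interval lay n1) //.
  have rd : ~~ ((i < d) && (d.+1 < i + k)).
    by apply/negP => /andP[id dk]; have := rn d.-1; rewrite bd; nat_lia.
  by case: ifP; nat_lia.
have g_inj : {in blocks_at (f d) &, injective g}.
  move=> B1 B2 /shape[i1 [k1 [[k11 ik1 V1] [bl1 s1 rn1]]]] /shape[i2 [k2 [[k21 ik2 V2] [bl2 s2 rn2]]]] gE.
  have [B1E /maxsetP[ns1 max1]] := block_fullsub bl1.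
  have [B2E /maxsetP[ns2 max2]] := block_fullsub bl2.
  rewrite B1E B2E; congr fullsub; rewrite gE in s1.
  have sub12 i k j l : i + k <= n -> j + l <= n -> j <= i -> i + k <= j + l ->
      interval f i k \subset interval f j l.
    move=> ik jl ji kl; apply/subsetP => x; have [p pn ->] := layout_pos lay x.
    by rewrite !(mem_interval lay n1) //; clear -ji kl; lia.
  have sides : (i1 == i2) || (i1 + k1 == i2 + k2).
    by case: (g B2) s1 s2 => -> ->; rewrite eqxx ?orbT.
  have [kk|kk] := leqP k1 k2.
    by apply/esym/max1 => //; rewrite V1 V2; apply: sub12 => //; clear -kk sides; lia.
  by apply: max2 => //; rewrite V1 V2; apply: sub12 => //; clear -kk sides; lia.
by rewrite -(card_in_imset g_inj) -card_bool max_card.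
Qed.

Lemma chain_block_K3 (B : subgraph G) : block B ->
  isomorphic (graph_of B) (complete_graph 3) -> #|cut_vertices_in B| = 2.
Proof.
move=> /block_interval[i [k [[k1 ik ->] [rn lmax rmax]]]] /iso_fullsub /iso_card.
rewrite interval_card // => k3; subst k.
have [[_ i0 i4 b1]|[]//] := maximal_run (leqnn 3) ik rn lmax rmax.
have bi : b i by apply: rn; nat_lia.
have -> : cut_vertices_in (fullsub (interval f i 3)) = [set f i; f i.+2].
  apply/setP => x; have [p pn ->] := layout_pos lay x.
  rewrite inE mem_fullsub (mem_interval lay n1) // (cut_vertex_layout lay n1) //.
  rewrite !inE !(layout_eq lay) //; try nat_lia.
  have [->|pi] := eqVneq p i; first by rewrite lmax //; nat_lia.
  have [->|pi2] := eqVneq p i.+2; first by rewrite /= b1; nat_lia.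
  have [->|pi1] := eqVneq p i.+1; first by rewrite /= bi; nat_lia.
  by nat_lia.
by rewrite cards2 (layout_eq lay); nat_lia.
Qed.

Lemma chain_block_gem (B : subgraph G) : block B ->
  isomorphic (graph_of B) gem -> #|cut_vertices_in B| = 1.
Proof.
move=> /block_interval[i [k [[k1 ik ->] [rn lmax rmax]]]] /iso_fullsub /iso_card.
rewrite interval_card // => k5; subst k.
have [[]//|[_ n6' ends]] := maximal_run (isT : 2 < 5) ik rn lmax rmax.
have [b0 b1 b2] : [/\ b i, b i.+1 & b i.+2] by split; apply: rn; nat_lia.
pose d := if i == 0 then 4 else i.
have -> : cut_vertices_in (fullsub (interval f i 5)) = [set f d]; last exact: cards1.
apply/setP => x; have [p pn ->] := layout_pos lay x.
rewrite [in LHS]inE mem_fullsub (mem_interval lay n1) // (cut_vertex_layout lay n1) //.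
rewrite !inE (layout_eq lay) //; last by rewrite /d; case: ifP; nat_lia.
have [->|p1] := eqVneq p i.+1; first by rewrite /= b0 /d; case: ifP; nat_lia.
have [->|p2] := eqVneq p i.+2; first by rewrite /= b1 /d; case: ifP; nat_lia.
have [->|p3] := eqVneq p i.+3; first by rewrite /= b2 /d; case: ifP; nat_lia.
rewrite /d; have [i0|i0] := eqVneq i 0.
  have [->|p4] := eqVneq p 4; last by nat_lia.
  by have := rmax; rewrite i0 /= => ->; nat_lia.
have [->|pi] := eqVneq p i; first by rewrite lmax; nat_lia.
by nat_lia.
Qed.

End Blocks.
End GoodBlocks.

(** * Ears, cycles and cut vertices *)

Section Ears.
Variable G : sgraph.
Implicit Types (S T D : {set G}) (x y z u v w : G).

Lemma path_connect_in D x p : path sedge x p -> {subset x :: p <= D} ->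
  connect (in_rel D) x (last x p).
Proof.
elim: p x => [|y p IH] x /=; first by rewrite connect0.
move=> /andP[xy pp] pD; apply: connect_trans (IH y pp _); last first.
  by move=> z zp; apply: pD; rewrite inE zp orbT.
by apply: connect1; rewrite /in_rel /= xy !pD // !inE eqxx ?orbT.
Qed.

(** After deleting [v], each remaining vertex of the ear can walk along it, away from [v], to one of
    the two ends in [S]. *)
Lemma nonsep_ear S u p : nonsep S -> u \in S -> last u p \in S -> u != last u p ->
  path sedge u p -> uniq (u :: p) -> nonsep (S :|: [set z in u :: p]).
Proof.
move=> /nonsepP[_ cS cv] uS wS uw pp up; set T := S :|: _.
have ST : S \subset T by apply: subsetUl.
have to_u z : z \in T -> exists2 s, s \in S & connect (in_rel T) z s.
  rewrite !inE => /orP[zS|]; first by exists z => //; apply: connect0.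
  rewrite -in_cons => zp; exists u => //; rewrite in_rel_connC.
  move: pp; case/splitPl def_p: {1}p / zp => [p1 p2 p1z]; rewrite cat_path => /andP[pp1 _].
  rewrite -p1z; apply: path_connect_in pp1 _ => t tp1.
  by rewrite !inE; apply/orP; right; move: tp1; rewrite -in_cons def_p !inE mem_cat => /orP[->//|->]; rewrite ?orbT.
have to_S v z : z \in T :\ v -> exists2 s, s \in S :\ v & connect (in_rel (T :\ v)) z s.
  rewrite !inE => /andP[zv /orP[zS|]]; first by exists z; rewrite ?connect0 // !inE zv.
  rewrite -in_cons => zp; move: pp up wS.
  case/splitPl def_p: {1 2 3}p / zp => [p1 p2 p1z].
  rewrite cat_path p1z last_cat p1z => /andP[pp1 pp2] up wS.
  have inT t : t \in u :: p1 ++ p2 -> t \in T.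
    by rewrite -def_p => tp; rewrite !inE -in_cons tp orbT.
  have [vl|vl] := boolP (v \in u :: p1).
    exists (last z p2); last first.
      apply: path_connect_in pp2 _ => t tp2; rewrite !in_setD1 inT ?andbT.
        move: up; rewrite -cat_cons cat_uniq => /and3P[_ /hasPn dis _].
        move: tp2; rewrite inE => /orP[/eqP -> //|/dis].
        by apply: contraNneq => ->.
      move: tp2; rewrite inE => /orP[/eqP ->|tp2]; last by rewrite !inE mem_cat tp2 !orbT.
      by rewrite -p1z -cat_cons mem_cat mem_last.
    rewrite in_setD1 wS andbT; have := mem_last z p2; rewrite inE => /orP[/eqP -> //|lp2].
    move: up; rewrite -cat_cons cat_uniq => /and3P[_ /hasPn dis _].
    by have := dis _ lp2; apply: contraNneq => ->.
  exists u; first by rewrite in_setD1 uS andbT; apply: contraNneq vl => <-; rewrite inE eqxx.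
  rewrite in_rel_connC -p1z; apply: path_connect_in pp1 _ => t tp1.
  rewrite !in_setD1 inT ?andbT; first by apply: contraNneq vl => <-.
  by rewrite -cat_cons mem_cat tp1.
apply/nonsepP; split.
- by exists u; apply: (subsetP ST).
- move=> x y /to_u[s sS xs] /to_u[t tS yt]; apply: connect_trans xs _.
  by apply: connect_trans (in_relS ST (cS _ _ sS tS)) _; rewrite in_rel_connC.
- move=> v x y /to_S[s sS xs] /to_S[t tS yt]; apply: connect_trans xs _.
  apply: connect_trans (in_relS (setSD _ ST) (cv _ _ _ sS tS)) _.
  by rewrite in_rel_connC.
Qed.

Lemma nonsep_edge x y : x -- y -> nonsep [set x; y].
Proof.
move=> xy; have conn D : {in D &, forall u v, u \in [set x; y] -> v \in [set x; y] ->
    connect (in_rel D) u v}.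
  move=> u v uD vD; rewrite !inE => /orP[] /eqP uE /orP[] /eqP vE; subst; rewrite ?connect0 //;
    by apply: connect1; rewrite /in_rel /= uD vD // sg_sym.
apply/nonsepP; split; first by exists x; rewrite set21.
- by move=> u v uS vS; apply: conn.
- move=> w u v uS vS; apply: conn => //.
    by move: uS; rewrite in_setD1 => /andP[].
  by move: vS; rewrite in_setD1 => /andP[].
Qed.

(** A cycle is one of its edges with the rest of the cycle as an ear. *)
Lemma block_of_cycle (s : seq G) : ucycle sedge s -> 2 < size s ->
  exists2 T, maxset (@nonsep G) T & {subset s <= T}.
Proof.
case: s => [|x [|y s]] //= /andP[cy us] _.
have ns : nonsep ([set x; y] :|: [set z in y :: rcons s x]).
  move: cy => /= /andP[xy ys]; apply: nonsep_ear; rewrite ?set22 ?last_rcons ?set21 //.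
  - exact: nonsep_edge.
  - by rewrite eq_sym sedge_neq.
  - move: us; rewrite /= mem_rcons rcons_uniq !inE !negb_or eq_sym.
    by move=> /and3P[/andP[-> ->] -> ->].
have [T mT sT] := maxset_exists ns; exists T => // z zs.
apply: (subsetP sT); rewrite !inE mem_rcons inE; move: zs; rewrite !inE.
by case/or3P => ->; rewrite ?orbT.
Qed.

Lemma block_of_edge x y : x -- y -> exists T, [/\ maxset (@nonsep G) T, x \in T & y \in T].
Proof.
move=> /nonsep_edge/maxset_exists[T mT /subsetP sT]; exists T.
by split=> //; apply: sT; rewrite ?set21 ?set22.
Qed.

Lemma maxset_ear T u p : maxset (@nonsep G) T -> u \in T -> last u p \in T -> u != last u p ->
  path sedge u p -> uniq (u :: p) -> {subset p <= T}.
Proof.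
move=> /maxsetP[nT mT] uT lT ne pp up z zp.
rewrite -(mT _ (nonsep_ear nT uT lT ne pp up) (subsetUl _ _)) !inE zp.
by rewrite !orbT.
Qed.

Lemma maxset_two_nbrs T u v w : maxset (@nonsep G) T -> u \in T -> v \in T -> u != v ->
  u -- w -> v -- w -> w \in T.
Proof.
move=> mT uT vT uv uw vw.
have sub : {subset [:: w; v] <= T}.
  apply: (maxset_ear mT uT); rewrite //= ?uw ?[w -- v]sg_sym ?vw //.
  by rewrite !inE negb_or uv (sedge_neq uw) eq_sym sedge_neq.
by apply: sub; rewrite inE eqxx.
Qed.

Hypothesis G_conn : forall x y, connect sedge x y.

(** A path from [w] back into [T] avoiding [v] would, preceded by [v], be an ear of [T] and put [w]
    into [T]. *)
Lemma maxset_cut T v w : maxset (@nonsep G) T -> v \in T -> v -- w -> w \notin T -> cut_vertex v.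
Proof.
move=> mT vT vw wT.
have [t tT tv] : exists2 t, t \in T & t != v.
  have [/existsP[t /andP[? ?]]|/existsPn no] := boolP [exists t, (t \in T) && (t != v)].
    by exists t.
  have Tv : T \subset [set v; w].
    apply/subsetP => t tT; have := no t; rewrite tT /= negbK => /eqP ->.
    by rewrite set21.
  have /maxsetP[_ /(_ _ (nonsep_edge vw) Tv) E] := mT.
  by rewrite -E set22 in wT.
apply/cut_vertexP; exists w, t; split=> //; first by rewrite eq_sym sedge_neq.
apply: contra wT => /connectP[p pp tE]; case/shortenP: pp tE => q pq uq _ tE.
have qD : {subset q <= [set~ v]}.
  move=> z; elim: q w pq {tE uq vw} => //= a q IH w' /andP[/and3P[_ aD _] pq].
  by rewrite inE => /orP[/eqP -> // | /(IH a pq)].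
have vq : v \notin q by apply/negP => /qD; rewrite !inE eqxx.
have sub : {subset w :: q <= T}.
  apply: (maxset_ear mT vT); rewrite /= -?tE //.
  - by rewrite eq_sym.
  - by rewrite vw; apply: sub_path pq => a c /and3P[].
  - by rewrite inE negb_or (sedge_neq vw) vq.
by apply: sub; rewrite inE eqxx.
Qed.

(** If all neighbours of [v] lay in [T], each passage through [v] could be rerouted in [T :\ v],
    which is connected. *)
Lemma cut_nbr_outside T v : nonsep T -> v \in T -> cut_vertex v ->
  exists2 w, v -- w & w \notin T.
Proof.
move=> /nonsepP[_ _ cv] vT.
have [/existsP[w /andP[vw wT]] _|/existsPn no] := boolP [exists w, (v -- w) && (w \notin T)].
  by exists w.
move=> /cut_vertexP[x [y [xv yv cxy ncxy]]]; exfalso; move/negP: ncxy; apply.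
have nT z : v -- z -> z \in T :\ v.
  move=> vz; have := no z; rewrite vz /= negbK in_setD1 => ->.
  by rewrite eq_sym sedge_neq.
have sub : T :\ v \subset [set~ v] by apply/subsetP => z; rewrite !inE => /andP[].
(* While the path stands at [v], the invariant keeps some neighbour of [v] reached without [v]. *)
have inv z : connect sedge x z ->
    if z == v then exists2 u, v -- u & connect (in_rel [set~ v]) x u
    else is_true (connect (in_rel [set~ v]) x z).
  move=> /connectP[p]; elim/last_ind: p z => [|p t IH] z /=.
    by move=> _ ->; rewrite (negbTE xv) connect0.
  rewrite rcons_path last_rcons => /andP[pp lt] ->; have := IH _ pp erefl.
  have [lv|lv] := eqVneq (last x p) v.
    rewrite lv in lt => -[u vu xu]; rewrite eq_sym (negbTE (sedge_neq lt)).
    exact: connect_trans xu (in_relS sub (cv _ _ _ (nT _ vu) (nT _ lt))).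
  move=> xl; have [tv|tv] := eqVneq t v; first by exists (last x p); rewrite // -tv sg_sym.
  by apply: connect_trans xl (connect1 _); rewrite /in_rel /= !inE lv tv lt.
by have := inv y cxy; rewrite (negbTE yv).
Qed.

End Ears.

(** * Graphs whose Gallai graph is a tree *)

Lemma path_iota (r : rel nat) i k : (forall j, i <= j < i + k -> r j j.+1) ->
  path r i (iota i.+1 k).
Proof.
elim: k i => //= k IH i rj; rewrite rj ?IH //; first by move=> j ij; apply: rj; lia.
by lia.
Qed.

Definition symr (r : rel nat) i j := if i < j then r i j else r j i.

Section GallaiTree.
Variable G : sgraph.

Lemma copy_symr m r (e : nat -> G) i j : copy m r e -> i < m -> j < m -> i != j ->
  (e i -- e j) = symr r i j.
Proof.
move=> ce im jm ij; rewrite /symr; case: ltnP => ij'.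
  by apply: (copy_edge ce); lia.
by rewrite sg_sym; apply: (copy_edge ce); lia.
Qed.

Definition gallai_set_rel (A B : {set G}) : bool :=
  [exists u : G, exists v : G, exists w : G,
     [&& u != w, A == [set u; v], B == [set v; w] & ~~ (u -- w)]].

Lemma gallai_set_relI u v w : u != w -> ~~ (u -- w) ->
  gallai_set_rel [set u; v] [set v; w].
Proof.
move=> uw nuw; apply/existsP; exists u; apply/existsP; exists v; apply/existsP; exists w.
by rewrite uw nuw !eqxx.
Qed.

Lemma gallai_cycle (s : seq {set G}) : {subset s <= edges G} -> uniq s ->
  cycle gallai_set_rel s -> 2 < size s -> ~ acyclic (gallai G).
Proof.
move=> s_edges us cs s2 acyc.
have [t tE] : exists t : seq (gallai G), s = map val t.
  elim: s s_edges {us cs s2} => [|A s IH] sE; first by exists [::].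
  have [|t ->] := IH; first by move=> B Bs; apply: sE; rewrite inE Bs orbT.
  by exists (Sub A (sE A (mem_head _ _)) :: t).
have : size t < 3.
  apply: acyc; apply/andP; split; last by move: us; rewrite tE map_inj_uniq //; apply: val_inj.
  by move: cs; rewrite tE; case: (t) => //= A t'; rewrite -map_rcons path_map.
by rewrite ltnS => t2; move: s2; rewrite tE size_map ltnNge t2.
Qed.

Definition pair_adj (r : rel nat) (p q : nat * nat) : bool :=
  let far x y := (x != y) && ~~ symr r x y in
  [|| (p.1 == q.1) && far p.2 q.2, (p.1 == q.2) && far p.2 q.1,
      (p.2 == q.1) && far p.1 q.2 | (p.2 == q.2) && far p.1 q.1].

Lemma copy_gallai_cycle m r (e : nat -> G) (l : seq (nat * nat)) : copy m r e ->
  all (fun p => (p.1 < p.2 < m) && r p.1 p.2) l -> uniq l -> cycle (pair_adj r) l ->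
  2 < size l -> ~ acyclic (gallai G).
Proof.
move=> ce /allP lE ul cl l2.
pose h (p : nat * nat) : {set G} := [set e p.1; e p.2].
apply: (@gallai_cycle (map h l)); last by rewrite size_map.
- move=> _ /mapP[p /lE /andP[pm rp] ->].
  by rewrite mem_edges (copy_edge ce).
- rewrite map_inj_in_uniq // => -[a b] [c d] /lE /andP[/= abm _] /lE /andP[/= cdm _] E.
  have [|[/= ac bd]|[/= ad bc]] := set2_eq E.
  + by have [] := ce a b abm.
  + have -> : a = c by apply: (copy_inj ce) ac; lia.
    by have -> : b = d by apply: (copy_inj ce) bd; lia.
  + have : a = d by apply: (copy_inj ce) ad; lia.
    have : b = c by apply: (copy_inj ce) bc; lia.
    lia.
have far x y (v : G) : x < m -> y < m -> (x != y) && ~~ symr r x y ->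
    gallai_set_rel [set e x; v] [set v; e y].
  move=> xm ym /andP[xy nr]; apply: gallai_set_relI.
    by apply: contra_neq xy => /(copy_inj ce xm ym).
  by rewrite (copy_symr ce).
have adjP p q : p \in l -> q \in l -> pair_adj r p q -> gallai_set_rel (h p) (h q).
  move=> /lE /andP[pm _] /lE /andP[qm _]; rewrite /h.
  case/andP: pm => pl p2; have p1 := ltn_trans pl p2.
  case/andP: qm => ql q2; have q1 := ltn_trans ql q2.
  case/or4P => /andP[/eqP E fr].
  - by rewrite E setUC; apply: far.
  - by rewrite E setUC [X in gallai_set_rel _ X]setUC; apply: far.
  - by rewrite E; apply: far.
  - by rewrite E [X in gallai_set_rel _ X]setUC; apply: far.
case: l cl adjP {lE ul l2} => //= p l; rewrite -map_rcons path_map => + adjP.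
have sub : {in [in p :: l] &, subrel (pair_adj r) (relpre h gallai_set_rel)}.
  by move=> a b al bl; apply: adjP.
apply: (sub_in_path sub).
by apply/allP => x; rewrite inE mem_rcons inE orbA orbb.
Qed.

(** Consecutive edges of an induced cycle of length at least 4 span no triangle, so its edges form a
    cycle of the Gallai graph. *)
Lemma cycle_gallai_cycle n (e : nat -> G) : 4 <= n -> copy n (cyc n) e -> ~ acyclic (gallai G).
Proof.
case: n => // n n4 ce.
pose h i : {set G} := [set e (i %% n.+1); e (i.+1 %% n.+1)].
have modE i : i < n.+1 -> i %% n.+1 = i by move=> ?; rewrite modn_small.
have modS i : i <= n -> i.+1 %% n.+1 = if i == n then 0 else i.+1.
  by move=> im; case: eqVneq => [->|ne]; rewrite ?modnn // modn_small //; lia.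
have mod2 i : i <= n -> i.+2 %% n.+1 = if i == n then 1 else if i.+1 == n then 0 else i.+2.
  move=> im; case: eqVneq => [->|ne].
    by rewrite -addn2 -addSnnS modnDl modn_small //; lia.
  by case: eqVneq => [->|ne']; rewrite ?modnn // modn_small //; lia.
apply: (@gallai_cycle (mkseq h n.+1)); last by rewrite size_mkseq; lia.
- move=> A /mapP[i]; rewrite mem_iota add0n => im ->.
  rewrite mem_edges modE // modS; last lia.
  rewrite (copy_symr ce) /symr /cyc; last by case: ifP; lia.
  + by case: ifP; case: ifP; lia.
  + lia.
  + by case: ifP; lia.
- rewrite map_inj_in_uniq ?iota_uniq // => i j; rewrite !mem_iota !add0n => im jm.
  rewrite /h (modE i) // (modE j) // (modS i) // (modS j) //.
  move=> /set2_eq [|[/(copy_inj ce) ->//] _|[/(copy_inj ce) E1 /(copy_inj ce) E2]].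
  + apply/eqP => /(copy_inj ce); case: ifP; lia.
  + by move: E1 E2; case: ifP; case: ifP; lia.
- have h0 : h 0 = h n.+1 by rewrite /h modnn mod0n -[n.+2]addn1 -modnDml modnn add0n.
  rewrite /mkseq /= [X in rcons _ X]h0.
  rewrite -map_rcons path_map -cats1 -(iotaD 1 n 1) addn1; apply: path_iota => j jn /=.
  rewrite /h; have [xm ym] : j %% n.+1 < n.+1 /\ j.+2 %% n.+1 < n.+1 by rewrite !ltn_mod.
  have ne : j %% n.+1 != j.+2 %% n.+1.
    by rewrite modE ?mod2; try lia; case: ifP; [|case: ifP]; lia.
  apply: gallai_set_relI; first by apply: contra_neq ne => /(copy_inj ce xm ym).
  rewrite (copy_symr ce) // (modE j) ?(mod2 j) //; try lia.
  rewrite /symr /cyc.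
  by repeat case: ifP => ?; lia.
Qed.

(** An edge uv inside [U] has all its Gallai neighbours inside [U]: a vertex outside [U] adjacent to
    v is also adjacent to u. Connectedness would confine every edge to [U], yet some edge meets the
    complement. *)
Lemma gallai_homogeneous (U : {set G}) : no_isolated_vertex G -> connected (gallai G) ->
  nontrivial U -> homogeneous U -> independent U.
Proof.
move=> noiso /andP[_ /forallP conn] ntU hU x y xU yU; apply/negP => xy.
have [z zU] : exists z, z \notin U.
  apply/existsP; rewrite -negb_forall; apply: contra ntU => /forallP UT.
  have -> : U = setT by apply/setP => t; rewrite UT inE.
  by rewrite cardsT !inE eqxx !orbT.
have [t zt] := noiso z.
have xyE : [set x; y] \in edges G by rewrite mem_edges.
have ztE : [set z; t] \in edges G by rewrite mem_edges.
have /forallP/(_ (Sub [set z; t] ztE))/connectP[p] := conn (Sub [set x; y] xyE).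
suff inU (A : gallai G) q : val A \subset U -> path sedge A q ->
    val (last A q) \subset U.
  have xyU : val (Sub [set x; y] xyE : gallai G) \subset U.
    by apply/subsetP => s; rewrite !inE => /orP[] /eqP ->.
  move=> /(inU _ _ xyU) + E; rewrite -E => /subsetP/(_ z).
  by rewrite set21 (negbTE zU) => /(_ isT).
elim: q A => //= B q IH A AU /andP[AB]; apply: IH.
move: AB => /existsP[u /existsP[v /existsP[w /and4P[uw /eqP AE /eqP BE nuw]]]].
rewrite BE; have [uU vU] : u \in U /\ v \in U.
  by move: AU; rewrite AE => /subsetP H; split; apply: H; rewrite ?set21 ?set22.
apply/subsetP => s; rewrite !inE => /orP[] /eqP -> //; apply: contraT => wU.
have vw : v -- w by rewrite -mem_edges -BE; apply: valP.
have [/(_ u uU)|/(_ v vU)] := hU w wU; first by rewrite sg_sym (negbTE nuw).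
by rewrite sg_sym vw.
Qed.

Lemma gallai_F_free m r : acyclic (gallai G) -> List.In (m, r) F_patterns ->
  forall e : nat -> G, ~ copy m r e.
Proof.
move=> acyc mr e ce.
suff [l [H1 H2 H3 H4]] : exists l : seq (nat * nat),
    [/\ all (fun p => (p.1 < p.2 < m) && r p.1 p.2) l, uniq l, cycle (pair_adj r) l & 2 < size l].
  exact: (copy_gallai_cycle ce H1 H2 H3 H4 acyc).
move: mr {ce}.
case=> [E|[E|[E|[E|[E|[E|[E|[E|[E|[]]]]]]]]]]; case: E => <- <-.
(* For each F_i, a cycle of its Gallai graph, with vertices counted from 0. *)
- by exists [:: (0, 3); (1, 3); (2, 3)].
- by exists [:: (0, 4); (2, 4); (1, 4); (3, 4)].
- by exists [:: (0, 1); (1, 2); (2, 3); (2, 5); (0, 5); (4, 5); (3, 4); (1, 4)].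
- by exists [:: (0, 1); (1, 2); (2, 3); (2, 4); (4, 5); (1, 4)].
- by exists [:: (0, 1); (1, 2); (1, 3); (3, 5); (0, 3); (3, 4); (2, 4); (4, 5); (1, 4)].
- by exists [:: (0, 1); (1, 2); (2, 3); (3, 4); (3, 5); (1, 5)].
- by exists [:: (0, 1); (1, 2); (2, 3); (3, 4); (4, 5); (4, 6); (1, 6)].
- by exists [:: (0, 1); (1, 2); (2, 3); (2, 5); (4, 5); (5, 6); (1, 5)].
- by exists [:: (0, 1); (1, 2); (2, 5); (2, 6); (3, 6); (0, 3); (3, 4); (4, 5); (1, 4)].
Qed.

Lemma gallai_chordal : acyclic (gallai G) -> chordal G.
Proof.
move=> acyc n n4 /(contains_copy (r := cyc n)) [|i j ij|e ce]; first lia.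
  by apply: symm_cyc => //; lia.
exact: (cycle_gallai_cycle n4 ce acyc).
Qed.

End GallaiTree.

(** * From blocks to forbidden subgraphs *)

Section BlockGraph.
Variable G : sgraph.
Hypothesis G_conn : forall x y : G, connect sedge x y.
Hypothesis block_iso : forall B : subgraph G, block B ->
  isomorphic (graph_of B) (complete_graph 2) \/
  isomorphic (graph_of B) (complete_graph 3) \/
  isomorphic (graph_of B) gem.
Hypothesis block_cut : forall v : G, cut_vertex v -> #|blocks_at v| <= 2 /\ degree v <= 3.
Hypothesis block_K3 : forall B : subgraph G, block B ->
  isomorphic (graph_of B) (complete_graph 3) -> #|cut_vertices_in B| = 2.
Hypothesis block_gem : forall B : subgraph G, block B ->
  isomorphic (graph_of B) gem -> #|cut_vertices_in B| = 1.

Implicit Types (T : {set G}) (x y z v w : G).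

Definition cuts T : {set G} := [set v in T | cut_vertex v].

Lemma block_shape T : maxset (@nonsep G) T ->
  [\/ #|T| = 2,
      [/\ #|T| = 3, {in T &, forall x y, x != y -> x -- y} & #|cuts T| = 2] |
      exists2 e, copy 5 (band predT) e & T = copy_set 5 e /\ #|cuts T| = 1].
Proof.
move=> mT; have bl := maxset_block mT.
have [isoB|[isoB|isoB]] := block_iso bl; have := isoB => /iso_fullsub iso.
- by constructor 1; apply: iso_card iso.
- constructor 2; split; [exact: iso_card iso | | exact: block_K3 bl isoB].
  have [|e ce ->] := iso_copy (m := 3) (r := fun _ _ => true) isT iso.
    by move=> i j ij; rewrite /symm_rel /= neq_ltn ij.
  move=> x y /copy_setP[i i3 ->] /copy_setP[j j3 ->] ij.
  rewrite (copy_symr ce) // /symr; first by case: ifP.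
  by apply: contra_neq ij => ->.
- constructor 3; have [|e ce TE] := iso_copy (m := 5)
      (r := prel [:: (1,2); (2,3); (3,4); (1,5); (2,5); (3,5); (4,5)]) isT iso.
    by move=> i j ij; apply: symm_prel.
  (* The gem read as [P_5^2]: its path backwards with the hub inserted in the middle. *)
  pose p a := nth 0 [:: 3; 2; 4; 1; 0] a.
  exists (fun a => e (p a)).
    apply: (copy_relabel (p := p) ce); first by case=> [|[|[|[|[|]]]]].
    by move=> [|[|[|[|[|?]]]]] [|[|[|[|[|?]]]]] //=; rewrite ?andbF.
  split; last exact: block_gem bl isoB.
  rewrite TE; apply/setP => x; apply/copy_setP/copy_setP => -[a a5 ->].
    by case: a a5 => [|[|[|[|[|]]]]] // _; [exists 4 | exists 3 | exists 1 | exists 0 | exists 2].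
  by exists (p a) => //; case: a a5 => [|[|[|[|[|]]]]].
Qed.

Lemma block_le5 T : maxset (@nonsep G) T -> #|T| <= 5.
Proof.
by move=> /block_shape[->|[-> _ _]|[e ce [-> _]]] //; rewrite (card_copy_set ce).
Qed.

Lemma block_gem_shape T : maxset (@nonsep G) T -> 3 < #|T| ->
  exists2 e, copy 5 (band predT) e & T = copy_set 5 e /\ #|cuts T| = 1.
Proof. by move=> /block_shape[->|[-> _ _]|]. Qed.

(** Four vertices in one block force a gem, so the search inside [P_5^2] must succeed. A failing
    computation, or a second cut vertex, then gives a contradiction. *)
Lemma block_sub_has_copy T m r (e' : nat -> G) (l : seq nat) : maxset (@nonsep G) T ->
  copy m r e' -> all (gtn m) l -> uniq l -> {in l, forall i, e' i \in T} -> 3 < size l ->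
  has_copy (sq_list 5) (fun i j => symr r (nth 0 l i) (nth 0 l j)) (size l) /\ #|cuts T| = 1.
Proof.
move=> mT ce' /allP lm ul lT l3.
have cl : copy (size l) (fun i j => symr r (nth 0 l i) (nth 0 l j)) (fun i => e' (nth 0 l i)).
  move=> i j ij; have [il jl] : i < size l /\ j < size l by nat_lia.
  have im := lm _ (mem_nth 0 il); have jm := lm _ (mem_nth 0 jl).
  have ne : nth 0 l i != nth 0 l j by rewrite nth_uniq //; nat_lia.
  rewrite (copy_symr ce') //; split=> //.
  by apply: contra_neq ne => /(copy_inj ce' im jm).
have T4 : 3 < #|T|.
  apply: leq_trans l3 _; rewrite -(card_copy_set cl); apply/subset_leq_card/subsetP => x.
  by move=> /copy_setP[i il ->]; apply: lT; apply: mem_nth.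
have [e ce [TE c1]] := block_gem_shape mT T4; split=> //.
apply: (has_copy_complete (copy_list ce) cl) => i il; rewrite size_graph_list.
by apply/copy_setP; rewrite -TE; apply: lT; apply: mem_nth.
Qed.

Lemma block_of_copy_cycle m r (e : nat -> G) (l : seq nat) : copy m r e ->
  all (gtn m) l -> uniq l -> cycle (fun i j => (i != j) && symr r i j) l -> 2 < size l ->
  exists2 T, maxset (@nonsep G) T & {in l, forall i, e i \in T}.
Proof.
move=> ce /allP lm ul cl l2.
have [||T mT sT] := @block_of_cycle G (map e l); rewrite ?size_map //; last first.
  by exists T => // i il; apply: sT; apply: map_f.
apply/andP; split; last first.
  by rewrite map_inj_in_uniq // => i j /lm im /lm jm; apply: (copy_inj ce).
case: l cl lm {ul l2} => //= i l; rewrite -map_rcons path_map => + lm.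
have sub : {in [in i :: l] &, subrel (fun i j => (i != j) && symr r i j) (relpre e sedge)}.
  by move=> a b /lm am /lm bm /andP[ab rab]; rewrite /= (copy_symr ce).
apply: (sub_in_path sub).
by apply/allP => x; rewrite inE mem_rcons inE orbA orbb.
Qed.

Lemma cuts_copy1 T v w v' w' : maxset (@nonsep G) T -> #|cuts T| = 1 ->
  v \in T -> v -- w -> w \notin T -> v' \in T -> v' -- w' -> w' \notin T -> v = v'.
Proof.
move=> mT /eqP/cards1P[c cE] vT vw wT vT' vw' wT'.
have : v \in cuts T by rewrite inE vT (maxset_cut G_conn mT vT vw wT).
have : v' \in cuts T by rewrite inE vT' (maxset_cut G_conn mT vT' vw' wT').
by rewrite cE !inE => /eqP -> /eqP ->.
Qed.

Lemma not_cut_nbr T v w : maxset (@nonsep G) T -> v \in T -> ~~ cut_vertex v ->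
  v -- w -> w \in T.
Proof. by move=> mT vT nc vw; apply: contraR nc => /(maxset_cut G_conn mT vT vw). Qed.

Lemma degree4_not_cut v : 3 < degree v -> ~~ cut_vertex v.
Proof. by move=> d4; apply/negP => /block_cut[_]; rewrite leqNgt d4. Qed.

Lemma block_triangle_at T v : maxset (@nonsep G) T -> v \in T -> 2 < #|T| ->
  exists a b, [/\ v -- a, v -- b & a -- b].
Proof.
move=> mT vT T2; have [E|[T3 cliq _]|[e ce [TE _]]] := block_shape mT; first by rewrite E in T2.
  have /card_gt1P[a [b [aT bT ab]]] : 1 < #|T :\ v|.
    by have := cardsD1 v T; rewrite vT T3; nat_lia.
  move: aT bT; rewrite !in_setD1 => /andP[av aT] /andP[bv bT].
  by exists a, b; split; apply: cliq => //; rewrite eq_sym.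
have E i j : i < 5 -> j < 5 -> i != j -> e i -- e j = symr (band predT) i j.
  exact: copy_symr.
move: vT; rewrite TE => /copy_setP[[|[|[|[|[|//]]]]] _ ->].
- by exists (e 1), (e 2); rewrite !E.
- by exists (e 0), (e 2); rewrite !E.
- by exists (e 0), (e 1); rewrite !E.
- by exists (e 1), (e 2); rewrite !E.
- by exists (e 2), (e 3); rewrite !E.
Qed.

(** If the centre is no cut vertex, the claw lies in a gem, which has none. Otherwise the centre has
    degree 3 and lies in no triangle, so its three edges are three blocks. *)
Lemma block_claw_free (e : nat -> G) : ~ copy 4 (prel [:: (1,4); (2,4); (3,4)]) e.
Proof.
move=> ce.
have E i j : i < 4 -> j < 4 -> i != j ->
    e i -- e j = symr (prel [:: (1,4); (2,4); (3,4)]) i j by apply: copy_symr.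
have inj i j : i < 4 -> j < 4 -> e i = e j -> i = j by apply: (copy_inj ce).
have [T [mT cT lT]] := block_of_edge (E 3 0 isT isT isT : e 3 -- e 0).
have [cc|nc] := boolP (cut_vertex (e 3)); last first.
  have [||||hc _] := @block_sub_has_copy T 4 _ e (iota 0 4) mT ce; try by [].
    move=> i; rewrite mem_iota add0n => i4; have [->//|i3] := eqVneq i 3.
    apply: (not_cut_nbr mT cT nc); rewrite E //; last by rewrite eq_sym.
    by case: i i4 i3 => [|[|[|[]]]].
have [bl2 deg3] := block_cut cc.
have nbrs : [set y | e 3 -- y] = copy_set 3 e.
  apply/eqP; rewrite eq_sym eqEcard (card_copy_set (copy_widen _ ce)) // deg3 andbT.
  apply/subsetP => x /copy_setP[i i3 ->]; rewrite inE E //; [|nat_lia|nat_lia].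
  by case: i i3 => [|[|[]]].
have small T' : maxset (@nonsep G) T' -> e 3 \in T' -> #|T'| <= 2.
  move=> mT' cT'; rewrite leqNgt; apply/negP => /(block_triangle_at mT' cT').
  move=> [a [b [ca cb]]]; have : a \in copy_set 3 e by rewrite -nbrs inE.
  have : b \in copy_set 3 e by rewrite -nbrs inE.
  move=> /copy_setP[i i3 ->] /copy_setP[j j3 ->].
  have [->|ij] := eqVneq j i; first by rewrite sg_irrefl.
  rewrite E //; try nat_lia.
  by case: i i3 ij => [|[|[]]] //; case: j j3 => [|[|[]]].
have two i : i < 3 -> fullsub [set e 3; e i] \in blocks_at (e 3).
  move=> i3; have ci : e 3 -- e i.
    by rewrite E //; [case: i i3 => [|[|[]]] | nat_lia | nat_lia].
  have [T' [mT' cT' iT']] := block_of_edge ci.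
  have TE : [set e 3; e i] = T'.
    apply/eqP; rewrite eqEcard cards2 (sedge_neq ci) small // andbT.
    by apply/subsetP => x; rewrite !inE => /orP[] /eqP ->.
  by rewrite inE TE maxset_block.
have : #|[set fullsub [set e 3; e (val i)] | i : 'I_3]| <= 2.
  apply: leq_trans bl2; apply/subset_leq_card/subsetP => B /imsetP[i _ ->].
  exact: two (ltn_ord i).
rewrite card_imset ?card_ord // => i j /(congr1 (@sub_vertices G)) Eij; apply: val_inj.
have : e i \in [set e 3; e j] by rewrite -[_ \in _]/(e i \in sub_vertices (fullsub [set e 3; e (val j)])) -Eij set22.
have [i3 j3] := (ltn_ord i, ltn_ord j).
rewrite !inE => /orP[] /eqP E'; last exact: (inj _ _ (ltnW i3) (ltnW j3) E').
by have H := inj _ 3 (ltnW i3) isT E'; rewrite H in i3.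
Qed.

(** The centre has degree at least 4, hence is no cut vertex, and the butterfly would lie in one
    gem. *)
Lemma block_butterfly_free (e : nat -> G) :
  ~ copy 5 (prel [:: (1,2); (1,5); (2,5); (3,4); (3,5); (4,5)]) e.
Proof.
move=> ce; have E i j : i < 5 -> j < 5 -> i != j ->
    e i -- e j = symr (prel [:: (1,2); (1,5); (2,5); (3,4); (3,5); (4,5)]) i j.
  exact: copy_symr.
have ci i : i < 4 -> e 4 -- e i.
  by move=> i4; rewrite E //; [case: i i4 => [|[|[|[]]]] | nat_lia | nat_lia].
have nc : ~~ cut_vertex (e 4).
  apply: degree4_not_cut; apply: leq_trans (_ : #|copy_set 4 e| <= _).
    by rewrite (card_copy_set (copy_widen _ ce)).
  by apply/subset_leq_card/subsetP => x /copy_setP[i i4 ->]; rewrite inE ci.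
have [T [mT cT _]] := block_of_edge (ci 0 isT).
have [||||hc _] := @block_sub_has_copy T 5 _ e (iota 0 5) mT ce; try by [].
  move=> i; rewrite mem_iota add0n => i5; have [->//|i4] := eqVneq i 4.
  by apply: (not_cut_nbr mT cT nc); apply: ci; lia.
Qed.

Lemma block_cycle_le5 m r (e : nat -> G) (l : seq nat) : copy m r e ->
  all (gtn m) l -> uniq l -> cycle (fun i j => (i != j) && symr r i j) l -> 2 < size l ->
  size l <= 5.
Proof.
move=> ce lm ul cl l2; have [T mT lT] := block_of_copy_cycle ce lm ul cl l2.
apply: leq_trans (block_le5 mT); rewrite -(size_map e) -(card_uniqP _).
  by apply/subset_leq_card/subsetP => x /mapP[i il ->]; apply: lT.
by rewrite map_inj_in_uniq // => i j /(allP lm) im /(allP lm) jm; apply: (copy_inj ce).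
Qed.

(** Consider the block of the triangle. If it is [K_3], all three vertices are cut vertices, one too
    many. If it is a gem, its single cut vertex forces two pendant vertices into it, but a gem
    contains no triangle with two pendants. *)
Lemma block_net_free (e : nat -> G) :
  ~ copy 6 (prel [:: (1,2); (2,3); (3,4); (2,5); (3,5); (5,6)]) e.
Proof.
move=> ce; set r := prel _ in ce; have E i j : i < 6 -> j < 6 -> i != j -> e i -- e j = symr r i j.
  exact: copy_symr.
have ne i j : i < 6 -> j < 6 -> i != j -> e i != e j.
  by move=> i6 j6; apply: contra_neq => /(copy_inj ce i6 j6).
have [T mT lT] := @block_of_copy_cycle _ _ _ [:: 1; 2; 4] ce isT isT isT isT.
have [T1 T2 T4] : [/\ e 1 \in T, e 2 \in T & e 4 \in T] by split; apply: lT.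
have no l : all (gtn 6) l -> uniq l -> 3 < size l -> {in l, forall i, e i \in T} ->
    has_copy (sq_list 5) (fun i j => symr r (nth 0 l i) (nth 0 l j)) (size l).
  by move=> lm ul l3 lT'; have [] := block_sub_has_copy mT ce lm ul lT' l3.
have inT l : all (fun i => e i \in T) l -> {in l, forall i, e i \in T} by move=> /allP.
have cut i j : i < 6 -> j < 6 -> i != j -> symr r i j -> e i \in T -> e j \notin T -> e i \in cuts T.
  by move=> i6 j6 ij rij iT jT; rewrite inE iT (maxset_cut G_conn mT iT _ jT) ?E.
have [E2|[T3 _ c2]|[e' _ [_ c1]]] := block_shape mT.
- have : #|[set e 1; e 2; e 4]| <= #|T|.
    by apply/subset_leq_card/subsetP => x; rewrite !inE => /orP[/orP[]|] /eqP ->.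
  by rewrite E2 -setUA cardsU1 !inE negb_or !ne // cards2 ne.
- have TE : T = [set e 1; e 2; e 4].
    apply/esym/eqP; rewrite eqEcard T3 -setUA cardsU1 !inE negb_or !ne // cards2 ne //= andbT.
    by apply/subsetP => x; rewrite !inE => /or3P[] /eqP ->.
  have out i : i < 6 -> i \notin [:: 1; 2; 4] -> e i \notin T.
    by move=> i6; rewrite TE !inE !negb_or => /and3P[? ? ?]; rewrite !ne.
  have : #|T| <= #|cuts T|.
    apply/subset_leq_card/subsetP => x; rewrite {1}TE !inE => /orP[/orP[]|] /eqP ->.
    + by have := @cut 1 0; rewrite inE; apply=> //; apply: out.
    + by have := @cut 2 3; rewrite inE; apply=> //; apply: out.
    + by have := @cut 4 5; rewrite inE; apply=> //; apply: out.
  by rewrite T3 c2.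
have [c cE] := cards1P (introT eqP c1).
have same i j : i < 6 -> j < 6 -> e i \in cuts T -> e j \in cuts T -> i = j.
  by rewrite cE !inE => i6 j6 /eqP <- /eqP /esym /(copy_inj ce); apply.
have [p0|p0] := boolP (e 0 \in T).
  have [p3|p3] := boolP (e 3 \in T).
    have := @no [:: 1; 2; 4; 0; 3] isT isT isT (inT _ _); rewrite /= T1 T2 T4 p0 p3.
    by move=> /(_ isT) hc; vm_compute in hc.
  have [p5|p5] := boolP (e 5 \in T).
    have := @no [:: 1; 2; 4; 0; 5] isT isT isT (inT _ _); rewrite /= T1 T2 T4 p0 p5.
    by move=> /(_ isT) hc; vm_compute in hc.
  have := @same 2 4 isT isT (@cut 2 3 isT isT isT isT T2 p3) (@cut 4 5 isT isT isT isT T4 p5).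
  by [].
have [p3|p3] := boolP (e 3 \in T); last first.
  have := @same 1 2 isT isT (@cut 1 0 isT isT isT isT T1 p0) (@cut 2 3 isT isT isT isT T2 p3).
  by [].
have [p5|p5] := boolP (e 5 \in T); last first.
  have := @same 1 4 isT isT (@cut 1 0 isT isT isT isT T1 p0) (@cut 4 5 isT isT isT isT T4 p5).
  by [].
have := @no [:: 1; 2; 4; 3; 5] isT isT isT (inT _ _); rewrite /= T1 T2 T4 p3 p5.
by move=> /(_ isT) hc; vm_compute in hc.
Qed.

(* The block of the cycle [l] is a gem; if neither pendant vertex [x] nor [y] were in
   it, then [a] and [b] would be two cut vertices of this gem. *)
Lemma block_two_pendants m r (e : nat -> G) l (a x b y : nat) : copy m r e ->
  all (gtn m) l -> uniq l -> cycle (fun i j => (i != j) && symr r i j) l -> 3 < size l ->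
  [&& a \in l, b \in l, x < m, y < m, a != b, a != x, b != y, symr r a x & symr r b y] ->
  uniq (rcons l x) -> uniq (rcons l y) ->
  has_copy (sq_list 5) (fun i j => symr r (nth 0 (rcons l x) i) (nth 0 (rcons l x) j)) (size l).+1 ||
  has_copy (sq_list 5) (fun i j => symr r (nth 0 (rcons l y) i) (nth 0 (rcons l y) j)) (size l).+1.
Proof.
move=> ce lm ul cl l3 /and5P[al bl xm ym /and5P[ab ax by_ rax rby]] ux uy.
have [T mT lT] := block_of_copy_cycle ce lm ul cl (ltnW l3).
have [_ c1] := block_sub_has_copy mT ce lm ul lT l3.
have use t : t < m -> uniq (rcons l t) -> e t \in T ->
    has_copy (sq_list 5) (fun i j => symr r (nth 0 (rcons l t) i) (nth 0 (rcons l t) j)) (size l).+1.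
  move=> tm ut tT; rewrite -(size_rcons l t).
  have lm' : all (gtn m) (rcons l t) by rewrite all_rcons /= tm.
  have lT' : {in rcons l t, forall i, e i \in T}.
    by move=> i; rewrite mem_rcons inE => /orP[/eqP -> //|/lT].
  have l3' : 3 < size (rcons l t) by rewrite size_rcons ltnW.
  by have [] := block_sub_has_copy mT ce lm' ut lT' l3'.
have [xT|xT] := boolP (e x \in T); first by rewrite use.
have [yT|yT] := boolP (e y \in T); first by rewrite [X in _ || X]use // orbT.
have am := allP lm _ al; have bm := allP lm _ bl.
have : e a = e b.
  apply: (cuts_copy1 mT c1 (lT _ al) (w := e x) _ xT (lT _ bl) (w' := e y) _ yT).
    by rewrite (copy_symr ce).
  by rewrite (copy_symr ce).
by move=> /(copy_inj ce am bm) E; rewrite E eqxx in ab.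
Qed.

Lemma block_F_free m r : List.In (m, r) F_patterns -> forall e : nat -> G, ~ copy m r e.
Proof.
case=> [E|[E|[E|[E|[E|[E|[E|[E|[E|[]]]]]]]]]]; case: E => <- <- e ce.
- exact: block_claw_free ce.
- exact: block_butterfly_free ce.
(* F_3, F_5, F_8 and F_9 have a Hamiltonian cycle on 6 or 7 vertices, too many for a block; F_6 and
   F_7 are a diamond and a gem with two pendant vertices. *)
- by have := @block_cycle_le5 _ _ _ [:: 0; 1; 2; 3; 4; 5] ce isT isT isT isT.
- exact: block_net_free ce.
- by have := @block_cycle_le5 _ _ _ [:: 0; 1; 2; 4; 5; 3] ce isT isT isT isT.
- have hc := @block_two_pendants _ _ _ [:: 1; 2; 3; 5] 1 0 3 4 ce isT isT isT isT isT isT isT.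
  by vm_compute in hc.
- have hc := @block_two_pendants _ _ _ [:: 1; 2; 3; 4; 6] 1 0 4 5 ce isT isT isT isT isT isT isT.
  by vm_compute in hc.
- by have := @block_cycle_le5 _ _ _ [:: 0; 1; 2; 3; 6; 5; 4] ce isT isT isT isT.
- by have := @block_cycle_le5 _ _ _ [:: 0; 1; 2; 5; 4; 6; 3] ce isT isT isT isT.
Qed.

Lemma block_chordal : chordal G.
Proof.
move=> n n4 /(contains_copy (r := cyc n)) [|i j ij|e ce]; first nat_lia.
  by apply: symm_cyc => //; nat_lia.
have cl : cycle (fun i j => (i != j) && symr (cyc n) i j) (iota 0 n).
  case: n n4 ce => // n n4 ce; rewrite /= rcons_path path_iota /=; last first.
    by move=> j jn; rewrite /symr ltnSn /cyc eqxx; lia.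
  have -> : last 0 (iota 1 n) = n by case: n n4 {ce} => // n _; rewrite -(nth_last 0) size_iota nth_iota.
  by rewrite /symr ltn0 /cyc /= eqxx orbT andbT; lia.
have lm : all (gtn n) (iota 0 n) by apply/allP => i; rewrite mem_iota.
have n5 : n <= 5.
  by have := block_cycle_le5 ce lm (iota_uniq _ _) cl; rewrite size_iota; apply; nat_lia.
have [|T mT lT] := block_of_copy_cycle ce lm (iota_uniq _ _) cl; first by rewrite size_iota; nat_lia.
have [|hc _] := block_sub_has_copy mT ce lm (iota_uniq _ _) lT; first by rewrite size_iota.
rewrite size_iota in hc; have nE : n = 4 \/ n = 5 by nat_lia.
by case: nE hc => ->; move=> hc; vm_compute in hc.
Qed.

(** Some [z] outside [U] is joined to all of [U]. In the block of the triangle [z], [x], [y] no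
    vertex of [U] is a cut vertex, which leaves too few: at most [z] if the block is [K_3], and none
    in a gem, whose hub has degree at least 4. *)
Lemma block_homogeneous (U : {set G}) : nontrivial U -> homogeneous U -> independent U.
Proof.
move=> ntU hU x y xU yU; apply/negP => xy.
(* The first vertex outside [U] on a path leaving [U] has a neighbour in [U], hence is joined to all
   of it. *)
have [z zU allz] : exists2 z, z \notin U & {in U, forall t, z -- t}.
  have [z0 z0U] : exists z, z \notin U.
    apply/existsP; rewrite -negb_forall; apply: contra ntU => /forallP UT.
    have -> : U = setT by apply/setP => t; rewrite UT inE.
    by rewrite cardsT !inE eqxx !orbT.
  have /connectP[p] := G_conn x z0; elim: p x xU {xy} => [|a p IH] x xU /=.
    by move=> _ E; rewrite E xU in z0U.
  move=> /andP[xa pa] E; have [aU|aU] := boolP (a \in U); first exact: (IH a).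
  by exists a => //; have [//|/(_ x xU)] := hU a aU; rewrite sg_sym xa.
have [zx zy] := (allz x xU, allz y yU).
have [||T mT sT] := @block_of_cycle G [:: z; x; y] => //.
  by rewrite /ucycle /= zx xy sg_sym zy !inE negb_or !sedge_neq.
have [zT xT yT] : [/\ z \in T, x \in T & y \in T] by split; apply: sT; rewrite !inE eqxx ?orbT.
have T3 : 2 < #|T|.
  apply: leq_trans (_ : #|[set z; x; y]| <= _).
    by rewrite -setUA cardsU1 !inE negb_or !sedge_neq // cards2 sedge_neq.
  by apply/subset_leq_card/subsetP => t; rewrite !inE => /orP[/orP[]|] /eqP ->.
(* A neighbour outside T would be adjacent to two vertices of T. *)
have noext u w : u \in U -> u \in T -> u -- w -> w \in T.
  move=> uU uT uw; have [wU|wU] := boolP (w \in U).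
    by apply: (maxset_two_nbrs mT zT uT); rewrite ?(sedge_neq (allz u uU)) ?allz.
  have [aw|/(_ u uU)] := hU w wU; last by rewrite sg_sym uw.
  by apply: (maxset_two_nbrs mT xT yT (sedge_neq xy)); rewrite sg_sym aw.
have nT : nonsep T by have /maxsetP[] := mT.
have nocut u : u \in U -> u \in T -> ~~ cut_vertex u.
  move=> uU uT; apply/negP => /(cut_nbr_outside nT uT)[w uw].
  by rewrite (noext u w).
have [E|[T3' _ c2]|[e ce [TE c1]]] := block_shape mT; first by rewrite E in T3.
  have : cuts T \subset [set z].
    apply/subsetP => t; rewrite !inE => /andP[tT ct].
    have : t \in [set z; x; y].
      have -> // : [set z; x; y] = T.
      apply/eqP; rewrite eqEcard T3' -setUA cardsU1 !inE negb_or !sedge_neq // cards2 sedge_neq //= andbT.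
      by apply/subsetP => s; rewrite !inE => /or3P[] /eqP ->.
    rewrite !inE => /orP[/orP[]|] /eqP tE; rewrite tE ?eqxx // in ct *.
      by rewrite (negbTE (nocut x xU xT)) in ct.
    by rewrite (negbTE (nocut y yU yT)) in ct.
  by move=> /subset_leq_card; rewrite c2 cards1.
(* In a gem, U meets T in the four vertices other than the hub. *)
pose uv := [seq e i \in U | i <- iota 0 5].
have uvE i : i < 5 -> nth false uv i = (e i \in U).
  by move=> i5; rewrite (nth_map 0) ?size_iota // nth_iota.
pose adj i j := symr (band predT) i j.
have adjE i j : i < 5 -> j < 5 -> i != j -> e i -- e j = adj i j by apply: copy_symr.
have hom i j k : i < 5 -> j < 5 -> k < 5 -> nth false uv j -> nth false uv k ->
    ~~ nth false uv i -> adj i j = adj i k.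
  move=> i5 j5 k5; rewrite !uvE // => jU kU iU.
  have [ij ik] : i != j /\ i != k by split; apply: contraNneq iU => ->.
  by rewrite -!adjE //; have [H|H] := hU _ iU; rewrite ?H // !(negbTE (H _ _)).
have uv5 : uv == [:: true; true; false; true; true].
  have [i i5 xE] : exists2 i, i < 5 & x = e i by apply/copy_setP; rewrite -TE.
  have [j j5 yE] : exists2 i, i < 5 & y = e i by apply/copy_setP; rewrite -TE.
  have [k k5 zE] : exists2 i, i < 5 & z = e i by apply/copy_setP; rewrite -TE.
  have ui : nth false uv i by rewrite uvE // -xE.
  have uj : nth false uv j by rewrite uvE // -yE.
  have uk : ~~ nth false uv k by rewrite uvE // -zE.
  have aij : adj i j.
    by rewrite -adjE -?xE -?yE //; apply: contraTneq xy => E; rewrite xE yE E sg_irrefl.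
  suff /allP/(_ uv) : all (fun v : bitseq =>
     [&& has (fun i => has (fun j => [&& nth false v i, nth false v j & adj i j]) (iota 0 5)) (iota 0 5),
         has (fun i => ~~ nth false v i) (iota 0 5) &
         all (fun i => all (fun j => all (fun k => [&& nth false v j, nth false v k & ~~ nth false v i]
           ==> (adj i j == adj i k)) (iota 0 5)) (iota 0 5)) (iota 0 5)]
     ==> (v == [:: true; true; false; true; true])) (bitseqs 5).
    have -> : uv \in bitseqs 5 by apply: (mem_bitseqs uv).
    move=> /(_ isT)/implyP; apply; apply/and3P; split.
    - apply/hasP; exists i; rewrite ?mem_iota //; apply/hasP; exists j; rewrite ?mem_iota //.
      by rewrite ui uj.
    - by apply/hasP; exists k; rewrite ?mem_iota.
    - apply/allP => a; rewrite mem_iota => a5; apply/allP => b'; rewrite mem_iota => b5.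
      apply/allP => d; rewrite mem_iota => d5; apply/implyP => /and3P[? ? ?].
      by apply/eqP; apply: hom.
  by vm_compute.
have inU i : i < 5 -> (e i \in U) = (i != 2).
  by move=> i5; rewrite -uvE // (eqP uv5); case: i i5 => [|[|[|[|[|]]]]].
have hub : ~~ cut_vertex (e 2).
  apply: degree4_not_cut; apply: leq_trans (_ : #|copy_set 5 e :\ e 2| <= _).
    have := cardsD1 (e 2) (copy_set 5 e); rewrite (card_copy_set ce).
    by have -> : e 2 \in copy_set 5 e by [apply/copy_setP; exists 2]; nat_lia.
  apply/subset_leq_card/subsetP => t; rewrite !inE => /andP[t2 /copy_setP[i i5 tE]].
  rewrite tE adjE //; last by apply: contraNneq t2 => E; rewrite tE E.
  have : i != 2 by apply: contraNneq t2 => E; rewrite tE E.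
  by case: i i5 {tE} => [|[|[|[|[|]]]]].
have [c cE] := cards1P (introT eqP c1).
have : c \in cuts T by rewrite cE set11.
rewrite inE => /andP[cT cc]; have := cT; rewrite TE => /copy_setP[i i5 iE].
have [i2|i2] := eqVneq i 2; first by rewrite -i2 -iE cc in hub.
by have := nocut c; rewrite cc iE inU // i2 -iE cT => /(_ isT isT).
Qed.

End BlockGraph.

(** * The equivalence *)

Lemma iso_setT (G H : sgraph) : isomorphic (induced [set: G]) H <-> isomorphic G H.
Proof.
split=> -[h hb hE].
  have hv (x : G) : x \in [set: G] by rewrite inE.
  exists (fun x : G => h (Sub x (hv x))); last by move=> x y; rewrite hE.
  have [g gh hg] := hb; exists (fun y => val (g y)) => [x|y] /=; first by rewrite gh.
  by rewrite (_ : Sub _ _ = g y) ?hg //; apply: val_inj.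
exists (fun x => h (val x)); last by move=> x y; rewrite hE.
have [g gh hg] := hb; exists (fun y => Sub (g y) (in_setT (g y))) => [x|y] /=.
  by apply: val_inj; rewrite /= gh.
by rewrite hg.
Qed.

(* The vertices a, d, b, c, e, f of F8minus, in this order, form the square of a path. *)
Definition F8minus_edges : seq (nat * nat) :=
  [:: (1,2); (1,4); (2,4); (2,3); (2,5); (3,4); (3,5); (3,6); (5,6)].

Lemma F8minus_of_sq6 (G : sgraph) (f : nat -> G) :
  copy 6 (band predT) f -> (forall x, x \in copy_set 6 f) -> isomorphic G F8minus.
Proof.
move=> cf full; pose p a := nth 0 [:: 0; 2; 3; 1; 4; 5] a.
have p6 a : a < 6 -> p a < 6 by case: a => [|[|[|[|[|[|]]]]]].
have cp : copy 6 (prel F8minus_edges) (fun a => f (p a)).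
  apply: (copy_relabel (p := p) cf); first exact: p6.
  by move=> [|[|[|[|[|[|?]]]]]] [|[|[|[|[|[|?]]]]]] //=; rewrite ?andbF.
have TE : copy_set 6 (fun a => f (p a)) = [set: G].
  apply/setP => x; rewrite inE; have /copy_setP[a a6 ->] := full x; apply/copy_setP.
  case: a a6 => [|[|[|[|[|[|]]]]]] // _; [exists 0|exists 3|exists 1|exists 2|exists 4|exists 5] => //.
apply/iso_setT; rewrite -TE; apply: (copy_iso cp) => i j ij.
exact: (@symm_prel 6 F8minus_edges).
Qed.

Lemma chain_of_F8minus (G : sgraph) : isomorphic G F8minus -> chain G.
Proof.
move=> /iso_setT iso; have [|e ce TE] := iso_copy (m := 6) (r := prel F8minus_edges) isT iso.
  by move=> i j ij; apply: (@symm_prel 6 F8minus_edges).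
pose p a := nth 0 [:: 0; 3; 1; 2; 4; 5] a.
exists 6, (gtn 4), (fun a => e (p a)); split=> //; last by right.
split.
  apply: (copy_relabel (p := p) ce); first by case=> [|[|[|[|[|[|]]]]]].
  by move=> [|[|[|[|[|[|?]]]]]] [|[|[|[|[|[|?]]]]]] //=; rewrite ?andbF.
move=> x; have := in_setT x; rewrite TE => /copy_setP[a a6 ->]; apply/copy_setP.
by case: a a6 => [|[|[|[|[|[|]]]]]] // _; [exists 0|exists 2|exists 3|exists 1|exists 4|exists 5].
Qed.

Lemma not_contains_of_free (G : sgraph) :
  (forall m r, List.In (m, r) F_patterns -> forall e : nat -> G, ~ copy m r e) ->
  ~ contains_induced G F1 /\ ~ contains_induced G F2 /\ ~ contains_induced G F3 /\
  ~ contains_induced G F4 /\ ~ contains_induced G F5 /\ ~ contains_induced G F6 /\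
  ~ contains_induced G F7 /\ ~ contains_induced G F8 /\ ~ contains_induced G F9.
Proof.
move=> fr; have no k es : List.In (k, prel es : rel nat) F_patterns -> 0 < k ->
    ~ contains_induced G (graph_of_edges k es).
  move=> /fr no k0 /(contains_copy (r := prel es) k0)[i j|e /no//].
  exact: symm_prel.
by repeat (split; first by apply: no => //=; tauto); apply: no => //=; tauto.
Qed.

Theorem theorem2 (G : sgraph) (G_nonempty : 0 < #|G|)
    (G_no_isolated : no_isolated_vertex G) :
  let cond_i := tree (gallai G) in
  let cond_ii :=
    (forall U : {set G}, nontrivial U -> homogeneous U -> independent U) /\
    chordal G /\
    ~ contains_induced G F1 /\ ~ contains_induced G F2 /\ ~ contains_induced G F3 /\
    ~ contains_induced G F4 /\ ~ contains_induced G F5 /\ ~ contains_induced G F6 /\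
    ~ contains_induced G F7 /\ ~ contains_induced G F8 /\ ~ contains_induced G F9 in
  let cond_iii :=
    isomorphic G F8minus \/
    (connected G /\
     (forall B : subgraph G, block B ->
        isomorphic (graph_of B) (complete_graph 2) \/
        isomorphic (graph_of B) (complete_graph 3) \/
        isomorphic (graph_of B) gem) /\
     (forall v : G, cut_vertex v -> #|blocks_at v| <= 2 /\ degree v <= 3) /\
     (forall B : subgraph G, block B ->
        isomorphic (graph_of B) (complete_graph 3) -> #|cut_vertices_in B| = 2) /\
     (forall B : subgraph G, block B ->
        isomorphic (graph_of B) gem -> #|cut_vertices_in B| = 1)) in
  (cond_i <-> cond_ii) /\ (cond_ii <-> cond_iii).
Proof.
move=> cond_i cond_ii cond_iii.
have i_ii : cond_i -> cond_ii.
  move=> [conn acyc]; split; first by move=> U; apply: gallai_homogeneous.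
  split; first exact: gallai_chordal.
  by apply: not_contains_of_free => m r; apply: gallai_F_free.
have ii_chain : cond_ii -> chain G.
  by move=> [hom [chd nF]]; apply: chain_of_ii => //; apply: free_of_not_contains.
have iii_ii : cond_iii -> cond_ii.
  (* The block argument does not apply to F_8^-; its layout shows that the Gallai graph is a tree,
     and (i) gives (ii). *)
  move=> [/chain_of_F8minus/tree_of_chain/i_ii //|[/andP[_ /forallP conn] [iso [cut [K3 gm]]]]].
  have G_conn (x y : G) : connect sedge x y by have /forallP := conn x.
  split; first by move=> U; apply: block_homogeneous.
  split; first exact: block_chordal.
  by apply: not_contains_of_free; apply: block_F_free.
have chain_iii : chain G -> cond_iii.
  move=> [n [b [f [lay n1 [[pre [suf [c [bE n6 n10 cP]]]]|[n6 b4]]]]]]; last first.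
    left; case: lay; rewrite n6 => cf full; apply: (F8minus_of_sq6 (f := f)) => //.
    by apply: copy_eq cf => i j ij; rewrite /band b4 /=; lia.
  right; split.
    rewrite /connected G_nonempty; apply/forallP => x; apply/forallP => y.
    exact: layout_connect lay n1 x y.
  split; first exact: chain_block_iso n1 bE n6 n10 cP _ _ lay.
  split; first exact: chain_cut_vertex n1 bE n6 n10 cP _ _ lay.
  split; first exact: chain_block_K3 n1 bE n6 n10 cP _ _ lay.
  exact: chain_block_gem n1 bE n6 n10 cP _ _ lay.
split; split=> // H; first by apply: tree_of_chain; apply: ii_chain.
by apply: chain_iii; apply: ii_chain.
Qed.
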